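(* Let $\mathbf{X}=\{(x,y)\in\mathbb{R}^2 : xy>0\}$. There exists $s_\circ\in(0,1/2)$ such that, for every $s\in(0,s_\circ)$, $\mathbf{X}$ is unstable (that is, not stable) in $\mathbb{R}^2\setminus\{0\}$.
   Context: Fractional perimeter. For $s\in(0,1)$, a bounded open set $\Omega\subset\mathbb{R}^n$ and a measurable set $E\subset\mathbb{R}^n$, with $\Omega^c=\mathbb{R}^n\setminus\Omega$, $$\mathrm{Per}_s(E,\Omega) := \frac12 \iint_{(\mathbb{R}^n\times\mathbb{R}^n)\setminus(\Omega^c\times\Omega^c)} \frac{|\chi_E(x)-\chi_E(y)|^2}{|x-y|^{n+s}}\,dx\,dy .$$ $s$-minimal surface. Let $\mathcal U\subset\mathbb{R}^n$ be open. A set $E$ is an $s$-minimal surface in $\mathcal U$ if for every bounded Lipschitz domain $\Omega\Subset\mathcal U$ one has $\mathrm{Per}_s(E,\Omega)<+\infty$ and $\frac{d}{dt}\big|_{t=0}\mathrm{Per}_s(\phi_t^X(E),\Omega)=0$ for all $X\in C_c^2(\Omega;\mathbb{R}^n)$, where $\phi_t^X:\Omega\to\Omega$ is the flow of $X$ at time $t$ (extended by the identity outside $\Omega$). The set $\mathbf{X}$ is an $s$-minimal surface for every $s\in(0,1)$. Stability. Let $E$ be an $s$-minimal surface in the open set $\mathcal U$. $E$ is stable in $\mathcal U$ if for every bounded Lipschitz domain $\Omega\Subset\mathcal U$ $$\delta^2\mathrm{Per}_s(E,\Omega)[X] := \frac{d^2}{dt^2}\Big|_{t=0}\mathrm{Per}_s(\phi_t^X(E),\Omega)\ge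 0 \quad\text{for all } X\in C_c^2(\Omega;\mathbb{R}^n).$$ *)

(* Defs.v *)
From HB Require Import structures.
From mathcomp Require Import all_boot all_order all_algebra.
From mathcomp Require Import all_classical all_reals all_analysis.

Set Implicit Arguments.
Unset Strict Implicit.
Unset Printing Implicit Defensive.

Import Order.TTheory GRing.Theory Num.Theory.
Import numFieldNormedType.Exports.

Local Open Scope classical_set_scope.
Local Open Scope ring_scope.

(* The norm that the library puts on a product type is the max norm, so the
   Euclidean norm is spelled out. The topology and the notions of derivative
   on R * R do not depend on this choice. *)
Definition enorm (R : realType) (x : R * R) : R :=
  Num.sqrt (x.1 ^+ 2 + x.2 ^+ 2).

Notation leb2 R := (@lebesgue_measure R \x @lebesgue_measure R)%E.

(* At z.1 = z.2 the integrand is 0 / 0 = 0; the diagonal is Lebesgue-null. *)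
Definition Per (R : realType) (s : R) (E Omega : set (R * R)) : \bar R :=
  ((2^-1)%:E *
   \int[leb2 R \x leb2 R]_(z in ~` (~` Omega `*` ~` Omega))
     (`|\1_E z.1 - \1_E z.2| ^+ 2 / enorm (z.1 - z.2) `^ (2 + s))%:E)%E.

(* Omega coincides near each boundary point p with the strict epigraph of a
   Lipschitz function, in the orthonormal frame (e, e') with e' the rotation of
   e by a right angle. A reflection of the frame can be absorbed in gamma, so
   rotations are enough. *)
Definition lipschitz_boundary (R : realType) (Omega : set (R * R)) : Prop :=
  forall p : R * R, (closure Omega `\` interior Omega) p ->
  exists (e : R * R) (r : R) (gamma : R -> R),
    [/\ enorm e = 1, 0 < r, lipschitz gamma &
      forall x : R * R, enorm (x - p) < r ->
        (Omega x <->
         gamma (x.1 * e.1 + x.2 * e.2) < x.2 * e.1 - x.1 * e.2)].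

Definition bounded_lipschitz_domain (R : realType) (Omega : set (R * R)) :
    Prop :=
  [/\ open Omega, Omega !=set0, connected Omega, bounded_set Omega &
      lipschitz_boundary Omega].

Definition compactly_contained (T : topologicalType) (A B : set T) : Prop :=
  compact (closure A) /\ closure A `<=` B.

Fixpoint is_Ck (R : realType) (V W : normedModType R) (k : nat) (f : V -> W) :
    Prop :=
  match k with
  | 0%N => continuous f
  | k'.+1 => (forall x, differentiable f x) /\ forall v, is_Ck k' ('D_v f)
  end.

(* A field in C_c^k(Omega; R^2) is represented by its extension by 0. *)
Definition is_Ckc (R : realType) (k : nat) (Omega : set (R * R))
    (X : R * R -> R * R) : Prop :=
  is_Ck k X /\ compactly_contained [set x | X x != 0] Omega.

(* The flow of the extension by 0 of X is the identity outside Omega. *)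
Definition is_flow (R : realType) (X : R * R -> R * R)
    (phi : R -> R * R -> R * R) : Prop :=
  forall x, phi 0 x = x /\
    forall t : R, is_derive t 1 (phi ^~ x) (X (phi t x)).

Definition Per_along (R : realType) (s : R) (E Omega : set (R * R))
    (phi : R -> R * R -> R * R) (t : R) : \bar R :=
  Per s (phi t @` E) Omega.

(* The second derivative at 0 of t |-> Per s (phi t @` E) Omega exists and is
   equal to d. *)
Definition is_second_variation (R : realType) (s : R) (E Omega : set (R * R))
    (phi : R -> R * R -> R * R) (d : R) : Prop :=
  let P := fun t => fine (Per_along s E Omega phi t) in
  (\forall t \near (0 : R),
     (Per_along s E Omega phi t < +oo)%E /\ derivable P t 1) /\
  is_derive (0 : R) 1 (derive1 P) d.

(* The usual standing assumption that E is s-minimal in U is not part of the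
   predicate: its negation thus always exhibits a direction of strictly
   negative second variation. *)
Definition stable (R : realType) (s : R) (E U : set (R * R)) : Prop :=
  forall Omega : set (R * R),
    bounded_lipschitz_domain Omega -> compactly_contained Omega U ->
  forall X : R * R -> R * R, is_Ckc 2 Omega X ->
  forall phi : R -> R * R -> R * R, is_flow X phi ->
  forall d : R, is_second_variation s E Omega phi d -> 0 <= d.

Definition cross (R : realType) : set (R * R) := [set z | 0 < z.1 * z.2].
Arguments cross R : clear implicits.

(* Main.v *)
From HB Require Import structures.
Require Import Defs.
From mathcomp Require Import all_boot all_order all_algebra.
From mathcomp Require Import all_classical all_reals all_analysis.
From mathcomp Require Import measurable_realfun ring lra.

Set Implicit Arguments.
Unset Strict Implicit.
Unset Printing Implicit Defensive.

Import Order.TTheory GRing.Theory Num.Theory.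
Import numFieldNormedType.Exports.

Local Open Scope classical_set_scope.
Local Open Scope ring_scope.

(** The cross is pushed vertically, by the flow of a field
    X (x, y) = (0, plateau A x * cutoff y) that lives near the positive
    horizontal half-axis only. Since the cut-off is 1 near the axis, for |t| <= 1
    the deformed cross is bounded by the graph of u = t * plateau A over x > 0:
    it consists of the upper half-lines y > u x in the columns x > 0, and of the
    lower half-lines y < 0 in the columns x < 0.

    The perimeter is an integral over pairs of columns x, x' and vertical offsets
    z of the kernel (|x - x'|^2 + z^2)^-(1 + s / 2), times the length of the
    heights y at which (x, y) and (x', y - z) are separated by the boundary
    ([Per_columns]). If x and x' have the same sign, both columns are half-lines
    with the same orientation, and this length is |v - z| with v = u x - u x'. If
    the signs are opposite, one of the half-lines is reversed, and the length is
    a constant minus |v - z|; the part of the columns that is not seen from the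
    domain does not depend on t. Because the kernel is even, |v - z| - |z| may be
    replaced by its even part max(0, |v| - |z|). The shift v therefore costs
    energy on pairs with the same sign and gains exactly the same expression on
    pairs with opposite signs ([pair_energy_same], [pair_energy_opp]). Rescaling
    z by |v| gives this expression as
    t^2 * density (x, x') * (a mass that tends to [bump_mass] as t tends to 0),
    where density (x, x') = (plateau x - plateau x')^2 / |x - x'|^(2 + s). Hence
    the second variation exists and equals [bump_mass] times the integral of the
    density over x * x' > 0 minus its integral over x * x' < 0
    ([second_derive_box_perimeter]).

    It remains to choose the plateau. It is a difference of a ramp at scale 1 and
    a ramp at scale A. By scaling, the energy of a ramp over the pairs of points
    of one half-line is bounded independently of A and of s <= 1/2
    ([energy_same_le]). On the other hand, over the pairs of opposite sign the
    density is |x - x'|^-(2 + s) as soon as 5 <= x <= 2 * A, and its integral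
    grows like log A as long as s * log A stays bounded ([energy_opposite_ge]).
    So a large A, and then a small s, make the second variation negative.

    The rest of the proof provides the required data: the perimeter of the cross
    is finite ([base_energy_lty]), the derivatives pass under the integral sign
    ([is_derive_derive1_quadratic_integral]), the cut-off is C^2 and its flow is
    explicit ([line_flow]), and the domain is a square that avoids the origin
    ([bounded_lipschitz_domain_square]). *)

(** * Affine changes of variable for the Lebesgue measure *)

Section affine.
Context {R : realType}.
Local Notation mu := (@lebesgue_measure R).
Local Open Scope ereal_scope.

Lemma measurable_affine (a b : R) :
  measurable_fun [set: measurableTypeR R] (fun x : measurableTypeR R => (a * x + b)%R : measurableTypeR R).
Proof.
by apply: measurable_funD => //; apply: measurable_funM.
Qed.

(** Both sides are measures in A, and they agree on the half-open intervals,
    so the uniqueness of the Lebesgue measure applies. *)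
Lemma lebesgue_measure_affine (a b : R) (A : set R) : (0 < a)%R ->
  measurable A ->
  mu A = a%:E * mu ((fun x : measurableTypeR R => (a * x + b)%R : measurableTypeR R) @^-1` A).
Proof.
move=> a0 mA.
have a'0 : (0 <= a)%R by exact: ltW.
pose phi := (fun x : measurableTypeR R => (a * x + b)%R : measurableTypeR R).
have mphi : measurable_fun setT phi by exact: measurable_affine.
pose phi' : {mfun measurableTypeR R >-> measurableTypeR R} :=
  HB.pack phi (isMeasurableFun.Build _ _ _ _ _ mphi).
pose m0 := mscale (NngNum a'0) (pushforward mu phi).
pose m : {measure set (measurableTypeR R) -> \bar R} := m0 mphi.
suff H X : ocitv X -> mu X = m X.
  exact: (lebesgue_measure_unique H).
move=> [[p q]] _ <-.
rewrite [RHS](_ : _ = a%:E * mu (phi @^-1` `]p, q])) //.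
have -> : phi @^-1` `]p, q] = `]((p - b) / a)%R, ((q - b) / a)%R]%classic.
  apply/seteqP; split => x /=; rewrite !in_itv/= /phi ltr_pdivrMr// ler_pdivlMr//
    ltrBlDr lerBrDr [(x * a)%R]mulrC//.
rewrite !lebesgue_measure_itv/= !lte_fin ltr_pM2r ?invr_gt0// ltrD2r.
case: ifP => _; last by rewrite mule0.
by rewrite -!EFinD -EFinM; congr EFin; field; rewrite gt_eqF.
Qed.

Lemma ge0_integral_affine (a b : R) (f : R -> \bar R) : (0 < a)%R ->
  measurable_fun setT f -> (forall x, 0 <= f x) ->
  \int[mu]_x f x = a%:E * \int[mu]_x f (a * x + b)%R.
Proof.
move=> a0 mf f0.
have a'0 : (0 <= a)%R by exact: ltW.
pose phi := (fun x : measurableTypeR R => (a * x + b)%R : measurableTypeR R).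
have mphi : measurable_fun setT phi by exact: measurable_affine.
pose phi' : {mfun measurableTypeR R >-> measurableTypeR R} :=
  HB.pack phi (isMeasurableFun.Build _ _ _ _ _ mphi).
pose m0 := mscale (NngNum a'0) (pushforward mu phi).
pose m : {measure set (measurableTypeR R) -> \bar R} := m0 mphi.
transitivity (\int[m]_x f x).
  by apply: eq_measure_integral => A mA _; rewrite /m/= /mscale/= -lebesgue_measure_affine.
rewrite ge0_integral_mscale//=; congr (_ * _).
by rewrite ge0_integral_pushforward.
Qed.

Lemma ge0_integral_opp (f : R -> \bar R) :
  measurable_fun setT f -> (forall x, 0 <= f x) ->
  \int[mu]_x f x = \int[mu]_x f (- x)%R.
Proof.
move=> mf f0.
transitivity (\int[pushforward mu (-%R : _ -> measurableTypeR R)]_x f x).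
  by apply: eq_measure_integral => //= A mA _; exact/esym/lebesgue_measureN.
by rewrite ge0_integral_pushforward.
Qed.

Lemma ge0_integral_subl (c : R) (f : R -> \bar R) :
  measurable_fun setT f -> (forall x, 0 <= f x) ->
  \int[mu]_x f x = \int[mu]_x f (c - x)%R.
Proof.
move=> mf f0.
rewrite (@ge0_integral_affine 1 c f)// mul1e.
rewrite ge0_integral_opp//; last first.
  apply: measurableT_comp => //; exact: measurable_affine.
by apply: eq_integral => x _; rewrite mul1r addrC.
Qed.

Lemma ge0_integral_shift (c : R) (f : R -> \bar R) :
  measurable_fun setT f -> (forall x, 0 <= f x) ->
  \int[mu]_x f x = \int[mu]_x f (x + c)%R.
Proof.
move=> mf f0.
by rewrite (@ge0_integral_affine 1 c f)// mul1e; under eq_integral do rewrite mul1r.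
Qed.

End affine.

(** * Tonelli for products of product measures *)

Section product_sigma_finite.
Local Open Scope ereal_scope.
Context {R : realType} {d1 d2 : measure_display}.
Context {T1 : measurableType d1} {T2 : measurableType d2}.
Variables (m1 : {sigma_finite_measure set T1 -> \bar R}).
Variables (m2 : {sigma_finite_measure set T2 -> \bar R}).

(** An iterated product of measures is only usable with Tonelli once each
    binary product is known to be sigma-finite: products of the pieces of two
    nondecreasing exhaustions exhaust the product. *)
Lemma product_measure_sigma_finite : sigma_finite setT (m1 \x m2).
Proof.
have /sigma_finiteP[F [TF ndF Foo]] := sigma_finiteT m1.
have /sigma_finiteP[G [TG ndG Goo]] := sigma_finiteT m2.
exists (fun n => F n `*` G n); last first.
  move=> k; have [mF Fk] := Foo k; have [mG Gk] := Goo k.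
  split; first exact: measurableX.
  by rewrite product_measure1E// lte_mul_pinfty// ge0_fin_numE.
apply/esym/seteqP; split => // -[x y] _.
have [n _ Fnx] : (\bigcup_n F n) x by rewrite -TF.
have [k _ Gky] : (\bigcup_n G n) y by rewrite -TG.
exists (maxn n k) => //; split => /=.
- by move: x Fnx; exact/subsetPset/ndF/leq_maxl.
- by move: y Gky; exact/subsetPset/ndG/leq_maxr.
Qed.

Definition product_sfm : {sigma_finite_measure set (T1 * T2)%type -> \bar R} :=
  HB.pack_for {sigma_finite_measure set (T1 * T2)%type -> \bar R} (m1 \x m2)
    (Measure_isSigmaFinite.Build _ _ _ (m1 \x m2) product_measure_sigma_finite).

End product_sigma_finite.

Section swap.
Local Open Scope ereal_scope.
Context {R : realType} {d1 d2 d3 d4 : measure_display}.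
Context {T1 : measurableType d1} {T2 : measurableType d2}.
Context {T3 : measurableType d3} {T4 : measurableType d4}.
Variables (m1 : {sigma_finite_measure set T1 -> \bar R}).
Variables (m2 : {sigma_finite_measure set T2 -> \bar R}).
Variables (m3 : {sigma_finite_measure set T3 -> \bar R}).
Variables (m4 : {sigma_finite_measure set T4 -> \bar R}).

(** This turns an integral over pairs of points of the plane into an integral
    over pairs of vertical lines, and then over pairs of points of these lines. *)
Lemma integral_swap_middle (F : (T1 * T2) * (T3 * T4) -> \bar R) :
  measurable_fun setT F -> (forall z, 0 <= F z) ->
  \int[(m1 \x m2) \x (m3 \x m4)]_z F z =
  \int[m1 \x m3]_p \int[m2 \x m4]_q F ((p.1, q.1), (p.2, q.2)).
Proof.
move=> mF F0.
have mF1 : measurable_fun setT (fun w : ((T1 * T2) * T3) * T4 => F (w.1.1, (w.1.2, w.2))).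
  apply: measurableT_comp => //.
  apply: measurable_fun_pair; first by apply: measurableT_comp => //; exact: measurableT_comp.
  apply: measurable_fun_pair => //; exact: measurableT_comp.
have mF2 : measurable_fun setT (fun w : (T1 * T3) * (T2 * T4) => F ((w.1.1, w.2.1), (w.1.2, w.2.2))).
  apply: measurableT_comp => //.
  by apply: measurable_fun_pair; apply: measurable_fun_pair; exact: measurableT_comp.
pose H (w : (T1 * T2) * T3) := \int[m4]_y' F (w.1, (w.2, y')).
have mH : measurable_fun setT H.
  exact: (measurable_fun_fubini_tonelli_F (m2 := m4) (fun w : ((T1 * T2) * T3) * T4 => F (w.1.1, (w.1.2, w.2)))).
have H0 w : 0 <= H w by apply: integral_ge0.
transitivity (\int[m1]_x \int[m3]_x' \int[m2]_y \int[m4]_y' F ((x, y), (x', y'))).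
  pose m12 : {sigma_finite_measure set (T1 * T2)%type -> \bar R} := product_sfm m1 m2.
  pose m34 : {sigma_finite_measure set (T3 * T4)%type -> \bar R} := product_sfm m3 m4.
  rewrite [LHS](fubini_tonelli1 (m1 := m12) (m2 := m34) F)//.
  rewrite [LHS](fubini_tonelli1 (m1 := m1) (m2 := m2) (fubini_F m34 F))//; last 2 first.
  - exact: measurable_fun_fubini_tonelli_F.
  - by move=> z; apply: integral_ge0.
  apply: eq_integral => x _.
  transitivity (\int[m2]_y \int[m3]_x' H ((x, y), x')).
    apply: eq_integral => y _ /=.
    rewrite /fubini_F fubini_tonelli1//.
    exact: measurableT_comp.
  rewrite (fubini_tonelli (m1 := m2) (m2 := m3) (fun w : T2 * T3 => H ((x, w.1), w.2)))//.
  apply: measurableT_comp => //.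
  by apply: measurable_fun_pair => //; apply: measurable_fun_pair.
pose G p := \int[m2 \x m4]_q F ((p.1, q.1), (p.2, q.2)).
have mG : measurable_fun setT G.
  exact: (measurable_fun_fubini_tonelli_F (m2 := product_sfm m2 m4)
   (fun w : (T1 * T3) * (T2 * T4) => F ((w.1.1, w.2.1), (w.1.2, w.2.2)))).
have G0 p : 0 <= G p by apply: integral_ge0.
rewrite [RHS](@fubini_tonelli1 _ _ _ _ _ m1 m3 G mG G0).
apply: eq_integral => x _; apply: eq_integral => x' _ /=.
rewrite /fubini_F /G fubini_tonelli1//.
apply: measurableT_comp => //.
by apply: measurable_fun_pair; apply: measurable_fun_pair.
Qed.

End swap.

Section column_pair.
Context {R : realType}.
Local Notation mu := (@lebesgue_measure R).
Local Open Scope ereal_scope.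

(** The kernel only sees the vertical offset z = y - y', so it is worth
    integrating in y at fixed z first. *)
Lemma integral_column_pair (F : R * R -> \bar R) :
  measurable_fun setT F -> (forall z, 0 <= F z) ->
  \int[leb2 R]_q F q = \int[mu]_z \int[mu]_y F (y, y - z)%R.
Proof.
move=> mF F0; rewrite [LHS](@fubini_tonelli1 _ _ _ _ _ mu mu F mF F0).
pose T := measurableTypeR R.
transitivity (\int[mu]_y \int[mu]_z F (y, (y - z)%R)).
  apply: eq_integral => y _; rewrite /fubini_F [LHS](ge0_integral_subl y)//.
  by apply: (measurableT_comp mF); exact: measurable_fun_pair.
apply: (fubini_tonelli (m1 := mu) (m2 := mu) (fun w : T * T => F (w.1, (w.1 - w.2)%R)))=> //.
apply: (measurableT_comp mF).
apply: measurable_fun_pair => //.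
exact: measurable_funB.
Qed.

End column_pair.

(** * The perimeter as an integral over pairs of columns *)

Section graph.
Context {R : realType}.
Local Notation mu := (@lebesgue_measure R).

(** The cross, with the half-axis x > 0 of its boundary replaced by the graph
    of u. The columns x > 0 are upper half-lines and the columns x < 0 are lower
    half-lines: this opposite orientation is the source of the instability. *)
Definition in_graph_cross (u : R -> R) (q : R * R) : bool :=
  (0 < q.1) && (u q.1 < q.2) || (q.1 < 0) && (q.2 < 0).

Definition in_box (a b r : R) (q : R * R) : bool :=
  [&& a < q.1, q.1 < b, - r < q.2 & q.2 < r].

(** With p = 1 + s / 2 this is |(d, z)|^-(2 + s). *)
Definition kern (p d z : R) : R := (d ^+ 2 + z ^+ 2) `^ (- p).

Lemma kern_ge0 p d z : 0 <= kern p d z.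
Proof. exact: powR_ge0. Qed.

Lemma kernN p d z : kern p d (- z) = kern p d z.
Proof. by rewrite /kern sqrrN. Qed.

Lemma measurable_powRcomp dd (T : measurableType dd) (f : T -> R) (p : R) :
  measurable_fun setT f -> measurable_fun setT (fun x => f x `^ p).
Proof.
by move=> mf; apply: (measurableT_comp (measurable_powR p)).
Qed.

Lemma measurable_kern dd (T : measurableType dd) p (f g : T -> R) :
  measurable_fun setT f -> measurable_fun setT g ->
  measurable_fun setT (fun x => kern p (f x) (g x)).
Proof.
move=> mf mg; apply: measurable_powRcomp; apply: measurable_funD; exact: measurable_funX.
Qed.

Lemma measurable_in_graph_cross dd (T : measurableType dd) u (f g : T -> R) :
  measurable_fun setT u -> measurable_fun setT f -> measurable_fun setT g ->
  measurable_fun setT (fun x => in_graph_cross u (f x, g x)).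
Proof.
move=> mu mf mg; apply: measurable_or; apply: measurable_and;
  apply: measurable_fun_ltr => //.
exact: measurableT_comp.
Qed.

Lemma measurable_in_box dd (T : measurableType dd) a b r (f g : T -> R) :
  measurable_fun setT f -> measurable_fun setT g ->
  measurable_fun setT (fun x => in_box a b r (f x, g x)).
Proof.
move=> mf mg; do 3 (apply: measurable_and; first exact: measurable_fun_ltr).
exact: measurable_fun_ltr.
Qed.

(** The pairs of points that contribute to the perimeter in the box. *)
Definition differ (a b r : R) (u : R -> R) (q q' : R * R) : bool :=
  (in_box a b r q || in_box a b r q') &&
  (in_graph_cross u q (+) in_graph_cross u q').

Lemma measurable_differ dd (T : measurableType dd) a b r u (f g f' g' : T -> R) :
  measurable_fun setT u ->
  measurable_fun setT f -> measurable_fun setT g ->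
  measurable_fun setT f' -> measurable_fun setT g' ->
  measurable_fun setT (fun x => differ a b r u (f x, g x) (f' x, g' x)).
Proof.
move=> mu mf mg mf' mg'; apply: measurable_and.
  by apply: measurable_or; exact: measurable_in_box.
rewrite (_ : (fun _ => _) = (fun x => if in_graph_cross u (f x, g x)
   then ~~ in_graph_cross u (f' x, g' x) else in_graph_cross u (f' x, g' x))); last first.
  by apply/funext => x; case: in_graph_cross.
apply: measurable_fun_ifT; [exact: measurable_in_graph_cross| |exact: measurable_in_graph_cross].
apply: measurable_neg; exact: measurable_in_graph_cross.
Qed.

(** Of the points at vertical offset z in the columns x and x', the length of
    those that contribute to the perimeter. *)
Definition column_length (a b r : R) (u : R -> R) (x x' z : R) : \bar R :=
  mu [set y | differ a b r u (x, y) (x', y - z)].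

Lemma measurable_differ_col a b r u x x' z : measurable_fun setT u ->
  measurable [set y : measurableTypeR R | differ a b r u (x, y) (x', y - z)].
Proof.
move=> mu'.
have := @measurable_differ _ (measurableTypeR R) a b r u (cst x) id (cst x') (fun y => y - z) mu'
  (measurable_cst _) (@measurable_id _ _ _) (measurable_cst _).
move=> /(_ _ measurableT [set true]).
rewrite setTI; apply => //; exact: measurable_funB.
Qed.

(** The four coordinates are regrouped so that the innermost integration is over
    the height y at fixed columns and fixed vertical offset, where the kernel is
    constant. *)
Lemma Per_columns s a b r u : measurable_fun setT u ->
  Per s [set q | in_graph_cross u q] [set q | in_box a b r q] =
  ((2^-1)%:E * \int[leb2 R]_p \int[mu]_z
     ((kern (1 + s / 2) (p.1 - p.2) z)%:E * column_length a b r u p.1 p.2 z))%E.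
Proof.
move=> mu'; rewrite /Per; congr (_ * _)%E.
pose T := measurableTypeR R.
pose F (w : (T * T) * (T * T)) : \bar R := (if differ a b r u w.1 w.2 then
    kern (1 + s / 2) (w.1.1 - w.2.1) (w.1.2 - w.2.2) else 0)%:E.
have mF : measurable_fun setT F.
  apply/measurable_EFinP; apply: measurable_fun_ifT => //.
    rewrite (_ : (fun _ => _) = (fun w : (T * T) * (T * T) => differ a b r u (w.1.1, w.1.2) (w.2.1, w.2.2))).
      by apply: measurable_differ => //; apply: measurableT_comp.
    by apply/funext => -[[? ?] [? ?]].
  by apply: measurable_kern; apply: measurable_funB; exact: measurableT_comp.
have F0 w : (0 <= F w)%E.
  by rewrite lee_fin; case: ifP => // _; exact: kern_ge0.
have indE q : \1_[set q | in_graph_cross u q] q = (in_graph_cross u q)%:R :> R.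
  by rewrite indicE; congr ((nat_of_bool _)%:R); apply/idP/idP; rewrite inE.
transitivity (\int[leb2 R \x leb2 R]_w F w)%E.
  pose m2 := product_sfm mu mu.
  rewrite [LHS](integral_mkcond (mu := product_sfm m2 m2)).
  apply: eq_integral => -[[x y] [x' y']] _ /=.
  rewrite patchE /F /differ/=.
  have -> : ((x, y, (x', y')) \in ~` (~` [set q | in_box a b r q] `*` ~` [set q | in_box a b r q])) =
     (in_box a b r (x, y) || in_box a b r (x', y')).
    apply/idP/idP; last by move=> /orP[] h; rewrite inE => -[] /=.
    rewrite inE => H; case e1: (in_box a b r (x, y)) => //.
    case e2: (in_box a b r (x', y')) => //; exfalso.
    by apply: H; split; rewrite /= ?e1 ?e2.
  case: (in_box _ _ _ _ || _) => //=; congr EFin.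
  rewrite !indE /enorm /kern /=.
  have -> : Num.sqrt ((x - x') ^+ 2 + (y - y') ^+ 2) `^ (2 + s) =
      ((x - x') ^+ 2 + (y - y') ^+ 2) `^ (1 + s / 2).
    rewrite -powR12_sqrt ?addr_ge0 ?sqr_ge0// -powRrM; by congr (_ `^ _); field.
  rewrite powRN.
  case: (in_graph_cross u _); case: (in_graph_cross u _); rewrite /= ?subrr ?subr0 ?sub0r ?normrN ?normr1 ?normr0 ?expr1n ?mul1r ?expr0n ?mul0r//.
rewrite (integral_swap_middle mu mu mu mu mF F0).
apply: eq_integral => p _ /=.
rewrite integral_column_pair//; last first.
  by apply: (measurableT_comp mF); apply: measurable_fun_pair; apply: measurable_fun_pair.
apply: eq_integral => z _; rewrite /F /column_length /=.
set S := [set y | _].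
have mS : measurable (S : set (measurableTypeR R)) by exact: measurable_differ_col.
have -> : mu S = (\int[mu]_y (\1_S y)%:E)%E by rewrite integral_indic// setIT.
rewrite -ge0_integralZl_EFin//; last 2 first.
- exact/measurable_EFinP/measurable_indic.
- exact: kern_ge0.
apply: eq_integral => y _; rewrite -EFinM indicE (_ : y - (y - z) = z); last by rewrite opprB addrC subrK.
rewrite (_ : (y \in S) = differ a b r u (p.1, y) (p.2, y - z)); last by apply/idP/idP; rewrite inE.
by case: differ; rewrite ?mulr1 ?mulr0.
Qed.

End graph.

(** * How the deformation changes the length of a pair of columns *)

Section columns.
Context {R : realType}.
Local Notation mu := (@lebesgue_measure R).

Lemma lebesgue_measure_eqD1 (A B : set R) (y0 : R) :
  measurable A -> measurable B -> A `\ y0 = B `\ y0 -> mu A = mu B.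
Proof.
have H (C : set R) : measurable C -> mu C = mu (C `\ y0).
  move=> mC; have := measureDI mu (mC : measurable (C : set (measurableTypeR R))) (measurable_set1 y0).
  move=> ->; rewrite [X in (_ + X)%E](_ : _ = 0%E) ?adde0//.
  apply/eqP; rewrite eq_le measure_ge0 andbT -(lebesgue_measure_set1 y0).
  by apply: le_measure; rewrite ?inE//; exact: measurableI.
by move=> mA mB AB; rewrite H// [RHS]H// AB.
Qed.

(** Two upper half-lines differ by the segment between their end points. *)
Lemma lebesgue_measure_between (c e : R) :
  mu [set y | (c < y) (+) (e < y)] = `|c - e|%:E.
Proof.
have -> : [set y | (c < y) (+) (e < y)] = `]Num.min c e, Num.max c e]%classic.
  apply/seteqP; split=> y /=; rewrite in_itv/=;
    case: (ltP c y); case: (ltP e y); rewrite ?gt_min ?le_max => /= h1 h2;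
    rewrite ?h1 ?h2 ?orbT //= ?(ltNge _ c) ?(ltNge _ e) ?h1 ?h2//.
  - by rewrite !leNgt h1 h2.
  - by rewrite !ltNge h1 h2.
rewrite lebesgue_measure_itv/= lte_fin.
have [h|h] := leP c e; case: ltP => h'.
- by rewrite -EFinB ler0_norm ?subr_le0// opprB.
- by rewrite (@le_anti _ _ c e) ?h ?h'// subrr normr0.
- by rewrite -EFinB gtr0_norm ?subr_gt0.
- by move: h'; rewrite leNgt h.
Qed.

Variables (a b r : R) (u : R -> R).
Hypothesis a0 : 0 <= a.
Hypothesis r0 : 0 < r.
Hypothesis mu' : measurable_fun setT u.
Hypothesis u0 : forall x, ~~ (a < x < b) -> u x = 0.
Hypothesis ur : forall x, `|u x| < r.

(** S is the set of heights that are seen from the box. Replacing u by 0 only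
    moves boundary points of the set inside the box, so that outside S the sets bet
    for u and for 0 coincide: whatever the box cuts away cancels out. *)
Let S (x x' z : R) := [set y | in_box a b r (x, y) || in_box a b r (x', y - z)].
Let bet (v : R -> R) (x x' z : R) := [set y | (v x < y) (+) (v x' < y - z)].

Let outside x y : ~~ in_box a b r (x, y) -> (u x < y) = (0 < y).
Proof.
rewrite /in_box /= andbA; case: (boolP (a < x < b)) => [_ /=|/u0 -> //].
have := ur x; rewrite ltr_norml => /andP[h1 h2].
rewrite negb_and -!leNgt => /orP[h|h].
- by apply/idP/idP => h'; lra.
- by apply/idP/idP => h'; lra.
Qed.

Let u_neg x : x < 0 -> u x = 0.
Proof. by move=> x0; apply: u0; rewrite negb_and -!leNgt (ltW (lt_le_trans x0 a0)). Qed.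

Let box_neg x y : x < 0 -> in_box a b r (x, y) = false.
Proof. by move=> x0; rewrite /in_box /= ltNge (ltW (lt_le_trans x0 a0)). Qed.

Let mS x x' z : measurable (S x x' z : set (measurableTypeR R)).
Proof.
have : measurable_fun setT (fun y : measurableTypeR R => in_box a b r (x, y) || in_box a b r (x', y - z)).
  by apply: measurable_or; apply: measurable_in_box => //; exact: measurable_funB.
by move=> /(_ measurableT [set true]); rewrite setTI; apply.
Qed.

Let mbet v x x' z : measurable (bet v x x' z : set (measurableTypeR R)).
Proof.
have : measurable_fun setT (fun y : measurableTypeR R => (if v x < y then ~~ (v x' < y - z) else (v x' < y - z))).
  apply: measurable_fun_ifT; first exact: measurable_fun_ltr.
    by apply: measurable_neg; apply: measurable_fun_ltr => //; exact: measurable_funB.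
  by apply: measurable_fun_ltr => //; exact: measurable_funB.
move=> /(_ measurableT [set true]); rewrite setTI => /(_ I).
congr (measurable _); apply/seteqP; split => y /=; rewrite /bet/=; by case: (v x < y); case: (v x' < _).
Qed.

Let mu_bet v x x' z : mu (bet v x x' z) = `|v x - v x' - z|%:E.
Proof.
rewrite -(_ : [set y | (v x < y) (+) (v x' + z < y)] = bet v x x' z).
  by rewrite lebesgue_measure_between opprD addrA.
by apply/seteqP; split => y /=; rewrite /bet/= ltrBrDr.
Qed.

Let lost x x' z : bet u x x' z `\` S x x' z = bet (fun=> 0) x x' z `\` S x x' z.
Proof.
by apply/seteqP; split => y /= [] + /negP; rewrite negb_or => + /andP[h1 h2];
  rewrite /bet /= !outside// => h; split => //; apply/negP; rewrite negb_or h1 h2.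
Qed.

Let split_bet v x x' z : mu (bet v x x' z) = (mu (bet v x x' z `\` S x x' z) + mu (bet v x x' z `&` S x x' z))%E.
Proof. exact: measureDI. Qed.

(** Without the box, columns on the same side are two half-lines with the same
    orientation, and the length is |u x - u x' - z|. The identity is written
    without subtraction because lengths are extended reals. *)
Lemma column_length_same x x' z : 0 < x * x' ->
  (column_length a b r u x x' z + `|z|%:E = column_length a b r (fun=> 0%R) x x' z + `|u x - u x' - z|%:E)%E.
Proof.
have zE : `|z|%:E = mu (bet (fun=> 0) x x' z) by rewrite mu_bet subr0 sub0r normrN.
have [x0|x0] := ltP 0 x.
  rewrite pmulr_rgt0// => x'0.
  have cE v : column_length a b r v x x' z = mu (bet v x x' z `&` S x x' z).
    congr (mu _); apply/seteqP; split => y; rewrite /bet/S/=/differ/in_graph_cross/= x0 x'0 !ltNge (ltW x0) (ltW x'0) /= !orbF.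
      by move=> /andP[].
    by move=> [h1 h2]; apply/andP.
  rewrite !cE zE -mu_bet !split_bet lost.
  by rewrite [LHS]addeA [LHS]addeC; congr (_ + _)%E; exact: addeC.
move=> xx'; have {}x0 : x < 0 by rewrite lt_neqAle x0 andbT; apply: contraTneq xx' => ->; rewrite mul0r ltxx.
have x'0 : x' < 0 by rewrite -(nmulr_rgt0 _ x0).
have cE v : column_length a b r v x x' z = 0%E.
  rewrite /column_length (_ : [set _ | _] = set0) ?measure0//.
  by apply/seteqP; split => y //=; rewrite /differ !box_neg.
by rewrite !cE !u_neg// subr0 sub0r normrN.
Qed.

Let lt0NE (w : R) : w != 0 -> (w < 0) = ~~ (0 < w).
Proof. by move=> w0; rewrite -leNgt lt_neqAle w0. Qed.

(** Half-lines with opposite orientations differ exactly where the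
    half-lines with the same orientation agree, up to an end point. *)
Let column_length_opp_aux (v : R -> R) x x' z : measurable_fun setT v -> x * x' < 0 -> (forall y, y < 0 -> v y = 0) ->
  (column_length a b r v x x' z + mu (bet v x x' z `&` S x x' z) = mu (S x x' z))%E.
Proof.
move=> mv xx' v0.
rewrite setIC [RHS](measureDI mu (mS x x' z) (mbet v x x' z)); congr (_ + _)%E.
have [x0|x0] := ltP 0 x.
  have x'0 : x' < 0 by rewrite -(pmulr_rlt0 _ x0).
  apply: (@lebesgue_measure_eqD1 _ _ z).
  - exact: measurable_differ_col.
  - exact: (measurableD (mS x x' z) (mbet v x x' z)).
  - rewrite /S /bet /differ /in_graph_cross/= x0 x'0 (ltNge x 0) (ltW x0) (ltNge 0 x') (ltW x'0) /= (v0 x')//.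
    by apply/seteqP; split => y /= [] h yz; split => //; move: h;
      rewrite orbF (lt0NE (w := y - z)) ?subr_eq0; try exact/eqP;
      case: (_ || _) => //=; case: (v x < y) => //=; case: (0 < y - z) => //= -[].
have {}x0 : x < 0 by rewrite lt_neqAle x0 andbT; apply: contraTneq xx' => ->; rewrite mul0r ltxx.
have x'0 : 0 < x' by rewrite -(nmulr_rlt0 _ x0).
apply: (@lebesgue_measure_eqD1 _ _ 0).
- exact: measurable_differ_col.
- exact: (measurableD (mS x x' z) (mbet v x x' z)).
- rewrite /S /bet /differ /in_graph_cross/= x0 x'0 (ltNge x' 0) (ltW x'0) (ltNge 0 x) (ltW x0) /= (v0 x)//.
  by apply/seteqP; split => y /= [] h yz; split => //; move: h;
    rewrite orbF (lt0NE (w := y)); try exact/eqP;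
    case: (_ || _) => //=; case: (v x' < y - z) => //=; case: (0 < y) => //= -[].
Qed.

(** As in [column_length_same], with the opposite sign: the length seen from the box is
    the constant measure of S minus the length for equal orientations. *)
Lemma column_length_opp x x' z : x * x' < 0 ->
  (column_length a b r u x x' z + `|u x - u x' - z|%:E =
   column_length a b r (fun=> 0%R) x x' z + `|z|%:E)%E.
Proof.
move=> xx'.
have zE : `|z|%:E = mu (bet (fun=> 0) x x' z) by rewrite mu_bet subr0 sub0r normrN.
rewrite zE -mu_bet !split_bet lost.
by rewrite [LHS]addeCA [RHS]addeCA; congr (_ + _)%E; rewrite !column_length_opp_aux.
Qed.

(** A point of the pair lies in the box, so the height lies in one of two
    intervals of length 2 * r. *)
Lemma column_length_le x x' z :
  (column_length a b r u x x' z <= ((a < x < b)%R%:R * (2 * r))%:E + ((a < x' < b)%R%:R * (2 * r))%:E)%E.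
Proof.
have H (c : R) (e : bool) : (mu [set y | e && (c - r < y < c + r)%R] <= (e%:R * (2 * r))%:E)%E.
  case: e => /=; last by rewrite mul0r (_ : [set _ | _] = set0) ?measure0//; apply/seteqP; split.
  rewrite mul1r (_ : [set _ | _] = `]c - r, c + r[%classic); last by apply/seteqP; split => y /=; rewrite in_itv/=.
  rewrite lebesgue_measure_itv/= lte_fin; case: ifP => _; last by rewrite lee_fin mulr_ge0// ltW.
  by rewrite -EFinB lee_fin; lra.
have mH (c : R) (e : bool) : measurable ([set y | e && (c - r < y < c + r)] : set (measurableTypeR R)).
  case: e => /=; last by rewrite (_ : [set _ | _] = set0) //; apply/seteqP; split.
  rewrite (_ : [set _ | _] = `]c - r, c + r[%classic)//; apply/seteqP; split => y /=; by rewrite in_itv/=.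
apply: (le_trans _ (leeD (H 0%R _) (H z _))).
apply: (le_trans _ (measureU2 mu (mH _ _) (mH _ _))).
apply: le_measure; rewrite ?inE; first exact: measurable_differ_col.
  exact: measurableU.
move=> y /= /andP[/orP[]/and4P[h1 h2 h3 h4] _]; [left|right] => /=; rewrite h1 h2/=.
  by rewrite sub0r add0r h3 h4.
have {}h3 : - r < y - z := h3. have {}h4 : y - z < r := h4.
by apply/andP; split; lra.
Qed.

Lemma column_length0_le x x' z : 0 < x * x' ->
  (column_length a b r (fun=> 0%R) x x' z <= `|z|%:E)%E.
Proof.
move=> xx'.
have -> : `|z|%:E = mu (bet (fun=> 0) x x' z) by rewrite mu_bet subr0 sub0r normrN.
apply: le_measure; rewrite ?inE; [exact: measurable_differ_col|exact: mbet|].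
move=> y; rewrite /differ/in_graph_cross/bet/= => /andP[].
have [x0|x0 /orP[]] := ltP 0 x.
- have x'0 : 0 < x' by rewrite -(pmulr_rgt0 _ x0).
  by rewrite x'0 (ltNge x) (ltNge x') (ltW x0) (ltW x'0) /= !orbF.
- move=> h; have := box_neg y (x := x); rewrite h.
  move: h => /and4P[/= /(le_lt_trans a0)]; by rewrite ltNge x0.
- move=> /and4P[/= /(le_lt_trans a0) x'0 _ _ _]; have := xx'; rewrite pmulr_lgt0//.
  by rewrite ltNge x0.
Qed.

End columns.

(** * The energy of a pair of columns *)

Section pairs.
Context {R : realType}.
Local Notation mu := (@lebesgue_measure R).
Local Notation T := (measurableTypeR R).

Definition tent (c z : R) : R := Num.max 0 (c - `|z|).

Lemma tent_ge0 c z : 0 <= tent c z.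
Proof. by rewrite le_max lexx. Qed.

Lemma measurable_tent (c : R) : measurable_fun setT (tent c : R -> R).
Proof.
apply: measurable_maxr => //; apply: measurable_funB => //.
Qed.

(** The symmetrization in z of |v - z| - |z|: it is even, nonnegative and
    supported in |z| <= |v|, so no cancellation is left in the integral. *)
Lemma tentE (v z : R) : `|v - z| + `|v - (- z)| = `|z| + `|- z| + (tent `|v| z + tent `|v| z).
Proof.
rewrite /tent normrN opprK.
by have [vz|vz] := leP 0 (`|v| - `|z|); move: vz;
  case: (ger0P v); case: (ger0P z); case: (ger0P (v - z)); case: (ger0P (v + z)); lra.
Qed.

(** The amount by which a relative shift v of the end points of two columns at
    distance d changes the energy of the pair. *)
Definition shift_energy (p d v : R) : \bar R := (\int[mu]_z (kern p d z * tent `|v| z)%:E)%E.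

Lemma measurable_column_length_joint (a b r : R) (u : R -> R) : measurable_fun setT u ->
  measurable_fun setT (fun w : (T * T) * T => column_length a b r u w.1.1 w.1.2 w.2).
Proof.
move=> mu'.
pose D (w : ((T * T) * T) * T) : bool := differ a b r u (w.1.1.1, w.2) (w.1.1.2, w.2 - w.1.2).
have mD : measurable_fun setT D.
  apply: measurable_differ => //.
  - by apply: measurableT_comp => //; apply: measurableT_comp.
  - by apply: measurableT_comp => //; apply: measurableT_comp.
  - by apply: measurable_funB => //; apply: measurableT_comp.
pose F (w : ((T * T) * T) * T) : \bar R := (if D w then 1 else 0)%:E.
have mF : measurable_fun setT F by apply/measurable_EFinP; apply: measurable_fun_ifT.
have F0 w : (0 <= F w)%E by rewrite lee_fin; case: ifP.
rewrite (_ : (fun _ => _) = fubini_F mu F); last first.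
  apply/funext => w; rewrite /fubini_F /column_length /F/=.
  set S := [set y | _].
  have mS : measurable (S : set (measurableTypeR R)) by exact: measurable_differ_col.
  have -> : mu S = (\int[mu]_y (\1_S y)%:E)%E by rewrite integral_indic// setIT.
  apply: eq_integral => y _; rewrite indicE.
  rewrite (_ : (y \in S) = D (w, y)); last by apply/idP/idP; rewrite inE.
  by case: (D _).
exact: (measurable_fun_fubini_tonelli_F (m2 := mu) F mF F0).
Qed.

Lemma measurable_column_length (a b r : R) (u : R -> R) x x' :
  measurable_fun setT u -> measurable_fun setT (column_length a b r u x x').
Proof.
move=> mu'; have mxx : measurable_fun setT (fun z : T => ((x, x'), z) : (T * T) * T).
  exact: measurable_fun_pair.
exact: measurableT_comp (measurable_column_length_joint a b r mu') mxx.
Qed.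

(** The kernel is even in z, so z can be averaged with - z. *)
Lemma integral_even_double (k : R -> R) (f : R -> \bar R) :
  measurable_fun setT k -> (forall z, 0 <= k z) -> (forall z, k (- z) = k z) ->
  measurable_fun setT f -> (forall z, (0 <= f z)%E) ->
  (\int[mu]_z ((k z)%:E * (f z + f (- z)%R)) =
   \int[mu]_z ((k z)%:E * f z) + \int[mu]_z ((k z)%:E * f z))%E.
Proof.
move=> mk k0 kN mf f0.
have mkf : measurable_fun setT (fun z => (k z)%:E * f z)%E.
  by apply: emeasurable_funM => //; exact/measurable_EFinP.
have kf0 z : (0 <= (k z)%:E * f z)%E by rewrite mule_ge0 ?lee_fin.
rewrite [X in (_ + X)%E]ge0_integral_opp// -ge0_integralD//; last first.
  by apply: (measurableT_comp mkf).
by apply: eq_integral => z _; rewrite kN ge0_muleDr.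
Qed.

Lemma ereal_half (x y z : \bar R) : (0 <= x)%E -> (0 <= y)%E -> (0 <= z)%E ->
  (x + x = (y + y) + (z + z))%E -> x = (y + z)%E.
Proof.
move: x y z => [x| |] [y| |] [z| |]//= _ _ _.
by rewrite -!EFinD => -[] h; congr EFin; lra.
Qed.

Variables (a b r : R) (u : R -> R).
Hypothesis a0 : 0 <= a.
Hypothesis r0 : 0 < r.
Hypothesis mu' : measurable_fun setT u.
Hypothesis u0 : forall x, ~~ (a < x < b) -> u x = 0.
Hypothesis ur : forall x, `|u x| < r.

Definition pair_energy p (w : R -> R) x x' : \bar R :=
  (\int[mu]_z ((kern p (x - x') z)%:E * column_length a b r w x x' z))%E.

Lemma pair_energy_ge0 p w x x' : (0 <= pair_energy p w x x')%E.
Proof. by apply: integral_ge0 => z _; rewrite mule_ge0 ?lee_fin ?kern_ge0//. Qed.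

Lemma shift_energy_ge0 p d v : (0 <= shift_energy p d v)%E.
Proof. by apply: integral_ge0 => z _; rewrite lee_fin mulr_ge0 ?kern_ge0 ?tent_ge0. Qed.

Let column_length_fin v x x' z : measurable_fun setT v -> column_length a b r v x x' z \is a fin_num.
Proof.
move=> mv; rewrite ge0_fin_numE//; by apply: (le_lt_trans (column_length_le a b r0 mv x x' z)); rewrite -EFinD ltry.
Qed.

Let mkern p d : measurable_fun setT (fun z : R => kern p d z).
Proof. exact: measurable_kern. Qed.

Let mtent v : measurable_fun setT (fun z : R => (tent v z)%:E).
Proof. by apply/measurable_EFinP; exact: measurable_tent. Qed.

Let double_energy p v x x' : measurable_fun setT v ->
  (\int[mu]_z ((kern p (x - x') z)%:E * (column_length a b r v x x' z + column_length a b r v x x' (- z)%R)) =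
  pair_energy p v x x' + pair_energy p v x x')%E.
Proof.
move=> mv; rewrite integral_even_double//; first by move=> z; exact: kern_ge0.
  by move=> z; exact: kernN.
exact: measurable_column_length.
Qed.

Let double_shift_energy p d v :
  (\int[mu]_z ((kern p d z)%:E * ((tent `|v| z)%:E + (tent `|v| z)%:E)) = shift_energy p d v + shift_energy p d v)%E.
Proof.
have mkt : measurable_fun setT (fun z : R => (kern p d z * tent `|v| z)%:E).
  by apply/measurable_EFinP; apply: measurable_funM => //; exact: measurable_tent.
rewrite /shift_energy -ge0_integralD//; last 2 first.
- by move=> z _; rewrite lee_fin mulr_ge0 ?kern_ge0 ?tent_ge0.
- by move=> z _; rewrite lee_fin mulr_ge0 ?kern_ge0 ?tent_ge0.
by apply: eq_integral => z _; rewrite -!EFinD -EFinM mulrDr.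
Qed.

Let m_en p v x x' : measurable_fun setT v -> measurable_fun setT (fun z : R =>
  ((kern p (x - x') z)%:E * (column_length a b r v x x' z + column_length a b r v x x' (- z)%R))%E).
Proof.
move=> mv; apply: emeasurable_funM; first exact/measurable_EFinP.
apply: emeasurable_funD; first exact: measurable_column_length.
by apply: (measurableT_comp (measurable_column_length a b r x x' mv)).
Qed.

Let m_pl p d v : measurable_fun setT (fun z : R =>
  ((kern p d z)%:E * ((tent v z)%:E + (tent v z)%:E))%E).
Proof.
apply: emeasurable_funM; first by apply/measurable_EFinP; apply: mkern.
by apply: emeasurable_funD; exact: mtent.
Qed.

(** The change of length |v - z| - |z| given by [column_length_same] becomes a tent when it
    is averaged over z and - z: the deformation costs energy. *)
Lemma pair_energy_same p x x' : 0 < x * x' ->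
  pair_energy p u x x' =
  (pair_energy p (fun=> 0%R) x x' + shift_energy p (x - x') (u x - u x'))%E.
Proof.
move=> xx'; apply: ereal_half; rewrite ?pair_energy_ge0 ?shift_energy_ge0//.
have m0 : measurable_fun setT (fun _ : R => 0 : R) by [].
rewrite -!double_energy// -double_shift_energy -ge0_integralD//; last 4 first.
- by move=> z _; rewrite mule_ge0 ?lee_fin ?kern_ge0// adde_ge0.
- exact: m_en.
- by move=> z _; rewrite mule_ge0 ?lee_fin ?kern_ge0// addr_ge0 ?tent_ge0.
- exact: m_pl.
apply: eq_integral => z _; rewrite -ge0_muleDr; last 2 first.
- by rewrite adde_ge0.
- by rewrite -EFinD lee_fin addr_ge0 ?tent_ge0.
congr (_ * _)%E.
have := column_length_same a0 u0 ur z xx'; have := column_length_same a0 u0 ur (- z) xx'.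
rewrite -(fineK (column_length_fin x x' z mu')) -(fineK (column_length_fin x x' (- z) mu')).
rewrite -(fineK (column_length_fin x x' z m0)) -(fineK (column_length_fin x x' (- z) m0)).
rewrite -!EFinD => -[h1] [h2]; congr EFin; have := tentE (u x - u x') z; lra.
Qed.

(** The same computation from [column_length_opp], where the change of length has the
    other sign: the deformation gains exactly what it costs for equal
    orientations. *)
Lemma pair_energy_opp p x x' : x * x' < 0 ->
  pair_energy p (fun=> 0%R) x x' =
  (pair_energy p u x x' + shift_energy p (x - x') (u x - u x'))%E.
Proof.
move=> xx'; apply: ereal_half; rewrite ?pair_energy_ge0 ?shift_energy_ge0//.
have m0 : measurable_fun setT (fun _ : R => 0 : R) by [].
rewrite -!double_energy// -double_shift_energy -ge0_integralD//; last 4 first.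
- by move=> z _; rewrite mule_ge0 ?lee_fin ?kern_ge0// adde_ge0.
- exact: m_en.
- by move=> z _; rewrite mule_ge0 ?lee_fin ?kern_ge0// addr_ge0 ?tent_ge0.
- exact: m_pl.
apply: eq_integral => z _; rewrite -ge0_muleDr; last 2 first.
- by rewrite adde_ge0.
- by rewrite -EFinD lee_fin addr_ge0 ?tent_ge0.
congr (_ * _)%E.
have := column_length_opp a0 mu' u0 ur z xx'; have := column_length_opp a0 mu' u0 ur (- z) xx'.
rewrite -(fineK (column_length_fin x x' z mu')) -(fineK (column_length_fin x x' (- z) mu')).
rewrite -(fineK (column_length_fin x x' z m0)) -(fineK (column_length_fin x x' (- z) m0)).
rewrite -!EFinD => -[h1] [h2]; congr EFin; have := tentE (u x - u x') z; lra.
Qed.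

(** The rescaling z = |v| * m exhibits the quadratic behaviour in v: the main
    factor is v ^+ 2 / |d| ^ (2 * p), and the remaining integral tends to the
    integral of the tent as v tends to 0. *)
Lemma shift_energyE p d v : d != 0 ->
  shift_energy p d v = ((v ^+ 2 * (d ^+ 2) `^ (- p))%:E *
    \int[mu]_m (tent 1 m * (1 + m ^+ 2 * (v / d) ^+ 2) `^ (- p))%:E)%E.
Proof.
move=> d0; rewrite /shift_energy.
have [->|v0] := eqVneq v 0.
  rewrite expr0n /= mul0r mul0e integral0_eq// => z _.
  by rewrite /tent normr0 sub0r (max_idPl _) ?mulr0// oppr_le0.
have v'0 : 0 < `|v| by rewrite normr_gt0.
have mk : measurable_fun setT (fun z : R => (kern p d z * tent `|v| z)%:E).
  by apply/measurable_EFinP; apply: measurable_funM => //; exact: measurable_tent.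
rewrite (@ge0_integral_affine _ `|v| 0)//; last first.
  by move=> z; rewrite lee_fin mulr_ge0 ?kern_ge0 ?tent_ge0.
have m2 : measurable_fun setT (fun m : R => (tent 1 m * (1 + m ^+ 2 * (v / d) ^+ 2) `^ (- p))%:E).
  apply/measurable_EFinP; apply: measurable_funM; first exact: measurable_tent.
  apply: measurable_powRcomp; apply: measurable_funD => //.
  by apply: measurable_funM => //; exact: measurable_funX.
have nn2 (m : R) : (0 <= (tent 1 m * (1 + m ^+ 2 * (v / d) ^+ 2) `^ (- p))%:E)%E.
  by rewrite lee_fin mulr_ge0 ?tent_ge0 ?powR_ge0.
rewrite -!ge0_integralZl_EFin//; last 3 first.
- by rewrite mulr_ge0 ?sqr_ge0 ?powR_ge0.
- by move=> z _; rewrite lee_fin mulr_ge0 ?kern_ge0 ?tent_ge0.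
- by apply: (measurableT_comp mk); exact: measurable_affine.
apply: eq_integral => m _; rewrite -!EFinM; congr EFin.
rewrite addr0 /kern.
have -> : d ^+ 2 + (`|v| * m) ^+ 2 = d ^+ 2 * (1 + m ^+ 2 * (v / d) ^+ 2).
  by rewrite exprMn -normrX ger0_norm ?sqr_ge0//; field.
rewrite powRM ?sqr_ge0//; last by rewrite addr_ge0// -exprMn sqr_ge0.
have -> : tent `|v| (`|v| * m) = `|v| * tent 1 m.
  by rewrite /tent normrM normr_id maxr_pMr// mulr0 mulrBr mulr1.
by rewrite -(ger0_norm (sqr_ge0 v)) normrX; ring.
Qed.

End pairs.

(** * Twice differentiating an integral quadratic in a parameter *)

Lemma powR_le1 (R : realType) (y e : R) : 1 <= y -> 0 <= e -> y `^ (- e) <= 1.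
Proof.
by move=> y1 e0; rewrite -[leRHS](powRr0 y); apply: ler_powR; rewrite ?oppr_le0.
Qed.

(** The integrand is bounded by t ^+ 2 * |g| and its derivative by a multiple of
    |t * g|, uniformly in c, so that g alone dominates everything. The second
    derivative exists at t = 0 because the first one is t times an integral that
    is continuous in t. *)
Section quadratic_integral.
Context {R : realType} {dd : measure_display} {Y : measurableType dd}.
Variable m : {measure set Y -> \bar R}.
Variables (g c : Y -> R) (p : R).
Hypothesis ig : m.-integrable setT (EFin \o g).
Hypothesis mc : measurable_fun setT c.
Hypothesis c0 : forall y, 0 <= c y.
Hypothesis p0 : 0 <= p.

Let base (t : R) y : 0 < 1 + t ^+ 2 * c y.
Proof. by rewrite (lt_le_trans ltr01)// lerDl mulr_ge0 ?sqr_ge0. Qed.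

(** The derivative in t of the integrand, divided by t * g. *)
Let slope (t : R) y : R :=
  2 * (1 + t ^+ 2 * c y) `^ (- p) -
  2 * p * (t ^+ 2 * c y) * (1 + t ^+ 2 * c y) `^ (- p - 1).

Let pow_le1 (t e : R) y : 0 <= e -> (1 + t ^+ 2 * c y) `^ (- e) <= 1.
Proof.
by move=> e0; apply: powR_le1 => //; rewrite lerDl mulr_ge0 ?sqr_ge0.
Qed.

Let slope_le t y : `|slope t y| <= 2 + 2 * p.
Proof.
have h1 := pow_le1 t y p0.
have h2 : (t ^+ 2 * c y) * (1 + t ^+ 2 * c y) `^ (- p - 1) <= 1.
  apply: (le_trans _ (pow_le1 t y p0)).
  have -> : (t ^+ 2 * c y) * (1 + t ^+ 2 * c y) `^ (- p - 1) =
      (1 + t ^+ 2 * c y) `^ (- p) * ((t ^+ 2 * c y) / (1 + t ^+ 2 * c y)).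
    have bn : 1 + t ^+ 2 * c y != 0 by rewrite gt_eqF ?base.
    rewrite powRB ?bn ?implybT//.
    by rewrite powRr1 ?ltW ?base//; ring.
  apply: ler_piMr; first exact: powR_ge0.
  by rewrite ler_pdivrMr ?base// mul1r lerDr.
have h3 : 0 <= (1 + t ^+ 2 * c y) `^ (- p) by exact: powR_ge0.
have h4 : 0 <= (t ^+ 2 * c y) * (1 + t ^+ 2 * c y) `^ (- p - 1).
  by rewrite mulr_ge0 ?powR_ge0// mulr_ge0// sqr_ge0.
rewrite /slope -[2 * p * _ * _]mulrA.
move: h1 h2 h3 h4; set u := _ `^ (- p); set v := _ * _ `^ _ => h1 h2 h3 h4.
have h5 : 0 <= p * v by rewrite mulr_ge0.
have h6 : p * v <= p by rewrite ler_piMr.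
by rewrite ler_norml; apply/andP; split; lra.
Qed.

Let is_derive_term t y : is_derive t (1 : R)
  (fun t : R => t ^+ 2 * (1 + t ^+ 2 * c y) `^ (- p)) (t * slope t y).
Proof.
have h1 : is_derive t (1 : R) (fun t : R => 1 + t ^+ 2 * c y) (2 * t * c y).
  by apply: is_derive_eq; rewrite /GRing.scale/=; ring.
have h2 := is_derive1_powR (- p) (base t y).
have h3 : is_derive t (1 : R) (fun t : R => (1 + t ^+ 2 * c y) `^ (- p))
   ((- p * (1 + t ^+ 2 * c y) `^ (- p - 1)) * (2 * t * c y)).
  exact: (@is_derive1_comp _ (fun x : R => x `^ (- p)) (fun t : R => 1 + t ^+ 2 * c y)).
by apply: is_derive_eq; rewrite /GRing.scale/= /slope; ring.
Qed.

Let q (t : R) : R := (\int[m]_y (g y * (t ^+ 2 * (1 + t ^+ 2 * c y) `^ (- p))))%R.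
Let S (t : R) : R := (\int[m]_y (g y * slope t y))%R.

Let mpow (t e : R) : measurable_fun setT (fun y => (1 + t ^+ 2 * c y) `^ e).
Proof.
apply: (measurableT_comp (measurable_powR e)); apply: measurable_funD => //.
exact: measurable_funM.
Qed.

Let mslope t : measurable_fun setT (slope t).
Proof.
apply: measurable_funB; first by apply: measurable_funM.
apply: measurable_funM => //; apply: measurable_funM => //; exact: measurable_funM.
Qed.

Let int_bounded (f : Y -> R) (M : R) : measurable_fun setT f -> (forall y, `|f y| <= M) ->
  m.-integrable setT (EFin \o (fun y => g y * f y)).
Proof.
move=> mf fM.
have mg : measurable_fun setT g by have /integrableP[/measurable_EFinP] := ig.
apply: (@le_integrable _ _ _ _ _ _ _ (fun y => (M%:E * (g y)%:E)%E)) => //.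
- by apply/measurable_EFinP; apply: measurable_funM.
- move=> y _ /=; rewrite lee_fin !normrM mulrC ler_wpM2r//.
  by apply: le_trans (fM y) _; rewrite ler_norm.
- exact: integrableZl.
Qed.

Let int_abs (M : R) : m.-integrable setT (EFin \o (fun y => M * `|g y|)).
Proof.
have := integrableZl measurableT M (integrable_abse ig).
by apply: eq_integrable => // y _; rewrite /= EFinM.
Qed.

Let der_q t : derivable q t 1 /\ derive1 q t = t * S t.
Proof.
pose f (t : R) y := g y * (t ^+ 2 * (1 + t ^+ 2 * c y) `^ (- p)).
have derf t' y : is_derive t' (1 : R) (f ^~ y) (g y * (t' * slope t' y)).
  have := is_derive_term t' y => h.
  by apply: is_derive_eq; rewrite /GRing.scale/=; ring.
have dE t' y : derive1 (fun x : R => f x y) t' = g y * (t' * slope t' y).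
  by rewrite derive1E; have [] := derf t' y.
pose I : set R := `]t - 1, t + 1[%classic.
have It : I t by rewrite /I /= in_itv/=; apply/andP; split; lra.
have intf x : I x -> m.-integrable setT (EFin \o f x).
  move=> _; apply: (int_bounded (M := x ^+ 2)).
    by apply: measurable_funM.
  move=> y; rewrite normrM (ger0_norm (sqr_ge0 _)) ler_piMr ?sqr_ge0//.
  by rewrite ger0_norm ?powR_ge0 ?pow_le1.
have derf1 x y : I x -> setT y -> derivable (f ^~ y) x 1.
  by move=> _ _; have [] := derf x y.
pose M := (`|t| + 1) * (2 + 2 * p).
have M0 : 0 <= M by rewrite mulr_ge0 ?addr_ge0 ?mulr_ge0.
have G0 y : 0 <= M * `|g y| by rewrite mulr_ge0.
have Gub x y : I x -> setT y -> `|partial1of2 f x y| <= M * `|g y|.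
  rewrite /I /= in_itv/= => /andP[x1 x2] _; rewrite /partial1of2 dE normrM mulrC.
  rewrite ler_wpM2r// normrM /M ler_pM//.
  by rewrite ler_norml; case: (ger0P t) => ?; apply/andP; split; lra.
split.
  exact: (@derivable_under_integral _ _ _ m f setT measurableT t _ _ It intf derf1 _ G0 (int_abs M) Gub).
have := (@differentiation_under_integral _ _ _ m f setT measurableT t _ _ It intf derf1 _ G0 (int_abs M) Gub).
rewrite -/(q) => ->.
rewrite /S -RintegralZl//; last exact: int_bounded (mslope t) (slope_le t).
by apply: eq_Rintegral => y _; rewrite /partial1of2 dE mulrCA.
Qed.

Lemma derivable_quadratic_integral t : derivable q t 1.
Proof. by have [] := der_q t. Qed.

Let cont_slope y t : {for t, continuous (fun t => g y * slope t y)}.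
Proof.
have ct e : {for t, continuous (fun t : R => (1 + t ^+ 2 * c y) `^ e)}.
  have h1 : is_derive t (1 : R) (fun t : R => 1 + t ^+ 2 * c y) (2 * t * c y).
    by apply: is_derive_eq; rewrite /GRing.scale/=; ring.
  have h2 := is_derive1_powR e (base t y).
  have h3 := @is_derive1_comp _ (fun x : R => x `^ e) (fun t : R => 1 + t ^+ 2 * c y) _ _ _ h2 h1.
  by apply: differentiable_continuous; apply/derivable1_diffP; case: h3.
have c2 : {for t, continuous (fun t : R => t ^+ 2 * c y)}.
  have h1 : is_derive t (1 : R) (fun t : R => t ^+ 2 * c y) (2 * t * c y).
    by apply: is_derive_eq; rewrite /GRing.scale/=; ring.
  by apply: differentiable_continuous; apply/derivable1_diffP; case: h1.
apply: continuousM; first exact: cst_continuous.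
apply: continuousB; apply: continuousM => //; try exact: cst_continuous.
by apply: continuousM => //; exact: cst_continuous.
Qed.

Lemma is_derive_derive1_quadratic_integral :
  is_derive (0 : R) 1 (derive1 q) (2 * \int[m]_y g y).
Proof.
have -> : derive1 q = (fun t => t * S t).
  by apply/funext => t; have [] := der_q t.
have S0 : S 0 = 2 * \int[m]_y g y.
  rewrite -RintegralZl//; apply: eq_Rintegral => y _.
  by rewrite /slope expr0n /= !mul0r addr0 !mulr0 mul0r subr0 powR1 mulr1 mulrC.
have cS : {for 0, continuous S}.
  have h : 0 \in (`]-1, 1[%classic : set R) by rewrite inE/= in_itv/=; apply/andP; split; lra.
  apply: (@continuity_under_integral _ _ _ m (fun t y => g y * slope t y) setT measurableT (-1) 1 _ _
    (fun y => (2 + 2 * p) * `|g y|) (int_abs _) _ 0 h).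
  - move=> x _; exact: int_bounded (mslope x) (slope_le x).
  - by apply: aeW => y _ x _; exact: cont_slope.
  - by move=> x _; apply: aeW => y _; rewrite normrM mulrC ler_wpM2r.
rewrite -S0; apply/is_derive1_caratheodory; exists S; split => //.
by move=> z; rewrite mul0r !subr0 mulrC.
Qed.

End quadratic_integral.

(** * Integrable power majorants *)

Section powers.
Context {R : realType}.
Local Notation mu := (@lebesgue_measure R).

Lemma integral_powR_segment (a u v : R) : a != 1 -> 0 < u -> u < v ->
  (\int[mu]_(x in `[u, v]) (x `^ (- a))%:E =
   ((v `^ (1 - a) - u `^ (1 - a)) / (1 - a))%:E)%E.
Proof.
move=> a1 u0 uv; have a1' : 1 - a != 0 by rewrite subr_eq0 eq_sym.
have dF (x : R) : 0 < x -> is_derive x (1:R) (fun x : R => x `^ (1 - a) / (1 - a)) (x `^ (- a)).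
  move=> x0; have h := is_derive1_powR (1 - a) x0.
  apply: is_derive_eq; rewrite /GRing.scale/=.
  by rewrite (_ : 1 - a - 1 = - a) ?mulrA ?mulVf ?mul1r//; ring.
have cF (x : R) : 0 < x -> {for x, continuous (fun x : R => x `^ (1 - a) / (1 - a))}.
  move=> /dF[d _]; exact/differentiable_continuous/derivable1_diffP.
have cf (x : R) : 0 < x -> {for x, continuous (fun x : R => x `^ (- a))}.
  move=> /(is_derive1_powR (- a))[d _]; exact/differentiable_continuous/derivable1_diffP.
have pos (x : R) : x \in `[u, v] -> 0 < x.
  by rewrite in_itv/= => /andP[/(lt_le_trans u0)].
rewrite (@continuous_FTC2 _ (fun x : R => x `^ (- a)) (fun x : R => x `^ (1 - a) / (1 - a)))//.
- by rewrite -EFinB mulrBl.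
- apply: continuous_in_subspaceT => x /set_mem/= /pos; exact: cf.
- split.
  + by move=> x xuv; have [] := dF x (pos _ (subset_itv_oo_cc xuv)).
  + exact: (cvg_at_right_filter (cF _ u0)).
  + exact: (cvg_at_left_filter (cF _ (lt_trans u0 uv))).
- move=> x xuv; rewrite derive1E.
  by have [] := dF x (pos _ (subset_itv_oo_cc xuv)).
Qed.

Let mpow (a : R) (D : set R) : measurable D ->
  measurable_fun D (fun x : R => (x `^ (- a))%:E).
Proof.
by move=> mD; apply/measurable_EFinP; apply: (measurable_funS measurableT).
Qed.

Lemma integral_powR_near0 (a : R) : a < 1 ->
  (\int[mu]_(x in `]0%R, 1%R]) (x `^ (- a))%:E < +oo)%E.
Proof.
move=> a1.
pose F (i : nat) : set (measurableTypeR R) := `[(i.+2%:R)^-1, 1]%classic.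
have Fcup : \bigcup_i F i = `]0, 1]%classic.
  apply/seteqP; split => x /=.
    by move=> [i _]; rewrite /F /= !in_itv/= => /andP[h ->]; rewrite andbT (lt_le_trans _ h)// invr_gt0.
  rewrite in_itv/= => /andP[x0 x1].
  exists (Num.truncn (x^-1)) => //; rewrite /F /= in_itv/= x1 andbT.
  rewrite invf_ple ?posrE//.
  have /ltW/le_trans := (truncnS_gt (x^-1)); apply.
  by rewrite ler_nat.
have nd : nondecreasing_seq F.
  move=> i j ij; apply/subsetPset => x; rewrite /F /= !in_itv/= => /andP[h ->]; rewrite andbT.
  by apply: le_trans h; rewrite lef_pV2 ?posrE// ler_nat.
have mF i : measurable (F i) by exact: measurable_itv.
have := @ge0_nondecreasing_set_cvg_integral _ _ R F (fun x => (x `^ (- a))%:E) mu nd mF (fun i => mpow a (mF i)).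
rewrite Fcup => /(_ (fun i x _ => ltac:(by rewrite lee_fin powR_ge0))) cv.
apply: (@le_lt_trans _ _ ((1 - a)^-1)%:E); last exact: ltry.
have ub i : (\int[mu]_(x in F i) (x `^ (- a))%:E <= ((1 - a)^-1)%:E)%E.
  rewrite integral_powR_segment ?invr_gt0 ?invf_lt1 ?ltr1n// ?lt_eqF// lee_fin.
  have a1' : 0 < 1 - a by rewrite subr_gt0.
  rewrite powR1 ler_pdivrMr// mulVf ?gt_eqF// gerDl oppr_le0; exact: powR_ge0.
rewrite -(cvg_lim _ cv)//; apply: lime_le; first by apply/cvg_ex; eexists; exact: cv.
by apply: nearW.
Qed.

Lemma integral_powR_infty (a : R) : 1 < a ->
  (\int[mu]_(x in `[1%R, +oo[) (x `^ (- a))%:E < +oo)%E.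
Proof.
move=> a1.
pose F (i : nat) : set (measurableTypeR R) := `[1, i.+2%:R]%classic.
have Fcup : \bigcup_i F i = `[1, +oo[%classic.
  apply/seteqP; split => x /=.
    by move=> [i _]; rewrite /F /= !in_itv/= => /andP[-> _].
  rewrite in_itv/= andbT => x1.
  exists (Num.truncn x) => //; rewrite /F /= in_itv/= x1/=.
  have /ltW/le_trans := (truncnS_gt x); apply.
  by rewrite ler_nat.
have nd : nondecreasing_seq F.
  move=> i j ij; apply/subsetPset => x; rewrite /F /= !in_itv/= => /andP[-> h] /=.
  by apply: (le_trans h); rewrite ler_nat.
have mF i : measurable (F i) by exact: measurable_itv.
have := @ge0_nondecreasing_set_cvg_integral _ _ R F (fun x => (x `^ (- a))%:E) mu nd mF (fun i => mpow a (mF i)).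
rewrite Fcup => /(_ (fun i x _ => ltac:(by rewrite lee_fin powR_ge0))) cv.
apply: (@le_lt_trans _ _ ((a - 1)^-1)%:E); last exact: ltry.
have ub i : (\int[mu]_(x in F i) (x `^ (- a))%:E <= ((a - 1)^-1)%:E)%E.
  rewrite integral_powR_segment ?ltr1n// ?gt_eqF// lee_fin.
  have a1' : 0 < a - 1 by rewrite subr_gt0.
  rewrite -mulrNN -invrN !opprB powR1 ler_pdivrMr// mulVf ?gt_eqF// gerDl oppr_le0; exact: powR_ge0.
rewrite -(cvg_lim _ cv)//; apply: lime_le; first by apply/cvg_ex; eexists; exact: cv.
by apply: nearW.
Qed.

(** An even weight with independent powers at 0 and at infinity. The summand 1
    keeps it above 1 on [-1, 1], for factors of the kernel that are dropped
    there. *)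
Definition majorant (a b r : R) : R :=
  if `|r| <= 1 then 1 + `|r| `^ (- a) else `|r| `^ (- b).

Lemma majorant_ge0 a b r : 0 <= majorant a b r.
Proof. by rewrite /majorant; case: ifP => _; rewrite ?addr_ge0 ?powR_ge0. Qed.

Lemma measurable_majorant a b : measurable_fun setT (majorant a b).
Proof.
apply: measurable_fun_ifT.
- by apply: measurable_fun_ler.
- apply: measurable_funD => //.
  by apply: (measurableT_comp (measurable_powR _)).
- by apply: (measurableT_comp (measurable_powR _)).
Qed.

Lemma integral_majorant_lty a b : 0 < a -> a < 1 -> 1 < b ->
  (\int[mu]_r (majorant a b r)%:E < +oo)%E.
Proof.
move=> a0 a1 b1.
pose h1 := (fun r : R => (r `^ (- a))%:E) \_ (`]0, 1]%classic : set R).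
pose h2 := (fun r : R => (r `^ (- b))%:E) \_ (`[1, +oo[%classic : set R).
pose h3 := (fun r : R => (1:R)%:E) \_ (`[-1, 1]%classic : set R).
have mh1 : measurable_fun setT h1 by rewrite -measurable_restrictT//; exact: mpow.
have mh2 : measurable_fun setT h2 by rewrite -measurable_restrictT//; exact: mpow.
have mh3 : measurable_fun setT h3 by rewrite -measurable_restrictT.
have h10 r : (0 <= h1 r)%E by rewrite /h1 patchE; case: ifP => _; rewrite ?lee_fin ?powR_ge0.
have h20 r : (0 <= h2 r)%E by rewrite /h2 patchE; case: ifP => _; rewrite ?lee_fin ?powR_ge0.
have h30 r : (0 <= h3 r)%E by rewrite /h3 patchE; case: ifP => _; rewrite ?lee_fin.
have I1 : (\int[mu]_r h1 r < +oo)%E by rewrite -integral_mkcond; exact: integral_powR_near0.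
have I2 : (\int[mu]_r h2 r < +oo)%E by rewrite -integral_mkcond; exact: integral_powR_infty.
have I3 : (\int[mu]_r h3 r < +oo)%E.
  rewrite -integral_mkcond integral_cst// mul1e.
  apply: (@le_lt_trans _ _ (mu `[-1 : R, 1 : R]%classic)); first by [].
  rewrite lebesgue_measure_itv/= lte_fin.
  by case: ifP => _ //; rewrite -EFinB ltry.
have mhN h : measurable_fun setT h -> measurable_fun setT (fun r : R => h (- r) : \bar R).
  by move=> mh; apply: (measurableT_comp mh).
apply: (@le_lt_trans _ _ (\int[mu]_r (h3 r + ((h1 r + h1 (- r)%R) + (h2 r + h2 (- r)%R))))%E).
  apply: ge0_le_integral => //.
  - by move=> r _; rewrite lee_fin majorant_ge0.
  - by apply/measurable_EFinP; exact: measurable_majorant.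
  - apply: emeasurable_funD => //; apply: emeasurable_funD; apply: emeasurable_funD => //; exact: mhN.
  - move=> r _; rewrite /h1 /h2 /h3 !patchE !mem_setE !in_itv/= /majorant !andbT.
    have [r0|r0|->] := ltgtP r 0.
    + have e1 : r <= 1 by apply: ltW (lt_trans r0 _).
      have e2 : (-1 <= r) = (- r <= 1) by rewrite lerNl.
      have e3 : (1 <= r) = false by apply/negbTE; rewrite -ltNge (lt_trans r0).
      rewrite ltr0_norm// e1 e2 e3 oppr_gt0 r0 /= andbT !add0e.
      have [h|h] := leP (- r) 1.
        by case: ifP => h'; rewrite ?adde0 -?EFinD lee_fin; have := powR_ge0 (- r) (- b); have := powR_ge0 r (- b); lra.
      by have h' := ltW h; rewrite h' ?add0e ?adde0.
    + have e1 : -1 <= r by rewrite (le_trans _ (ltW r0))// lerN10.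
      have e2 : (0 < - r) = false by rewrite oppr_gt0; apply/negbTE; rewrite -leNgt ltW.
      have e3 : (1 <= - r) = false by apply/negbTE; rewrite -ltNge (lt_trans _ ltr01)// oppr_lt0.
      rewrite gtr0_norm// e1 e2 e3 /= !adde0.
      have [h|h] := leP r 1.
        by case: ifP => h'; rewrite ?adde0 -?EFinD lee_fin; have := powR_ge0 (- r) (- b); have := powR_ge0 r (- b); lra.
      by have h' := ltW h; rewrite h' ?add0e ?adde0.
    + rewrite normr0 ler01 oppr0 lerN10 (lt_geF ltr01) ltxx /= (_ : (point : \bar R) = 0%E)// !adde0.
      by rewrite powR0 ?oppr_eq0 ?gt_eqF// addr0.
have mh12 : measurable_fun setT (fun r : R => h1 r + h1 (- r)%R)%E by apply: emeasurable_funD => //; exact: mhN.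
have mh22 : measurable_fun setT (fun r : R => h2 r + h2 (- r)%R)%E by apply: emeasurable_funD => //; exact: mhN.
rewrite ge0_integralD//; last 2 first.
- by move=> r _; rewrite !adde_ge0.
- exact: emeasurable_funD.
rewrite ge0_integralD//; last 2 first.
- by move=> r _; rewrite !adde_ge0.
- by move=> r _; rewrite !adde_ge0.
rewrite !ge0_integralD//; [|exact: mhN|exact: mhN].
rewrite -!ge0_integral_opp// lte_add_pinfty// lte_add_pinfty// lte_add_pinfty//.
Qed.

End powers.

(** * Integrals over strips of a function of the difference *)

Section strip.
Context {R : realType}.
Local Notation mu := (@lebesgue_measure R).

(** A real-valued indicator, convenient inside products of real functions. *)
Definition in_strip (a b : R) (x : R) : R := (a < x < b)%R%:R.

Lemma in_strip_ge0 a b x : 0 <= in_strip a b x.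
Proof. by rewrite /in_strip ler0n. Qed.

Lemma measurable_in_strip dd (T : measurableType dd) a b (f : T -> R) :
  measurable_fun setT f -> measurable_fun setT (fun x => in_strip a b (f x)).
Proof.
move=> mf; rewrite (_ : (fun _ => _) = (fun x => if a < f x < b then 1 else 0)); last first.
  by apply/funext => x; rewrite /in_strip; case: ifP.
by apply: measurable_fun_ifT => //; apply: measurable_and; exact: measurable_fun_ltr.
Qed.

Lemma integral_in_strip a b : a < b ->
  (\int[mu]_x (in_strip a b x)%:E = (b - a)%:E)%E.
Proof.
move=> ab; transitivity (mu `]a, b[).
  transitivity (\int[mu]_x (\1_(`]a, b[%classic : set R) x)%:E)%E; last by rewrite integral_indic// setIT.
  apply: eq_integral => x _; rewrite indicE /in_strip; congr ((nat_of_bool _)%:R%:E).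
  by apply/idP/idP; rewrite ?inE/= in_itv.
by rewrite lebesgue_measure_itv/= lte_fin ab EFinB.
Qed.

Lemma integral_two_strips (k : R -> R) a b : measurable_fun setT k ->
  (forall r, 0 <= k r) -> a < b ->
  (\int[leb2 R]_q ((in_strip a b q.1 + in_strip a b q.2) * k (q.1 - q.2))%:E =
   (2 * (b - a))%:E * \int[mu]_r (k r)%:E)%E.
Proof.
move=> mk k0 ab; pose T := measurableTypeR R.
have mk2 : measurable_fun setT (fun q : T * T => k (q.1 - q.2)).
  by apply: (measurableT_comp mk); exact: measurable_funB.
have mf1 : measurable_fun setT (fun q : T * T => (in_strip a b q.1 * k (q.1 - q.2))%:E).
  by apply/measurable_EFinP; apply: measurable_funM => //; exact: measurable_in_strip.
have mf2 : measurable_fun setT (fun q : T * T => (in_strip a b q.2 * k (q.1 - q.2))%:E).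
  by apply/measurable_EFinP; apply: measurable_funM => //; exact: measurable_in_strip.
have f10 (q : T * T) : (0 <= (in_strip a b q.1 * k (q.1 - q.2))%:E)%E.
  by rewrite lee_fin mulr_ge0 ?in_strip_ge0.
have f20 (q : T * T) : (0 <= (in_strip a b q.2 * k (q.1 - q.2))%:E)%E.
  by rewrite lee_fin mulr_ge0 ?in_strip_ge0.
have mEk : measurable_fun setT (fun r : R => (k r)%:E) by exact/measurable_EFinP.
have Ek0 r : (0 <= (k r)%:E)%E by rewrite lee_fin.
have mE : measurable_fun setT (fun x : R => (in_strip a b x)%:E).
  by apply/measurable_EFinP; exact: measurable_in_strip.
have Ik0 : (0 <= \int[mu]_r (k r)%:E)%E by apply: integral_ge0.
transitivity ((\int[leb2 R]_q (in_strip a b q.1 * k (q.1 - q.2))%:E) +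
   (\int[leb2 R]_q (in_strip a b q.2 * k (q.1 - q.2))%:E))%E.
  rewrite -ge0_integralD//; apply: eq_integral => q _.
  by rewrite -EFinD mulrDl.
have -> : (\int[leb2 R]_q (in_strip a b q.1 * k (q.1 - q.2))%:E = (b - a)%:E * \int[mu]_r (k r)%:E)%E.
  rewrite fubini_tonelli1// -(integral_in_strip ab) -ge0_integralZr//; last first.
    by move=> x _; rewrite lee_fin in_strip_ge0.
  apply: eq_integral => x _; rewrite /fubini_F /= [in RHS](ge0_integral_subl x)//.
  under eq_integral do rewrite EFinM.
  rewrite ge0_integralZl_EFin ?in_strip_ge0//.
  by apply: (measurableT_comp mEk); exact: measurable_funB.
have -> : (\int[leb2 R]_q (in_strip a b q.2 * k (q.1 - q.2))%:E = (b - a)%:E * \int[mu]_r (k r)%:E)%E.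
  rewrite fubini_tonelli2// -(integral_in_strip ab) -ge0_integralZr//; last first.
    by move=> x _; rewrite lee_fin in_strip_ge0.
  apply: eq_integral => x _; rewrite /fubini_G /= [in RHS](ge0_integral_shift (- x))//.
  under eq_integral do rewrite EFinM.
  rewrite ge0_integralZl_EFin ?in_strip_ge0//.
  by apply: (measurableT_comp mEk); exact: measurable_funB.
rewrite -ge0_muleDl ?lee_fin ?subr_ge0 ?(ltW ab)// -EFinD.
by congr (_%:E * _)%E; ring.
Qed.

End strip.

(** * A twice continuously differentiable step *)

Section step.
Context {R : realType}.

Definition pospart (x : R) : R := Num.max 0 x.

Lemma pospart_ge0 x : 0 <= pospart x.
Proof. by rewrite le_max lexx. Qed.

Lemma pospart_id x : 0 <= x -> pospart x = x.
Proof. by move=> x0; apply/max_idPr. Qed.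

Lemma pospart_0 x : x <= 0 -> pospart x = 0.
Proof. by move=> x0; apply/max_idPl. Qed.

Lemma continuous_pospart : continuous pospart.
Proof.
move=> x; apply: (@continuous_max _ _ (cst 0) id).
- exact: cst_continuous.
- by [].
Qed.

(** At 0 the difference quotient is pospart y ^+ n.+1, which is continuous. *)
Lemma is_derive_pospartX n x :
  is_derive x (1 : R) (fun y => pospart y ^+ n.+2) (n.+2%:R * pospart x ^+ n.+1).
Proof.
have [x0|x0|->] := ltgtP x 0.
- rewrite (pospart_0 (ltW x0)) expr0n/= mulr0.
  apply: (@near_eq_is_derive _ _ _ (cst 0)) => //.
  near=> y; rewrite /= pospart_0 ?expr0n//.
  by apply: ltW; near: y; exact: lt_nbhsl.
- rewrite (pospart_id (ltW x0)).
  apply: (@near_eq_is_derive _ _ _ (fun y : R => y ^+ n.+2)).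
    near=> y; rewrite /= pospart_id//.
    by apply: ltW; near: y; exact: lt_nbhsr.
  have := @is_deriveX _ _ (@id R) n.+2 x 1 1 (is_derive_id x 1); rewrite exprfctE.
  by rewrite /GRing.scale/= mulr1.
- rewrite (pospart_0 (lexx _)) expr0n/= mulr0.
  apply/is_derive1_caratheodory; exists (fun y => pospart y ^+ n.+1); split.
  + move=> z; rewrite (pospart_0 (lexx _)) [in LHS]expr0n/= !subr0.
    have [z0|z0] := leP 0 z; first by rewrite pospart_id// exprSr.
    by rewrite pospart_0 ?ltW// !expr0n/= mul0r.
  + apply: (@continuous_comp _ _ _ pospart (fun x : R => x ^+ n.+1)); first exact: continuous_pospart.
    exact: exprn_continuous.
  + by rewrite pospart_0// expr0n.
Unshelve. all: by end_near. Qed.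

(** The integral of the quadratic B-spline with knots 0, 1, 2, 3, hence a C^2
    transition from 0 to 1. *)
Definition step (z : R) : R :=
  (pospart z ^+ 3 - 3 * pospart (z - 1) ^+ 3 + 3 * pospart (z - 2) ^+ 3 - pospart (z - 3) ^+ 3) / 6.
Definition step' (z : R) : R :=
  (pospart z ^+ 2 - 3 * pospart (z - 1) ^+ 2 + 3 * pospart (z - 2) ^+ 2 - pospart (z - 3) ^+ 2) / 2.
Definition step'' (z : R) : R :=
  pospart z - 3 * pospart (z - 1) + 3 * pospart (z - 2) - pospart (z - 3).

Lemma is_derive_shift_pospartX n c x :
  is_derive x (1 : R) (fun y => pospart (y - c) ^+ n.+2) (n.+2%:R * pospart (x - c) ^+ n.+1).
Proof.
have h1 : is_derive x (1 : R) (fun y : R => y - c) 1 by apply: is_derive_eq; rewrite subr0.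
have := @is_derive1_comp _ (fun y => pospart y ^+ n.+2) (fun y : R => y - c) _ _ _ (is_derive_pospartX n (x - c)) h1.
by rewrite mulr1.
Qed.

Lemma is_derive_step z : is_derive z (1 : R) step (step' z).
Proof.
have h0 := is_derive_pospartX 1 z.
have h1 := is_derive_shift_pospartX 1 1 z.
have h2 := is_derive_shift_pospartX 1 2 z.
have h3 := is_derive_shift_pospartX 1 3 z.
by rewrite /step; apply: is_derive_eq; rewrite /GRing.scale/= /step'; field.
Qed.

Lemma is_derive_step' z : is_derive z (1 : R) step' (step'' z).
Proof.
have h0 := is_derive_pospartX 0 z.
have h1 := is_derive_shift_pospartX 0 1 z.
have h2 := is_derive_shift_pospartX 0 2 z.
have h3 := is_derive_shift_pospartX 0 3 z.
by rewrite /step'; apply: is_derive_eq; rewrite /GRing.scale/= /step''; field.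
Qed.

Lemma continuous_step'' : continuous step''.
Proof.
have c (a : R) : continuous (fun z => pospart (z - a)).
  move=> z; apply: (@continuous_comp _ _ _ (fun z : R => z - a) pospart).
    by apply: cvgB; [exact: cvg_id|exact: cvg_cst].
  exact: continuous_pospart.
have c3 (a : R) z : {for z, continuous (fun z => 3 * pospart (z - a))}.
  by apply: continuousM; [exact: cst_continuous|exact: c].
move=> z; exact: (continuousB (continuousD (continuousB (@continuous_pospart z) (c3 1 z)) (c3 2 z)) (c 3 z)).
Qed.

Lemma step_le0 z : z <= 0 -> step z = 0.
Proof.
move=> z0; rewrite /step !pospart_0//; [|lra..].
by field.
Qed.

Lemma step_ge3 z : 3 <= z -> step z = 1.
Proof.
move=> z3; rewrite /step !pospart_id; [|lra..].
by field.
Qed.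

Lemma step'_bound z : 0 <= step' z <= 1.
Proof.
rewrite /step'.
have [z0|z0] := leP z 0; first by rewrite !pospart_0//; [apply/andP; split; lra|lra..].
rewrite (pospart_id (ltW z0)).
have [z1|z1] := leP z 1.
  by rewrite !pospart_0//; [apply/andP; split; nra|lra..].
rewrite (pospart_id (x := z - 1)); last lra.
have [z2|z2] := leP z 2.
  by rewrite !pospart_0//; [apply/andP; split; nra|lra..].
rewrite (pospart_id (x := z - 2)); last lra.
have [z3|z3] := leP z 3.
  by rewrite !pospart_0//; [apply/andP; split; nra|lra..].
rewrite (pospart_id (x := z - 3)); last lra.
by apply/andP; split; nra.
Qed.

Lemma step_bound z : 0 <= step z <= 1.
Proof.
rewrite /step.
have [z0|z0] := leP z 0; first by rewrite !pospart_0//; [apply/andP; split; lra|lra..].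
rewrite (pospart_id (ltW z0)).
have [z1|z1] := leP z 1.
  rewrite !pospart_0//; [|lra..].
  have : z ^+ 3 <= 1 by rewrite exprn_ile1// ltW.
  have : 0 <= z ^+ 3 by rewrite exprn_ge0// ltW.
  by move=> ? ?; apply/andP; split; lra.
rewrite (pospart_id (x := z - 1)); last lra.
have [z2|z2] := leP z 2.
  rewrite !pospart_0//; [|lra..].
  have h1 : 0 <= (2 - z) ^+ 2 * (1 + 2 * (z - 1)) by rewrite mulr_ge0 ?sqr_ge0//; lra.
  have h2 : 0 <= (z - 1) ^+ 2 * (2 - z) by rewrite mulr_ge0 ?sqr_ge0//; lra.
  have h3 : 0 <= (z - 1) ^+ 2 by rewrite sqr_ge0.
  by apply/andP; split; lra.
rewrite (pospart_id (x := z - 2)); last lra.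
have [z3|z3] := leP z 3.
  have h : 0 <= (3 - z) ^+ 3 by rewrite exprn_ge0//; lra.
  have h' : (3 - z) ^+ 3 <= 1 by rewrite exprn_ile1//; lra.
  rewrite !pospart_0//; last lra.
  by apply/andP; split; lra.
rewrite (pospart_id (x := z - 3)); last lra.
by apply/andP; split; lra.
Qed.

Lemma step_lipschitz z z' : `|step z - step z'| <= `|z - z'|.
Proof.
wlog zz' : z z' / z' < z.
  move=> h; have [zz'|zz'|->] := ltgtP z z'; [|exact: h|by rewrite !subrr].
  by rewrite distrC [leRHS]distrC; exact: h.
have cs : {within `[z', z], continuous step}.
  apply: continuous_subspaceT => x; apply: differentiable_continuous; apply/derivable1_diffP.
  by have [] := is_derive_step x.
have [c _ ->] := @MVT _ step step' z' z zz' (fun x _ => is_derive_step x) cs.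
rewrite normrM ler_piMl//; have /andP[h1 h2] := step'_bound c.
by rewrite ger0_norm.
Qed.

End step.

(** * The density of the second variation *)

Section energy.
Context {R : realType}.
Local Notation mu := (@lebesgue_measure R).

(** The ramp runs from 0 to 1 on [2 * A, 5 * A], so the plateau is 1 on
    [5, 2 * A] and 0 outside [2, 5 * A]. *)
Definition ramp (A x : R) : R := step (x / A - 2).
Definition plateau (A x : R) : R := ramp 1 x - ramp A x.

(** With p = 1 + s / 2 this is the Gagliardo density
    (plateau x - plateau x')^2 / |x - x'|^(2 + s), which is, up
    to sign and a constant, the second variation of the energy of the columns x
    and x'. *)
Definition density (p A : R) (q : R * R) : R :=
  (plateau A q.1 - plateau A q.2) ^+ 2 * ((q.1 - q.2) ^+ 2) `^ (- p).

Lemma ramp_eq0 A x : 0 < A -> x <= 2 * A -> ramp A x = 0.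
Proof. by move=> A0 xA; rewrite /ramp step_le0// subr_le0 ler_pdivrMr. Qed.

Lemma ramp_eq1 A x : 0 < A -> 5 * A <= x -> ramp A x = 1.
Proof.
move=> A0 xA; rewrite /ramp step_ge3// lerBrDr ler_pdivlMr//.
by lra.
Qed.

Lemma ramp_bound A x : 0 <= ramp A x <= 1.
Proof. exact: step_bound. Qed.

Lemma ramp_diff_le1 A x x' : `|ramp A x - ramp A x'| <= 1.
Proof.
have /andP[? ?] := ramp_bound A x; have /andP[? ?] := ramp_bound A x'.
by rewrite ler_norml; apply/andP; split; lra.
Qed.

Lemma ramp_lipschitz A x x' : 0 < A -> `|ramp A x - ramp A x'| <= `|x - x'| / A.
Proof.
move=> A0; apply: le_trans (step_lipschitz _ _) _.
rewrite opprB addrA subrK -mulrBl normrM normfV [`|A|]gtr0_norm//.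
Qed.

Lemma plateau_norm_le1 A x : `|plateau A x| <= 1.
Proof.
rewrite /plateau.
have /andP[? ?] := ramp_bound A x; have /andP[? ?] := ramp_bound 1 x.
by rewrite ler_norml; apply/andP; split; lra.
Qed.

Lemma plateau_eq0l A x : 1 <= A -> x <= 2 -> plateau A x = 0.
Proof.
move=> A1 x2; have A0 : 0 < A by apply: lt_le_trans A1.
by rewrite /plateau !ramp_eq0 ?subrr//; lra.
Qed.

Lemma plateau_eq0r A x : 1 <= A -> 5 * A <= x -> plateau A x = 0.
Proof.
move=> A1 x2; have A0 : 0 < A by apply: lt_le_trans A1.
by rewrite /plateau !ramp_eq1 ?subrr//; lra.
Qed.

Lemma plateau_eq1 A x : 0 < A -> 5 <= x -> x <= 2 * A -> plateau A x = 1.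
Proof. by move=> A0 x5 xA; rewrite /plateau ramp_eq1 ?ramp_eq0 ?subr0//; lra. Qed.

Lemma sqr_powR (s y : R) : 0 < y ->
  (y ^+ 2) `^ (- (1 + s / 2)) = y ^- 2 * y `^ (- s).
Proof.
move=> y0; rewrite -powR_invn ?ltW// -powRD; last by rewrite (gt_eqF y0) implybT.
by rewrite -powR_mulrn ?ltW// -powRrM; congr (_ `^ _); field.
Qed.

Lemma sqr_powR_norm (s d : R) : d != 0 ->
  (d ^+ 2) `^ (- (1 + s / 2)) = `|d| ^- 2 * `|d| `^ (- s).
Proof. by move=> d0; rewrite -sqr_powR ?normr_gt0// real_normK ?num_real. Qed.

(** A majorant of the powers |r|^-s near 0 and |r|^-(2 + s) at infinity for all
    s in [0, 1/2] at once. *)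
Definition kappa : R -> R := majorant 2^-1 2.

Lemma kappa_gt1 r : 1 < `|r| -> kappa r = `|r| ^- 2.
Proof. by move=> r1; rewrite /kappa /majorant leNgt r1 /= powR_invn. Qed.

(** The energy of a ramp is nearly scale invariant: in the variable
    r = |x - x'| / A the density carries a factor A^-2, compensated after
    integration by the length of the strips and by the change of variable, and a
    factor A^-s <= 1. For r <= 1
    the Lipschitz bound on the ramp absorbs r^-2, for r > 1 the difference of the
    ramps is bounded by 1. *)
Lemma ramp_energy_density s A x x' : 0 <= s <= 2^-1 -> 1 <= A -> 0 < x -> 0 < x' ->
  (ramp A x - ramp A x') ^+ 2 * ((x - x') ^+ 2) `^ (- (1 + s / 2)) <=
  (in_strip 0 (5 * A) x + in_strip 0 (5 * A) x') * (A ^- 2 * kappa ((x - x') / A)).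
Proof.
move=> /andP[s0 s1] A1 x0 x'0; have A0 : 0 < A by apply: lt_le_trans A1.
have k0 : 0 <= A ^- 2 * kappa ((x - x') / A).
  by rewrite mulr_ge0 ?invr_ge0 ?sqr_ge0 ?majorant_ge0.
have [/andP[xA x'A]|xx'A] := boolP ((5 * A <= x) && (5 * A <= x')).
  by rewrite !ramp_eq1// subrr expr0n/= mul0r mulr_ge0// addr_ge0 ?in_strip_ge0.
have strip1 : 1 <= in_strip 0 (5 * A) x + in_strip 0 (5 * A) x'.
  move: xx'A; rewrite negb_and -!ltNge /in_strip x0 x'0 /=.
  have := ler0n R (x < 5 * A)%R; have := ler0n R (x' < 5 * A)%R.
  by move=> h1 h2 /orP[] h; move: h1 h2; rewrite h /=; lra.
apply: le_trans (ler_peMl k0 strip1).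
have [->|d0] := eqVneq x x'.
  by rewrite subrr expr0n/= mul0r mulr_ge0 ?invr_ge0 ?sqr_ge0 ?majorant_ge0.
have {}d0 : x - x' != 0 by rewrite subr_eq0.
have l1 := ramp_diff_le1 A x x'; have l2 := ramp_lipschitz x x' A0.
move: d0 l1 l2; set d := x - x'; set D := ramp A x - ramp A x' => d0 l1 l2.
pose r := `|d| / A.
have r0 : 0 < r by rewrite divr_gt0 ?normr_gt0.
have dE : `|d| = A * r by rewrite /r mulrCA divff ?mulr1// gt_eqF.
have kE : kappa (d / A) = kappa r.
  by rewrite /kappa /majorant normrM normfV (gtr0_norm A0) (gtr0_norm r0).
rewrite kE sqr_powR_norm// dE exprMn invfM powRM ?(ltW A0) ?(ltW r0)//.
have DD : D ^+ 2 = `|D| ^+ 2 by rewrite real_normK ?num_real.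
rewrite [leLHS](_ : _ = A ^- 2 * (A `^ (- s) * (D ^+ 2 * r ^- 2 * r `^ (- s)))); last by ring.
rewrite ler_wpM2l ?invr_ge0 ?sqr_ge0//.
have As : A `^ (- s) <= 1 by exact: powR_le1.
have nn : 0 <= D ^+ 2 * r ^- 2 * r `^ (- s).
  by rewrite mulr_ge0 ?powR_ge0// mulr_ge0 ?invr_ge0 ?sqr_ge0.
apply: le_trans (ler_piMl nn As) _.
have [r1|r1] := leP r 1.
  rewrite /kappa /majorant gtr0_norm// r1.
  apply: (@le_trans _ _ (r `^ (- s))).
    rewrite ler_piMl ?powR_ge0// ler_pdivrMr ?exprn_gt0// mul1r DD.
    by rewrite ler_pXn2r ?nnegrE ?normr_ge0 ?(ltW r0).
  apply: (@le_trans _ _ (r `^ (- 2^-1))); last by rewrite lerDr.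
  by apply: ger_powR; rewrite ?r0 ?r1// lerN2.
rewrite kappa_gt1 ?gtr0_norm//.
apply: (@le_trans _ _ (D ^+ 2 * r ^- 2)).
  apply: ler_piMr; last by apply: powR_le1 => //; exact: ltW.
  by rewrite mulr_ge0 ?invr_ge0 ?sqr_ge0.
rewrite ler_piMl ?invr_ge0 ?sqr_ge0// DD.
by rewrite expr_le1.
Qed.

Definition same_side (q : R * R) : bool := 0 < q.1 * q.2.
Definition opposite_side (q : R * R) : bool := q.1 * q.2 < 0.

Lemma density_ge0 p A q : 0 <= density p A q.
Proof. by rewrite mulr_ge0 ?sqr_ge0 ?powR_ge0. Qed.

Lemma density_neg p A q : 1 <= A -> q.1 <= 0 -> q.2 <= 0 -> density p A q = 0.
Proof.
move=> A1 x0 x'0; rewrite /density !plateau_eq0l ?subrr ?expr0n/= ?mul0r//; lra.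
Qed.

Lemma density_same_le s A q : 0 <= s <= 2^-1 -> 1 <= A -> same_side q ->
  density (1 + s / 2) A q <=
  2 * ((in_strip 0 5 q.1 + in_strip 0 5 q.2) * kappa (q.1 - q.2)) +
  2 * ((in_strip 0 (5 * A) q.1 + in_strip 0 (5 * A) q.2) * (A ^- 2 * kappa ((q.1 - q.2) / A))).
Proof.
move=> s01 A1; rewrite /same_side; case: q => x x' /= xx'.
have A0 : 0 < A by apply: lt_le_trans A1.
have [x0|x0] := leP x 0.
  have x'0 : x' <= 0.
    by rewrite leNgt; apply/negP => h; have := mulr_le0_ge0 x0 (ltW h); rewrite leNgt xx'.
  rewrite density_neg// addr_ge0// mulr_ge0// mulr_ge0 ?addr_ge0 ?in_strip_ge0 ?majorant_ge0//.
  by rewrite mulr_ge0 ?invr_ge0 ?sqr_ge0 ?majorant_ge0.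
have x'0 : 0 < x' by rewrite -(pmulr_rgt0 _ x0).
have h1 := ramp_energy_density s01 (lexx 1) x0 x'0.
have hA := ramp_energy_density s01 A1 x0 x'0.
move: h1; rewrite expr1n invr1 !mulr1 mul1r => h1.
rewrite /density /plateau /=.
have := powR_ge0 ((x - x') ^+ 2) (- (1 + s / 2)).
move: h1 hA; set P := _ `^ _; set a := ramp 1 x; set a' := ramp 1 x'.
set b := ramp A x; set b' := ramp A x' => h1 hA P0.
have h : (a - b - (a' - b')) ^+ 2 <= 2 * (a - a') ^+ 2 + 2 * (b - b') ^+ 2.
  by have := sqr_ge0 ((a - a') + (b - b')); lra.
apply: le_trans (ler_wpM2r P0 h) _.
rewrite mulrDl -[2 * _ * P]mulrA -[2 * (b - b') ^+ 2 * P]mulrA.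
by apply: lerD; rewrite ler_pM2l.
Qed.

(** The support of the plateau keeps x and x' more than 2 apart. *)
Lemma density_opposite_le s A q : 0 <= s -> 1 <= A -> opposite_side q ->
  density (1 + s / 2) A q <=
  (in_strip 0 (5 * A) q.1 + in_strip 0 (5 * A) q.2) * kappa (q.1 - q.2).
Proof.
move=> s0 A1; rewrite /opposite_side; case: q => x x' /= xx'.
have A0 : 0 < A by apply: lt_le_trans A1.
have k0 : 0 <= (in_strip 0 (5 * A) x + in_strip 0 (5 * A) x') * kappa (x - x').
  by rewrite mulr_ge0 ?addr_ge0 ?in_strip_ge0 ?majorant_ge0.
wlog : x x' xx' k0 / x' < 0.
  move=> h; have [x'0|x'0] := ltP x' 0; first exact: h.
  have x0 : x < 0.
    by rewrite ltNge; apply/negP => h'; have := mulr_ge0 h' x'0; rewrite leNgt xx'.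
  have := h x' x; rewrite mulrC addrC => /(_ xx').
  have kE : kappa (x' - x) = kappa (x - x') by rewrite /kappa /majorant distrC.
  rewrite kE => /(_ k0 x0); congr (_ <= _).
  by rewrite /density /= -sqrrN opprB; congr (_ * _ `^ _); rewrite -sqrrN opprB.
move=> x'0.
have x0 : 0 < x by rewrite -(nmulr_llt0 _ x'0).
rewrite /density /= (plateau_eq0l A1 (x := x')); last lra.
rewrite subr0.
have [x2|x2] := leP x 2; first by rewrite plateau_eq0l// expr0n/= mul0r.
have [xA|xA] := leP (5 * A) x; first by rewrite plateau_eq0r// expr0n/= mul0r.
rewrite {1}/in_strip x0 xA/=.
have d1 : 1 < x - x' by lra.
have d0 : 0 < x - x' by lra.
rewrite kappa_gt1 ?gtr0_norm// sqr_powR//.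
have K0 : 0 <= (x - x') ^- 2 by rewrite invr_ge0 sqr_ge0.
apply: (@le_trans _ _ ((x - x') ^- 2)); last first.
  by rewrite ler_peMl// lerDl in_strip_ge0.
apply: (@le_trans _ _ ((x - x') ^- 2 * (x - x') `^ (- s))).
  rewrite ler_piMl ?mulr_ge0 ?powR_ge0// -(real_normK (num_real _)) expr_le1//.
  exact: plateau_norm_le1.
by rewrite ler_piMr// powR_le1// ltW.
Qed.

End energy.

(** * Columns on opposite sides outweigh columns on the same side *)

Section energy_integrals.
Context {R : realType}.
Local Notation mu := (@lebesgue_measure R).
Local Notation T := (measurableTypeR R).

Lemma continuous_step : continuous (@step R).
Proof.
move=> x; apply: differentiable_continuous; apply/derivable1_diffP.
by have [] := is_derive_step x.
Qed.

Lemma measurable_plateau (A : R) : measurable_fun setT (plateau A).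
Proof.
have mr (B : R) : measurable_fun setT (ramp B : R -> R).
  apply: (measurableT_comp (continuous_measurable_fun continuous_step)).
  by apply: measurable_funB => //; exact: measurable_funM.
exact: measurable_funB.
Qed.

Lemma measurable_density (p A : R) :
  measurable_fun [set: (T * T)%type] (density p A : T * T -> R).
Proof.
apply: measurable_funM.
  apply: measurable_funX; apply: measurable_funB;
    by apply: (measurableT_comp (measurable_plateau A)).
apply: (measurableT_comp (measurable_powR _)).
by apply: measurable_funX; apply: measurable_funB.
Qed.

Lemma measurable_same_side : measurable_fun [set: (T * T)%type] (@same_side R : T * T -> bool).
Proof. by apply: measurable_fun_ltr => //; exact: measurable_funM. Qed.

Lemma measurable_opposite_side : measurable_fun [set: (T * T)%type] (@opposite_side R : T * T -> bool).
Proof. by apply: measurable_fun_ltr => //; exact: measurable_funM. Qed.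

Definition kappa_mass : R := fine (\int[mu]_r (kappa r)%:E)%E.

Let kappa_lty : (\int[mu]_r (kappa r)%:E < +oo)%E.
Proof. by apply: integral_majorant_lty; lra. Qed.

Let kappa_massE : (\int[mu]_r (kappa r)%:E = kappa_mass%:E)%E.
Proof.
rewrite fineK// ge0_fin_numE//.
by apply: integral_ge0 => r _; rewrite lee_fin majorant_ge0.
Qed.

Let mkappa : measurable_fun setT (@kappa R).
Proof. exact: measurable_majorant. Qed.

Let kappa_ge0 (r : R) : 0 <= kappa r.
Proof. exact: majorant_ge0. Qed.

Let kappa_scale (A : R) : 0 < A ->
  (\int[mu]_r (A ^- 2 * kappa (r / A))%:E = (A^-1 * kappa_mass)%:E)%E.
Proof.
move=> A0.
have mEk : measurable_fun setT (fun r : R => (kappa r)%:E) by exact/measurable_EFinP.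
have A'0 : 0 < A^-1 by rewrite invr_gt0.
have -> : (A^-1 * kappa_mass)%:E = ((A ^- 2 * A)%:E * \int[mu]_r (kappa r)%:E)%E.
  by rewrite kappa_massE -EFinM; congr EFin; field; rewrite gt_eqF.
have k0 (r : R) : (0 <= (kappa r)%:E)%E by rewrite lee_fin.
rewrite (@ge0_integral_affine _ A^-1 0 (fun r => (kappa r)%:E))//.
rewrite muleA -EFinM mulfK ?gt_eqF//.
have mkA : measurable_fun setT (fun r : R => (kappa (A^-1 * r + 0))%:E).
  by apply: (measurableT_comp mEk); exact: measurable_affine.
have A2 : 0 <= A ^- 2 by rewrite invr_ge0 sqr_ge0.
rewrite -(@ge0_integralZl_EFin _ _ _ mu setT measurableT _ (fun r _ => k0 _) mkA _ A2).
by apply: eq_integral => r _; rewrite -EFinM addr0 [A^-1 * r]mulrC.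
Qed.

(** The plateau is a difference of two ramps, at the scales 1 and A, and each
    ramp has an energy bounded independently of its scale. *)
Lemma energy_same_le (s A : R) : 0 <= s <= 2^-1 -> 1 <= A ->
  (\int[leb2 R]_q (if same_side q then density (1 + s / 2) A q else 0)%:E <=
   (40 * kappa_mass)%:E)%E.
Proof.
move=> s01 A1; have A0 : 0 < A by apply: lt_le_trans A1.
have kA0 (r : R) : 0 <= A ^- 2 * kappa (r / A) by rewrite mulr_ge0 ?invr_ge0 ?sqr_ge0.
have mkA : measurable_fun setT (fun r : R => A ^- 2 * kappa (r / A)).
  apply: measurable_funM => //; apply: (measurableT_comp mkappa); exact: measurable_funM.
pose f1 (q : T * T) : \bar R := ((in_strip 0 5 q.1 + in_strip 0 5 q.2) * kappa (q.1 - q.2))%:E.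
pose f2 (q : T * T) : \bar R := ((in_strip 0 (5 * A) q.1 + in_strip 0 (5 * A) q.2) * (A ^- 2 * kappa ((q.1 - q.2) / A)))%:E.
have mf (b : R) (k : R -> R) : measurable_fun setT k -> measurable_fun [set: (T * T)%type]
   (fun q : T * T => ((in_strip 0 b q.1 + in_strip 0 b q.2) * k (q.1 - q.2))%:E).
  move=> mk; apply/measurable_EFinP; apply: measurable_funM.
    by apply: measurable_funD; exact: measurable_in_strip.
  by apply: (measurableT_comp mk); exact: measurable_funB.
have f10 q : (0 <= f1 q)%E by rewrite lee_fin mulr_ge0 ?addr_ge0 ?in_strip_ge0.
have f20 q : (0 <= f2 q)%E by rewrite lee_fin mulr_ge0 ?addr_ge0 ?in_strip_ge0.
have mf1 : measurable_fun setT f1 by exact: mf.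
have mf2 : measurable_fun setT f2 by exact: (mf _ _ mkA).
apply: (@le_trans _ _ (\int[leb2 R]_q (2%:E * f1 q + 2%:E * f2 q))%E).
  apply: ge0_le_integral => //.
  - by move=> q _; rewrite lee_fin; case: ifP => // _; rewrite density_ge0.
  - apply/measurable_EFinP; apply: measurable_fun_ifT => //; [exact: measurable_same_side|exact: measurable_density].
  - by apply: emeasurable_funD; exact: measurable_funeM.
  - move=> q _; case: ifP => sq; last by rewrite adde_ge0// mule_ge0.
    by rewrite /f1 /f2 -!EFinM -EFinD lee_fin; exact: density_same_le.
rewrite ge0_integralD//; last 4 first.
- by move=> q _; rewrite mule_ge0.
- exact: measurable_funeM.
- by move=> q _; rewrite mule_ge0.
- exact: measurable_funeM.
rewrite !ge0_integralZl_EFin// integral_two_strips//.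
rewrite (integral_two_strips mkA kA0) ?mulr_gt0//.
rewrite kappa_massE kappa_scale// -!EFinM -EFinD lee_fin !subr0.
rewrite le_eqVlt; apply/orP; left; apply/eqP; field.
by rewrite gt_eqF.
Qed.

Lemma energy_opposite_lty (s A : R) : 0 <= s -> 1 <= A ->
  (\int[leb2 R]_q (if opposite_side q then density (1 + s / 2) A q else 0)%:E < +oo)%E.
Proof.
move=> s0 A1; have A0 : 0 < A by apply: lt_le_trans A1.
apply: (@le_lt_trans _ _ (\int[leb2 R]_q ((in_strip 0 (5 * A) q.1 + in_strip 0 (5 * A) q.2) * kappa (q.1 - q.2))%:E)%E).
  apply: ge0_le_integral => //.
  - by move=> q _; rewrite lee_fin; case: ifP => // _; rewrite density_ge0.
  - apply/measurable_EFinP; apply: measurable_fun_ifT => //; [exact: measurable_opposite_side|exact: measurable_density].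
  - apply/measurable_EFinP; apply: measurable_funM.
      by apply: measurable_funD; exact: measurable_in_strip.
    by apply: (measurableT_comp mkappa); exact: measurable_funB.
  - move=> q _; rewrite lee_fin; case: ifP => sq; first exact: density_opposite_le.
    by rewrite mulr_ge0 ?addr_ge0 ?in_strip_ge0.
by rewrite integral_two_strips// ?mulr_gt0// kappa_massE -EFinM ltry.
Qed.

(** Slabs exhausting, by doublings, a part of the region where the plateau is 1
    at q.1 and 0 at q.2. *)
Let slab (k : nat) : set (T * T) := `[8, 8 * 2 ^+ k[ `*` `]-oo, 0[.

Let mslab k : measurable (slab k).
Proof. by apply: measurableX. Qed.

(** Where the plateau is 1 at q.1 and 0 at q.2, the density is
    |q.1 - q.2|^-(2 + s), whose integral diverges logarithmically for s = 0.
    Each of the n doublings contributes at least 1 / 18, as long as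
    |q.1 - q.2|^s stays below 2 at the largest scale: this is the reason for the
    condition on s. *)
Lemma energy_opposite_ge (s : R) (n : nat) : 0 <= s -> s * n.+4%:R <= 1 ->
  ((n%:R / 18)%:E <=
    \int[leb2 R]_q (if opposite_side q then density (1 + s / 2) (2 ^+ n.+2) q else 0)%:E)%E.
Proof.
move=> s0 sn; set A : R := 2 ^+ n.+2.
have A1 : 1 <= A by rewrite exprn_ege1// ler1n.
have A0 : 0 < A by apply: lt_le_trans A1.
pose f (q : T * T) : \bar R := (if opposite_side q then density (1 + s / 2) A q else 0)%:E.
have mf : measurable_fun setT f.
  apply/measurable_EFinP; apply: measurable_fun_ifT => //; [exact: measurable_opposite_side|exact: measurable_density].
have f0 q : (0 <= f q)%E by rewrite lee_fin; case: ifP => // _; rewrite density_ge0.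
have step k : (k < n)%N -> (18^-1%:E <= \int[leb2 R]_(q in slab k.+1 `\` slab k) f q)%E.
  move=> kn; pose r : R := 8 * 2 ^+ k.
  have r0 : 0 < r by rewrite mulr_gt0// exprn_gt0.
  have rA : 2 * r <= 2 * A.
    rewrite ler_pM2l// /r /A (_ : 8 = 2 ^+ 3); last by rewrite -natrX.
    by rewrite -exprD ler_eXn2l// ?ltr1n// addnC.
  (* On B the distance is at most 3 * r, and B has area r ^+ 2. *)
  pose B : set (T * T) := `[r, 2 * r[ `*` `]- r, 0[.
  have mB : measurable B by apply: measurableX.
  have Bsub : B `<=` slab k.+1 `\` slab k.
    move=> [x y] /= [/=]; rewrite !in_itv/= => /andP[x1 x2] /andP[y1 y2]; split.
      split; rewrite /= in_itv/= ?y2//; apply/andP; split.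
        by apply: le_trans x1; rewrite ler_peMr// exprn_ege1// ler1n.
      by apply: (lt_le_trans x2); rewrite exprS mulrCA.
    by move=> [/=]; rewrite in_itv/= => /andP[_]; rewrite ltNge x1.
  have mD : measurable (slab k.+1 `\` slab k) by exact: measurableD.
  apply: (@le_trans _ _ (\int[leb2 R]_(q in B) f q)%E); last first.
    apply: ge0_subset_integral => //.
    exact: (measurable_funS measurableT).
  have muB : leb2 R B = (r * r)%:E.
    rewrite product_measure1E//= !lebesgue_measure_itv/= !lte_fin.
    rewrite ltr_pMl// ltr1n oppr_lt0 r0 -!EFinD -EFinM; congr EFin; ring.
  pose c : R := (18 * r ^+ 2)^-1.
  have c0 : 0 <= c by rewrite invr_ge0 mulr_ge0// sqr_ge0.
  apply: (@le_trans _ _ (\int[leb2 R]_(q in B) c%:E)%E).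
    rewrite integral_cst// [X in (_ * X)%E]muB -EFinM lee_fin /c.
    rewrite le_eqVlt; apply/orP; left; apply/eqP; field.
    by rewrite gt_eqF.
  apply: ge0_le_integral => //.
    exact: (measurable_funS measurableT).
  move=> [x y] /= [/=]; rewrite !in_itv/= => /andP[x1 x2] /andP[y1 y2].
  have r8 : 8 <= r by rewrite ler_peMr// exprn_ege1// ler1n.
  rewrite /f lee_fin /opposite_side /= nmulr_llt0// (lt_le_trans _ x1)//.
  rewrite /density/= (plateau_eq0l A1 (x := y)); last lra.
  rewrite plateau_eq1//; [|lra|lra].
  rewrite subr0 expr1n mul1r sqr_powR; last lra.
  have d0 : 0 < x - y by lra.
  have d3 : x - y <= 3 * r by lra.
  have h1 : (3 * r) ^- 2 <= (x - y) ^- 2.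
    rewrite lef_pV2 ?posrE ?exprn_gt0 ?mulr_gt0//.
    by rewrite ler_pXn2r ?nnegrE ?(ltW d0)// mulr_ge0// ltW.
  have h2 : 2^-1 <= (x - y) `^ (- s).
    rewrite powRN lef_pV2 ?posrE ?powR_gt0//.
    apply: (@le_trans _ _ ((2 ^+ n.+4) `^ s)).
      have AA : 2 ^+ n.+4 = 2 * (2 * A) by rewrite /A -!exprS.
      apply: ge0_ler_powR; rewrite ?nnegrE ?exprn_ge0 ?(ltW d0)// AA; lra.
    rewrite -powR_mulrn// -powRrM mulrC -[leRHS]powRr1//.
    by apply: ler_powR => //; rewrite ler1n.
  rewrite /c; apply: (@le_trans _ _ ((3 * r) ^- 2 * 2^-1)).
    rewrite le_eqVlt; apply/orP; left; apply/eqP; field.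
    by rewrite gt_eqF.
  by apply: ler_pM => //; rewrite invr_ge0 sqr_ge0.
have main k : (k <= n)%N -> ((k%:R / 18)%:E <= \int[leb2 R]_(q in slab k) f q)%E.
  elim: k => [_|k IH kn]; first by rewrite mul0r integral_ge0.
  have sub : slab k `<=` slab k.+1.
    move=> [x y] [/=]; rewrite !in_itv/= => /andP[x1 x2] y0; split; rewrite /= in_itv/= ?x1//=.
    apply: (lt_le_trans x2); rewrite ler_pM2l// exprS ler_peMl ?exprn_ge0//.
    by rewrite ler1n.
  have -> : slab k.+1 = slab k `|` (slab k.+1 `\` slab k) by rewrite setDUK.
  rewrite ge0_integral_setU//; last 3 first.
  - exact: measurableD.
  - exact: (measurable_funS measurableT).
  - by apply/disj_setPS => q [? []].
  rewrite -natr1 mulrDl mul1r EFinD leeD// ?IH// ?step//.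
  exact: ltnW.
apply: (le_trans (main n (leqnn n))).
apply: ge0_subset_integral => //.
Qed.

End energy_integrals.

(** * Finiteness of the perimeter of the cross *)

Section finiteness.
Context {R : realType}.
Local Notation mu := (@lebesgue_measure R).
Local Notation T := (measurableTypeR R).

Lemma ae_generic_pair :
  {ae leb2 R, forall q : T * T, q.1 != q.2 /\ q.1 * q.2 != 0}.
Proof.
pose Z0 : set T := [set 0].
pose ZT : set T := setT.
have mZ0 : measurable Z0 by exact: measurable_set1.
have mZT : measurable ZT by exact: measurableT.
have muZ0 : mu Z0 = 0%E by exact: lebesgue_measure_set1.
pose N : set (T * T) := [set q | q.1 == q.2] `|` (Z0 `*` ZT) `|` (ZT `*` Z0).
have mdiag : measurable ([set q | q.1 == q.2] : set (T * T)).
  have : measurable_fun setT (fun q : T * T => q.1 == q.2) by apply: measurable_fun_eqr.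
  by move=> /(_ measurableT [set true] I); rewrite setTI.
have m01 : measurable ((Z0 `*` ZT) : set (T * T)) by exact: measurableX.
have m02 : measurable ((ZT `*` Z0) : set (T * T)) by exact: measurableX.
have n1 : leb2 R [set q | q.1 == q.2] = 0%E.
  rewrite /product_measure1 integral0_eq// => x _ /=.
  rewrite (_ : xsection _ _ = [set x]) ?lebesgue_measure_set1//.
  by apply/seteqP; split => y; rewrite /xsection/= inE/=; [move=> /eqP ->|move=> ->; rewrite eqxx].
have n2 : leb2 R (Z0 `*` ZT) = 0%E.
  transitivity (mu Z0 * mu ZT)%E; first exact: product_measure1E.
  by rewrite muZ0 mul0e.
have n3 : leb2 R (ZT `*` Z0) = 0%E.
  transitivity (mu ZT * mu Z0)%E; first exact: product_measure1E.
  by rewrite muZ0 mule0.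
exists N; split.
- by apply: measurableU => //; exact: measurableU.
- apply/eqP; rewrite -measure_le0.
  apply: (le_trans (measureU2 _ _ _)) => //; first exact: measurableU.
  rewrite [X in (_ + X)%E]n3 adde0.
  by apply: (le_trans (measureU2 _ _ _)) => //; rewrite [X in (X + _)%E]n1 [X in (_ + X)%E]n2 adde0.
- move=> [x y] /= /not_andP[|].
    by move=> /negP; rewrite negbK => xy; left; left.
  move=> /negP; rewrite negbK mulf_eq0 => /orP[/eqP ->|/eqP ->].
    by left; right.
  by right.
Qed.

Lemma powRN_le (x y e : R) : 0 < x -> x <= y -> 0 <= e -> y `^ (- e) <= x `^ (- e).
Proof.
move=> x0 xy e0; have y0 : 0 < y by exact: lt_le_trans xy.
rewrite !powRN lef_pV2 ?posrE ?powR_gt0//.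
by apply: ge0_ler_powR; rewrite ?nnegrE ?(ltW x0) ?(ltW y0).
Qed.

Lemma normr_powR (d e : R) : `|d| `^ (- e) = (d ^+ 2) `^ (- (e / 2)).
Proof.
rewrite -[in RHS](real_normK (num_real d)) -powR_mulrn// -powRrM; congr (_ `^ _); by field.
Qed.

(** Of the powers - al / 2 and - be / 2 of d ^+ 2 + z ^+ 2, the first one is
    bounded by means of d and the second one by means of z: this splits the
    singularity of the kernel between the two offsets. *)
Lemma kern_le_prod (p d z al be : R) : d != 0 -> z != 0 -> 0 <= al -> 0 <= be ->
  al + be = 2 * p -> kern p d z <= `|d| `^ (- al) * `|z| `^ (- be).
Proof.
move=> d0 z0 al0 be0 ab; rewrite /kern !normr_powR.
have dd : 0 < d ^+ 2 by rewrite exprn_even_gt0.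
have zz : 0 < z ^+ 2 by rewrite exprn_even_gt0.
have -> : - p = - (al / 2) + - (be / 2) by lra.
have h : d ^+ 2 + z ^+ 2 != 0 by rewrite gt_eqF// addr_gt0.
rewrite powRD; last by rewrite h implybT.
apply: ler_pM; rewrite ?powR_ge0//; apply: powRN_le => //.
- by rewrite lerDl ltW.
- by rewrite divr_ge0.
- by rewrite lerDr ltW.
- by rewrite divr_ge0.
Qed.

Lemma kern_le_d (p d z : R) : d != 0 -> 0 <= p -> kern p d z <= `|d| `^ (- (2 * p)).
Proof.
move=> d0 p0; rewrite normr_powR mulrAC divff// mul1r.
by apply: powRN_le; rewrite ?exprn_even_gt0// lerDl sqr_ge0.
Qed.

Lemma majorant_le1 (a b z : R) : `|z| <= 1 -> 1 <= majorant a b z.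
Proof. by move=> z1; rewrite /majorant z1 lerDl powR_ge0. Qed.

Lemma powR_le_majorant (a b z : R) : `|z| <= 1 -> `|z| `^ (- a) <= majorant a b z.
Proof. by move=> z1; rewrite /majorant z1 lerDr. Qed.

Lemma majorant_gt1 (a b z : R) : 1 < `|z| -> majorant a b z = `|z| `^ (- b).
Proof. by move=> z1; rewrite /majorant leNgt z1. Qed.

(** The exponents 1/2 and 3/4 are below 1 near the origin, and 1 + s / 2 exceeds
    1 at infinity, so both factors are integrable. *)
Let far_bound (s d z : R) : 0 <= s -> 1 < `|d| ->
  kern (1 + s / 2) d z <= majorant 2^-1 (1 + s / 2) d * majorant (3 / 4) (1 + s / 2) z.
Proof.
move=> s0 d1; have d0 : d != 0 by rewrite -normr_gt0 (lt_trans _ d1).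
rewrite (majorant_gt1 _ _ d1).
have [z1|z1] := leP `|z| 1.
  apply: (@le_trans _ _ (`|d| `^ (- (1 + s / 2)))); last first.
    by rewrite ler_peMr ?powR_ge0// majorant_le1.
  apply: (le_trans (kern_le_d _ d0 _)); first lra.
  by apply: ler_powR; [exact: ltW|lra].
rewrite majorant_gt1//; apply: kern_le_prod => //; [|lra|lra|lra].
by rewrite -normr_gt0 (lt_trans _ z1).
Qed.

Lemma kern_far (s d z r : R) : 0 <= s -> 0 < r -> 1 < `|d| ->
  kern (1 + s / 2) d z * (2 * r) <=
  (1 + 2 * r) * (majorant 2^-1 (1 + s / 2) d * majorant (3 / 4) (1 + s / 2) z).
Proof.
move=> s0 r0 d1; rewrite mulrC ler_pM ?mulr_ge0 ?kern_ge0 ?(ltW r0)//; first lra.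
exact: far_bound.
Qed.

(** For columns on the same side the length is at most |z|, which lowers the
    exponent 3 / 2 + s left to the vertical offset by 1. The distance between
    the columns takes the exponent 1 / 2. *)
Lemma kern_near (s d z r : R) : 0 <= s <= 4^-1 -> 0 < r -> d != 0 ->
  kern (1 + s / 2) d z * Num.min `|z| (2 * r) <=
  (1 + 2 * r) * (majorant 2^-1 (1 + s / 2) d * majorant (3 / 4) (1 + s / 2) z).
Proof.
move=> /andP[s0 s1] r0 d0.
have r1 : 0 <= 2 * r by rewrite mulr_ge0// ltW.
have [d1|d1] := ltP 1 `|d|.
  apply: le_trans (kern_far _ s0 r0 d1).
  by rewrite ler_wpM2l ?kern_ge0// ge_min lexx orbT.
have M0 : 0 <= majorant 2^-1 (1 + s / 2) d * majorant (3 / 4) (1 + s / 2) z.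
  by rewrite mulr_ge0 ?majorant_ge0.
have [->|z0] := eqVneq z 0.
  rewrite normr0 (min_idPl _)// mulr0 mulr_ge0 ?majorant_ge0 ?addr_ge0 ?mulr_ge0 ?majorant_ge0//.
  exact: ltW.
have kle : kern (1 + s / 2) d z <= `|d| `^ (- 2^-1) * `|z| `^ (- (3 / 2 + s)).
  by apply: kern_le_prod => //; lra.
have z'0 : 0 < `|z| by rewrite normr_gt0.
have [z1|z1] := leP `|z| 1.
  apply: (@le_trans _ _ (majorant 2^-1 (1 + s / 2) d * majorant (3 / 4) (1 + s / 2) z)); last first.
    by rewrite ler_peMl//; lra.
  apply: (@le_trans _ _ (`|d| `^ (- 2^-1) * `|z| `^ (- (3 / 4)))); last first.
    by apply: ler_pM; rewrite ?powR_ge0// powR_le_majorant.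
  apply: (@le_trans _ _ (`|d| `^ (- 2^-1) * `|z| `^ (- (3 / 2 + s)) * `|z|)).
    by apply: ler_pM; rewrite ?kern_ge0// ?le_min ?normr_ge0// ge_min lexx.
  rewrite -mulrA ler_wpM2l ?powR_ge0// -[X in _ * X]powRr1 ?(ltW z'0)//.
  rewrite -powRD; last by rewrite (gt_eqF z'0) implybT.
  by apply: ger_powR; rewrite ?z'0 ?z1//; lra.
rewrite mulrC; apply: ler_pM; rewrite ?kern_ge0//.
- by rewrite le_min normr_ge0.
- by rewrite (@le_trans _ _ (2 * r))// ?ge_min ?lexx ?orbT//; lra.
apply: (le_trans kle); apply: ler_pM; rewrite ?powR_ge0// ?powR_le_majorant//.
by rewrite majorant_gt1//; apply: ler_powR; [exact: ltW|lra].
Qed.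

Variables (b r : R).
Hypothesis b1 : 1 < b.
Hypothesis r0 : 0 < r.

Let column_length0 x x' z := column_length 1 b r (fun=> 0 : R) x x' z.

(** Columns on the same side are controlled by [kern_near]. Columns on opposite
    sides, one of which meets the box, are more than 1 apart because the box
    lies in x > 1, so [kern_far] applies. *)
Lemma base_pair_le (s x x' z : R) : 0 <= s <= 4^-1 -> x != x' -> x * x' != 0 ->
  ((kern (1 + s / 2) (x - x') z)%:E * column_length0 x x' z <=
   ((in_strip 1 b x + in_strip 1 b x') *
    ((1 + 2 * r) * majorant 2^-1 (1 + s / 2) (x - x')) * majorant (3 / 4) (1 + s / 2) z)%:E)%E.
Proof.
move=> s01 xx' x0; have s0 : 0 <= s by case/andP: s01.
have d0 : x - x' != 0 by rewrite subr_eq0.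
have m0 : measurable_fun setT (fun _ : R => 0 : R) by [].
have cle : (column_length0 x x' z <= ((in_strip 1 b x + in_strip 1 b x') * (2 * r))%:E)%E.
  by rewrite mulrDl EFinD; exact: column_length_le.
have cge : (0 <= column_length0 x x' z)%E by exact: measure_ge0.
have cfin : column_length0 x x' z \is a fin_num by rewrite ge0_fin_numE//; apply: le_lt_trans cle (ltry _).
have cz : 0 < x * x' -> (column_length0 x x' z <= `|z|%:E)%E by move=> h; apply: column_length0_le.
move: cle cge cz; rewrite -(fineK cfin) -EFinM !lee_fin.
set c := fine _ => cle cge cz.
set S := in_strip 1 b x + in_strip 1 b x' in cle *.
have S01 : S = 0 \/ 1 <= S.
  rewrite /S /in_strip; case: (1 < x < b); case: (1 < x' < b) => /=; [right|right|right|left]; lra.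
have [S0|S1] := S01.
  have -> : c = 0 by apply/eqP; rewrite eq_le cge andbT (le_trans cle)// S0 mul0r.
  by rewrite S0 !mul0r mulr0.
rewrite -!mulrA; have k0 := kern_ge0 (1 + s / 2) (x - x') z.
have S0 : 0 <= S by lra.
have [same|opp|/eqP] := ltgtP 0 (x * x'); last by rewrite eq_sym (negbTE x0).
  have h := kern_near z s01 r0 d0.
  apply: (@le_trans _ _ (S * (kern (1 + s / 2) (x - x') z * Num.min `|z| (2 * r)))); last by rewrite ler_wpM2l.
  rewrite mulrCA ler_wpM2l//; rewrite minr_pMr// le_min cle andbT.
  by apply: (le_trans (cz same)); rewrite ler_peMl.
have d1 : 1 < `|x - x'|.
  have h : (1 < x) \/ (1 < x').
    move: S1; rewrite /S /in_strip; case: (boolP (1 < x < b)) => [/andP[h _] _|_]; first by left.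
    case: (boolP (1 < x' < b)) => [/andP[h _] _|_]; first by right.
    by rewrite /= addr0 ler10.
  case: h => h.
    have x'0 : x' < 0 by rewrite -(pmulr_rlt0 _ (lt_trans ltr01 h)).
    by rewrite gtr0_norm; lra.
  have x'0 : x < 0 by rewrite -(pmulr_llt0 _ (lt_trans ltr01 h)).
  by rewrite ltr0_norm; lra.
have h := kern_far z s0 r0 d1.
apply: (@le_trans _ _ (S * (kern (1 + s / 2) (x - x') z * (2 * r)))); last by rewrite ler_wpM2l.
by rewrite mulrCA ler_wpM2l.
Qed.

Lemma measurable_pair_energy p (a : R) (u : R -> R) : measurable_fun setT u ->
  measurable_fun setT (fun q : T * T => pair_energy a b r p u q.1 q.2).
Proof.
move=> mu'.
apply: (measurable_fun_fubini_tonelli_F (m2 := mu) (fun w : (T * T) * T =>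
  ((kern p (w.1.1 - w.1.2) w.2)%:E * column_length a b r u w.1.1 w.1.2 w.2)%E)).
  apply: emeasurable_funM; last exact: measurable_column_length_joint.
  apply/measurable_EFinP; apply: measurable_kern => //.
  by apply: measurable_funB; apply: measurableT_comp.
by move=> w; rewrite mule_ge0 ?lee_fin ?kern_ge0//; exact: measure_ge0.
Qed.

Lemma base_energy_lty (s : R) : 0 < s <= 4^-1 ->
  (\int[leb2 R]_q pair_energy 1%R b r (1 + s / 2)%R (fun=> 0%R) q.1 q.2 < +oo)%E.
Proof.
move=> /andP[s0 s1]; have s01 : 0 <= s <= 4^-1 by rewrite (ltW s0).
have m0 : measurable_fun setT (fun _ : R => 0 : R) by [].
have Mlty : (\int[mu]_z (majorant (3 / 4) (1 + s / 2) z)%:E < +oo)%E.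
  by apply: integral_majorant_lty; lra.
have M'lty : (\int[mu]_z (majorant 2^-1 (1 + s / 2) z)%:E < +oo)%E.
  by apply: integral_majorant_lty; lra.
pose M := fine (\int[mu]_z (majorant (3 / 4) (1 + s / 2) z)%:E)%E.
have mmaj (a c : R) : measurable_fun setT (fun z : R => (majorant a c z)%:E).
  by apply/measurable_EFinP; exact: measurable_majorant.
have Zl (a c e : R) : 0 <= c ->
    (\int[mu]_z (c%:E * (majorant a e z)%:E) = c%:E * \int[mu]_z (majorant a e z)%:E)%E.
  move=> c0; apply: ge0_integralZl_EFin => //; first by move=> z _; rewrite lee_fin majorant_ge0.
  exact: mmaj.
have ME : (\int[mu]_z (majorant (3 / 4) (1 + s / 2) z)%:E = M%:E)%E.
  rewrite /M fineK// ge0_fin_numE//.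
  by apply: integral_ge0 => z _; rewrite lee_fin majorant_ge0.
have M0 : 0 <= M by apply: fine_ge0; apply: integral_ge0 => z _; rewrite lee_fin majorant_ge0.
pose k (d : R) : R := M * (1 + 2 * r) * majorant 2^-1 (1 + s / 2) d.
have C0 : 0 <= M * (1 + 2 * r) by rewrite mulr_ge0// addr_ge0// mulr_ge0// ltW.
have k0 d : 0 <= k d by rewrite mulr_ge0 ?majorant_ge0.
have mk : measurable_fun setT k by apply: measurable_funM => //; exact: measurable_majorant.
apply: (@le_lt_trans _ _ (\int[leb2 R]_q ((in_strip 1 b q.1 + in_strip 1 b q.2) * k (q.1 - q.2))%:E)%E).
  apply: ae_ge0_le_integral => //.
  - by move=> q _; apply: pair_energy_ge0.
  - exact: measurable_pair_energy.
  - by move=> q _; rewrite lee_fin mulr_ge0 ?addr_ge0 ?in_strip_ge0.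
  - apply/measurable_EFinP; apply: measurable_funM.
      by apply: measurable_funD; exact: measurable_in_strip.
    by apply: (measurableT_comp mk); exact: measurable_funB.
  - apply: filterS ae_generic_pair => -[x x'] /= [xx' x0] _.
    rewrite /pair_energy.
    pose C := (in_strip 1 b x + in_strip 1 b x') * ((1 + 2 * r) * majorant 2^-1 (1 + s / 2) (x - x')).
    have CC0 : 0 <= C.
      by rewrite mulr_ge0 ?addr_ge0 ?in_strip_ge0// mulr_ge0 ?majorant_ge0// addr_ge0// mulr_ge0// ltW.
    apply: (@le_trans _ _ (\int[mu]_z (C%:E * (majorant (3 / 4) (1 + s / 2) z)%:E))%E).
      apply: ge0_le_integral => //.
      + by move=> z _; rewrite mule_ge0 ?lee_fin ?kern_ge0//; exact: measure_ge0.
      + apply: emeasurable_funM; last exact: measurable_column_length.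
        by apply/measurable_EFinP; exact: measurable_kern.
      + by apply: measurable_funeM; exact: mmaj.
      + by move=> z _; rewrite -EFinM; exact: base_pair_le.
    rewrite Zl//.
    rewrite ME -EFinM lee_fin /C /k.
    by rewrite le_eqVlt; apply/orP; left; apply/eqP; ring.
rewrite integral_two_strips//.
under eq_integral do rewrite EFinM.
rewrite Zl//.
rewrite muleA -EFinM; apply: lte_mul_pinfty => //.
by rewrite lee_fin mulr_ge0// mulr_ge0// subr_ge0 ltW.
Qed.

End finiteness.

(** * The perimeter along the deformation *)

Section leb2_sum.
Context {R : realType}.
Local Notation T := (measurableTypeR R).

Lemma leb2_integralD (f g : T * T -> \bar R) :
  measurable_fun setT f -> measurable_fun setT g ->
  (forall q, (0 <= f q)%E) -> (forall q, (0 <= g q)%E) ->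
  (\int[leb2 R]_q (f q + g q) = \int[leb2 R]_q f q + \int[leb2 R]_q g q)%E.
Proof. by move=> mf mg f0 g0; rewrite ge0_integralD. Qed.

End leb2_sum.

Section along.
Context {R : realType}.
Local Notation mu := (@lebesgue_measure R).
Local Notation T := (measurableTypeR R).
Local Notation nu := (leb2 R \x mu)%E.

Definition bump_mass : R := fine (\int[mu]_m (tent 1 m)%:E)%E.

Let tent_le (m : R) : tent 1 m <= in_strip (-1) 1 m.
Proof.
rewrite /tent /in_strip -ltr_norml; case: ltP => h /=.
  by rewrite ge_max ler01 lerBlDr lerDl normr_ge0.
by rewrite (max_idPl _)// subr_le0.
Qed.

Let bump_massE : (\int[mu]_m (tent 1 m)%:E = bump_mass%:E)%E.
Proof.
have h0 : (0 <= \int[mu]_m (tent (1:R) m)%:E)%E.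
  by apply: integral_ge0 => m _; rewrite lee_fin tent_ge0.
rewrite fineK// ge0_fin_numE//.
apply: (@le_lt_trans _ _ (\int[mu]_m (in_strip (-1) 1 m)%:E)%E).
  apply: ge0_le_integral => //.
  - by move=> m _; rewrite lee_fin tent_ge0.
  - by apply/measurable_EFinP; exact: measurable_tent.
  - by apply/measurable_EFinP; exact: measurable_in_strip.
  - by move=> m _; rewrite lee_fin.
by rewrite integral_in_strip ?ltry//; lra.
Qed.

Lemma bump_mass_gt0 : 0 < bump_mass.
Proof.
rewrite -lte_fin -bump_massE.
apply: (@lt_le_trans _ _ (\int[mu]_m ((2^-1)%:E * (in_strip (- 2^-1) 2^-1 m)%:E))%E); last first.
  apply: ge0_le_integral => //.
  - by move=> m _; rewrite -EFinM lee_fin mulr_ge0 ?in_strip_ge0.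
  - by apply: measurable_funeM; apply/measurable_EFinP; exact: measurable_in_strip.
  - by apply/measurable_EFinP; exact: measurable_tent.
  - move=> m _; rewrite -EFinM lee_fin /in_strip -ltr_norml.
    case: ltP => h; last by rewrite mulr0 tent_ge0.
    by rewrite mulr1 /tent le_max; apply/orP; right; lra.
rewrite ge0_integralZl_EFin//; last 2 first.
- by move=> m _; rewrite lee_fin in_strip_ge0.
- by apply/measurable_EFinP; exact: measurable_in_strip.
by rewrite integral_in_strip ?lte_fin -?EFinM ?lte_fin; lra.
Qed.

Variables (A s : R).
Hypothesis A1 : 1 <= A.
Hypothesis s0 : 0 < s.
Hypothesis s1 : s <= 4^-1.

Let p : R := 1 + s / 2.
Let b : R := 6 * A + 1.
Let r : R := 3 * A.
Let u (t x : R) : R := t * plateau A x.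

Let A0 : 0 < A. Proof. exact: lt_le_trans A1. Qed.
Let b1 : 1 < b. Proof. by rewrite /b; have := A0; lra. Qed.
Let r0 : 0 < r. Proof. by rewrite /r; have := A0; lra. Qed.

Let mu_u t : measurable_fun setT (u t).
Proof. by apply: measurable_funM => //; exact: measurable_plateau. Qed.

Let u_out t x : ~~ (1 < x < b) -> u t x = 0.
Proof.
rewrite negb_and -!leNgt /u /b => /orP[h|h].
  by rewrite plateau_eq0l ?mulr0//; lra.
by rewrite plateau_eq0r ?mulr0//; have := A0; lra.
Qed.

Let u_small t x : `|t| <= 1 -> `|u t x| < r.
Proof.
move=> t1; rewrite /u normrM.
apply: (@le_lt_trans _ _ 1); last by rewrite /r; have := A1; lra.
by rewrite -[leRHS]mulr1 ler_pM// plateau_norm_le1.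
Qed.

Let E (v : R -> R) : \bar R := (\int[leb2 R]_q pair_energy 1%R b r p v q.1 q.2)%E.

Let sgn_same (q : T * T) : R := if same_side q then density p A q else 0.
Let sgn_opp (q : T * T) : R := if opposite_side q then density p A q else 0.
(** By [shift_energyE], the shift energy of the pair q is the integral over m of
    density p A q * tent 1 m * phi t (q, m), and phi t is of order t ^+ 2. *)
Let c (y : (T * T) * T) : R := y.2 ^+ 2 * density 1 A y.1.
Let phi t y : R := t ^+ 2 * (1 + t ^+ 2 * c y) `^ (- p).

Let msame : measurable_fun setT sgn_same.
Proof. by apply: measurable_fun_ifT => //; [exact: measurable_same_side|exact: measurable_density]. Qed.
Let mopp : measurable_fun setT sgn_opp.
Proof. by apply: measurable_fun_ifT => //; [exact: measurable_opposite_side|exact: measurable_density]. Qed.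
Let same0 q : 0 <= sgn_same q.
Proof. by rewrite /sgn_same; case: ifP => _ //; exact: density_ge0. Qed.
Let opp0 q : 0 <= sgn_opp q.
Proof. by rewrite /sgn_opp; case: ifP => _ //; exact: density_ge0. Qed.

Let mc : measurable_fun setT c.
Proof.
apply: measurable_funM; first by apply: measurable_funX.
by apply: (measurableT_comp (measurable_density 1 A)).
Qed.
Let c0 y : 0 <= c y.
Proof. by rewrite mulr_ge0 ?sqr_ge0 ?density_ge0. Qed.
Let mphi t : measurable_fun setT (phi t).
Proof.
apply: measurable_funM => //; apply: (measurableT_comp (measurable_powR _)).
by apply: measurable_funD => //; apply: measurable_funM.
Qed.
Let phi0 t y : 0 <= phi t y.
Proof. by rewrite mulr_ge0 ?sqr_ge0 ?powR_ge0. Qed.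
Let phi_le t y : phi t y <= t ^+ 2.
Proof.
rewrite ler_piMr ?sqr_ge0//; apply: powR_le1; last by rewrite /p; have := s0; lra.
by rewrite lerDl mulr_ge0 ?sqr_ge0.
Qed.

Let weight (h : T * T -> R) (y : (T * T) * T) : R := h y.1 * tent 1 y.2.

Let mweight h : measurable_fun setT h -> measurable_fun setT (weight h).
Proof.
move=> mh; apply: measurable_funM; first exact: measurableT_comp.
by apply: (measurableT_comp (measurable_tent 1)).
Qed.

Let shift_energy_phi t (q : T * T) : q.1 != q.2 ->
  shift_energy p (q.1 - q.2) (u t q.1 - u t q.2) =
  (\int[mu]_m (density p A q * tent 1 m * phi t (q, m))%:E)%E.
Proof.
case: q => x x' /= xx'; have d0 : x - x' != 0 by rewrite subr_eq0.
rewrite shift_energyE// /u -mulrBr.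
have k0 : 0 <= (t * (plateau A x - plateau A x')) ^+ 2 * ((x - x') ^+ 2) `^ (- p).
  by rewrite mulr_ge0 ?sqr_ge0 ?powR_ge0.
pose f (m : R) : \bar R := (tent 1 m * (1 + m ^+ 2 * (t * (plateau A x - plateau A x') / (x - x')) ^+ 2) `^ (- p))%:E.
have f0 m : setT m -> (0 <= f m)%E by move=> _; rewrite lee_fin mulr_ge0 ?tent_ge0 ?powR_ge0.
have mf : measurable_fun setT f.
  apply/measurable_EFinP; apply: measurable_funM; first exact: measurable_tent.
  apply: measurable_powRcomp; apply: measurable_funD => //.
  by apply: measurable_funM => //; exact: measurable_funX.
rewrite -(@ge0_integralZl_EFin _ _ _ mu setT measurableT f f0 mf _ k0).
apply: eq_integral => m _; rewrite -EFinM; congr EFin.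
rewrite /phi /c /density /= powR_inv1 ?sqr_ge0// expr_div_n.
have -> : t ^+ 2 * (m ^+ 2 * ((plateau A x - plateau A x') ^+ 2 / (x - x') ^+ 2)) =
  m ^+ 2 * ((t * (plateau A x - plateau A x')) ^+ 2 / (x - x') ^+ 2) by field.
by rewrite exprMn; ring.
Qed.

Let mshift_energy t (S : T * T -> bool) : measurable_fun setT S ->
  measurable_fun setT (fun q : T * T => if S q then shift_energy p (q.1 - q.2) (u t q.1 - u t q.2) else 0%E).
Proof.
move=> mS; apply: measurable_fun_ifT => //.
apply: (measurable_fun_fubini_tonelli_F (m2 := mu) (fun w : (T * T) * T =>
  (kern p (w.1.1 - w.1.2) w.2 * tent `|u t w.1.1 - u t w.1.2| w.2)%:E)).
  apply/measurable_EFinP; apply: measurable_funM.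
    apply: measurable_kern => //.
    by apply: measurable_funB; apply: measurableT_comp.
  apply: measurable_maxr => //; apply: measurable_funB; last by apply: measurableT_comp.
  apply: measurableT_comp => //; apply: measurable_funB;
    by apply: (measurableT_comp (mu_u t)); apply: measurableT_comp.
by move=> w; rewrite lee_fin mulr_ge0 ?kern_ge0 ?tent_ge0.
Qed.

Let shift_energy_integral t (S : T * T -> bool) : measurable_fun setT S ->
  let h := fun q => if S q then density p A q else 0 in
  (\int[leb2 R]_q (if S q then shift_energy p (q.1 - q.2)%R (u t q.1 - u t q.2)%R else 0) =
   \int[nu]_y (weight h y * phi t y)%:E)%E.
Proof.
move=> mS h.
have mh : measurable_fun setT h by apply: measurable_fun_ifT => //; exact: measurable_density.
have h0 q : 0 <= h q by rewrite /h; case: ifP => _ //; exact: density_ge0.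
have mf : measurable_fun setT (fun y => (weight h y * phi t y)%:E).
  by apply/measurable_EFinP; apply: measurable_funM => //; exact: mweight.
have f0 y : (0 <= (weight h y * phi t y)%:E)%E.
  by rewrite lee_fin mulr_ge0// mulr_ge0 ?tent_ge0.
rewrite [RHS](fubini_tonelli1 (m1 := product_sfm mu mu) (m2 := mu))//.
apply: ge0_ae_eq_integral => //.
- exact: mshift_energy.
- exact: (measurable_fun_fubini_tonelli_F (m2 := mu)).
- by move=> q _; case: ifP => // _; exact: shift_energy_ge0.
- by move=> q _; apply: integral_ge0 => m _; exact: f0.
apply: filterS ae_generic_pair => q [qq _] _.
rewrite /fubini_F /weight /h /=; case: ifP => _; first exact: shift_energy_phi.
by rewrite integral0_eq// => m _; rewrite !mul0r.
Qed.

(** The terms of the columns on opposite sides are moved to the left-hand side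
    because nothing is known to be finite yet. *)
Lemma energy_along t : `|t| <= 1 ->
  (E (u t) + \int[nu]_y (weight sgn_opp y * phi t y)%:E =
   E (fun=> 0%R) + \int[nu]_y (weight sgn_same y * phi t y)%:E)%E.
Proof.
move=> t1.
rewrite -(shift_energy_integral t measurable_opposite_side) -(shift_energy_integral t measurable_same_side).
have mp S (mS : measurable_fun setT S) := mshift_energy t mS.
have shift_energy0 (S : T * T -> bool) q : (0 <= if S q then shift_energy p (q.1 - q.2)%R (u t q.1 - u t q.2)%R else 0)%E.
  by case: ifP => // _; exact: shift_energy_ge0.
have m0 : measurable_fun setT (fun _ : R => 0 : R) by [].
pose f1 q := pair_energy 1 b r p (u t) q.1 q.2.
pose f2 q := pair_energy 1 b r p (fun=> 0) q.1 q.2.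
pose g1 q := if opposite_side q then shift_energy p (q.1 - q.2) (u t q.1 - u t q.2) else 0%E.
pose g2 q := if same_side q then shift_energy p (q.1 - q.2) (u t q.1 - u t q.2) else 0%E.
have f10 q : (0 <= f1 q)%E by exact: pair_energy_ge0.
have f20 q : (0 <= f2 q)%E by exact: pair_energy_ge0.
have g10 q : (0 <= g1 q)%E by exact: (shift_energy0 (@opposite_side R)).
have g20 q : (0 <= g2 q)%E by exact: (shift_energy0 (@same_side R)).
have mf1 : measurable_fun setT f1 by exact: measurable_pair_energy.
have mf2 : measurable_fun setT f2 by exact: measurable_pair_energy.
have mg1 : measurable_fun setT g1 by exact: mp measurable_opposite_side.
have mg2 : measurable_fun setT g2 by exact: mp measurable_same_side.
rewrite -[LHS](leb2_integralD mf1 mg1 f10 g10) -[RHS](leb2_integralD mf2 mg2 f20 g20).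
apply: (@ge0_ae_eq_integral _ _ _ (product_sfm mu mu)) => //.
- exact: (emeasurable_funD mf1 mg1).
- exact: (emeasurable_funD mf2 mg2).
- by move=> q _; exact: (adde_ge0 (f10 q) (g10 q)).
- by move=> q _; exact: (adde_ge0 (f20 q) (g20 q)).
apply: filterS ae_generic_pair => q [qq qq0] _.
have a0 : 0 <= (1 : R) by [].
rewrite /f1 /f2 /g1 /g2 /same_side /opposite_side.
move: qq0; rewrite neq_lt => /orP[h|h].
- rewrite h (lt_gtF h) adde0.
  by rewrite (pair_energy_opp a0 r0 (mu_u t) (@u_out t) (fun x => u_small x t1) p h).
- rewrite h (lt_gtF h) adde0.
  by rewrite (pair_energy_same a0 r0 (mu_u t) (@u_out t) (fun x => u_small x t1) p h).
Qed.

Let s01 : 0 <= s <= 2^-1.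
Proof. by rewrite (ltW s0)/=; have := s1; lra. Qed.

Definition same_energy : R := fine (\int[leb2 R]_q (sgn_same q)%:E)%E.
Definition opposite_energy : R := fine (\int[leb2 R]_q (sgn_opp q)%:E)%E.

Let same_energyE : (\int[leb2 R]_q (sgn_same q)%:E = same_energy%:E)%E.
Proof.
have h0 : (0 <= \int[leb2 R]_q (sgn_same q)%:E)%E.
  by apply: integral_ge0 => q _; rewrite lee_fin same0.
rewrite fineK// ge0_fin_numE//.
by apply: (le_lt_trans (energy_same_le s01 A1)); rewrite ltry.
Qed.

Let opposite_energyE : (\int[leb2 R]_q (sgn_opp q)%:E = opposite_energy%:E)%E.
Proof.
have h0 : (0 <= \int[leb2 R]_q (sgn_opp q)%:E)%E.
  by apply: integral_ge0 => q _; rewrite lee_fin opp0.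
rewrite fineK// ge0_fin_numE//.
exact: (energy_opposite_lty (ltW s0) A1).
Qed.

Let weight0 (h : T * T -> R) y : (forall q, 0 <= h q) -> 0 <= weight h y.
Proof. by move=> h0; rewrite mulr_ge0 ?tent_ge0. Qed.

Let weight_integral (h : T * T -> R) (I : R) : measurable_fun setT h -> (forall q, 0 <= h q) ->
  (\int[leb2 R]_q (h q)%:E = I%:E)%E ->
  (\int[nu]_y (weight h y)%:E = (bump_mass * I)%:E)%E.
Proof.
move=> mh h0 hI.
have mw : measurable_fun setT (fun y => (weight h y)%:E) by apply/measurable_EFinP; exact: mweight.
have w0 y : (0 <= (weight h y)%:E)%E by rewrite lee_fin weight0.
rewrite [LHS](fubini_tonelli1 (m1 := product_sfm mu mu) (m2 := mu))//.
have mt : measurable_fun setT (fun m : R => (tent 1 m)%:E).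
  by apply/measurable_EFinP; exact: measurable_tent.
have t0 (m : R) : setT m -> (0 <= (tent 1 m)%:E)%E by move=> _; rewrite lee_fin tent_ge0.
have mhE : measurable_fun setT (fun q : T * T => (h q)%:E) by exact/measurable_EFinP.
have hE0 (q : T * T) : setT q -> (0 <= (h q)%:E)%E by rewrite lee_fin.
rewrite EFinM -hI -(@ge0_integralZl_EFin _ _ _ (product_sfm mu mu) setT measurableT _ hE0 mhE _ (ltW bump_mass_gt0)).
apply: eq_integral => q _; rewrite /fubini_F /weight /=.
under eq_integral do rewrite EFinM.
by rewrite (@ge0_integralZl_EFin _ _ _ mu setT measurableT _ t0 mt _ (h0 q)) bump_massE muleC.
Qed.

Let weight_integrable (h : T * T -> R) (I : R) : measurable_fun setT h -> (forall q, 0 <= h q) ->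
  (\int[leb2 R]_q (h q)%:E = I%:E)%E -> nu.-integrable setT (EFin \o weight h).
Proof.
move=> mh h0 hI; apply/integrableP; split.
  by apply/measurable_EFinP; exact: mweight.
under eq_integral do rewrite /= ger0_norm ?weight0//.
by rewrite (weight_integral mh h0 hI) ltry.
Qed.

Let g (y : (T * T) * T) : R := weight sgn_same y - weight sgn_opp y.

Let int_same : nu.-integrable setT (EFin \o weight sgn_same).
Proof. exact: weight_integrable msame same0 same_energyE. Qed.
Let int_opp : nu.-integrable setT (EFin \o weight sgn_opp).
Proof. exact: weight_integrable mopp opp0 opposite_energyE. Qed.

Let int_g : nu.-integrable setT (EFin \o g).
Proof.
have := @integrableB _ _ _ nu setT measurableT _ _ int_same int_opp.
by apply: eq_integrable => // y _; rewrite /= EFinB.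
Qed.

Let integral_g : (\int[nu]_y g y)%R = bump_mass * (same_energy - opposite_energy).
Proof.
rewrite (RintegralB measurableT int_same int_opp) /Rintegral.
rewrite (weight_integral msame same0 same_energyE) (weight_integral mopp opp0 opposite_energyE) /=.
by rewrite mulrBr.
Qed.

Let int_phi t (h : T * T -> R) : measurable_fun setT h -> (forall q, 0 <= h q) -> nu.-integrable setT (EFin \o weight h) ->
  nu.-integrable setT (EFin \o (fun y => weight h y * phi t y)).
Proof.
move=> mh h0 ih.
apply: (@le_integrable _ _ _ nu setT measurableT _ (fun y => ((t ^+ 2)%:E * (weight h y)%:E)%E)).
- by apply/measurable_EFinP; apply: measurable_funM => //; exact: mweight.
- move=> y _ /=; rewrite lee_fin.
  have w0 := weight0 y h0; have t0 := sqr_ge0 t.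
  rewrite (ger0_norm (mulr_ge0 w0 (phi0 t y))) (ger0_norm (mulr_ge0 t0 w0)).
  by rewrite mulrC ler_wpM2r.
- exact: (@integrableZl _ _ _ nu setT measurableT (t ^+ 2) _ ih).
Qed.

Let quad t : R := (\int[nu]_y (g y * (t ^+ 2 * (1 + t ^+ 2 * c y) `^ (- p))))%R.

Let quadE t : quad t = fine (\int[nu]_y (weight sgn_same y * phi t y)%:E)%E -
  fine (\int[nu]_y (weight sgn_opp y * phi t y)%:E)%E.
Proof.
rewrite -[RHS](RintegralB measurableT (int_phi t msame same0 int_same) (int_phi t mopp opp0 int_opp)).
by apply: eq_Rintegral => y _; rewrite /g mulrBl.
Qed.

Lemma energy_along_fine t : `|t| <= 1 ->
  (E (u t) < +oo)%E /\ fine (E (u t)) = fine (E (fun=> 0)) + quad t.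
Proof.
move=> t1; have := energy_along t1; rewrite quadE.
have F1 := integrable_fin_num measurableT (int_phi t msame same0 int_same).
have F2 := integrable_fin_num measurableT (int_phi t mopp opp0 int_opp).
have E0 : (0 <= E (u t))%E by apply: integral_ge0 => q _; exact: pair_energy_ge0.
have F3 : E (fun=> 0) \is a fin_num.
  rewrite ge0_fin_numE; last by apply: integral_ge0 => q _; exact: pair_energy_ge0.
  by apply: base_energy_lty => //; rewrite s0 s1.
rewrite -(fineK F1) -(fineK F2) -(fineK F3) -!EFinD.
by move: E0; case: (E (u t)) => [x| |] //= _ [h]; split; [exact: ltry|lra].
Qed.

Definition box_perimeter (t : R) : \bar R :=
  Per s [set q | in_graph_cross (u t) q] [set q | in_box 1 b r q].

Let perimeterE t : `|t| <= 1 -> box_perimeter t = (2^-1 * (fine (E (fun=> 0)) + quad t))%:E.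
Proof.
move=> t1; rewrite /box_perimeter Per_columns//.
have [lty <-] := energy_along_fine t1.
rewrite EFinM fineK// ge0_fin_numE//.
by apply: integral_ge0 => q _; exact: pair_energy_ge0.
Qed.

Lemma box_perimeter_lty t : `|t| <= 1 -> (box_perimeter t < +oo)%E.
Proof. by move=> t1; rewrite perimeterE// ltry. Qed.

Let near_unit (t : R) : `|t| < 1 -> \forall t' \near t, `|t'| < 1.
Proof.
rewrite ltr_norml => t1.
have : t \in `]-1, 1[ by rewrite in_itv.
by move=> /near_in_itvoo; apply: filterS => t'; rewrite in_itv/= ltr_norml.
Qed.

Let P t := fine (box_perimeter t).
Let Q t := 2^-1 * (fine (E (fun=> 0)) + quad t).

Let nearPQ t : `|t| < 1 -> \forall t' \near t, Q t' = P t'.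
Proof. by move=> /near_unit; apply: filterS => t' /ltW h; rewrite /P perimeterE. Qed.

Let dQ t : is_derive t (1 : R) Q (2^-1 * derive1 quad t).
Proof.
have dq : is_derive t (1 : R) quad (derive1 quad t).
  have p0 : 0 <= p by rewrite /p; have := s0; lra.
  have dv := @derivable_quadratic_integral _ _ _ nu g c p int_g mc c0 p0 t.
  exact: (DeriveDef dv (esym (derive1E quad t))).
have h := @is_deriveD _ _ _ (cst (fine (E (fun=> 0)))) quad t 1 0 _ (is_derive_cst _ _ _) dq.
have := @is_deriveZ _ _ _ _ (2^-1) t 1 _ h.
by rewrite add0r.
Qed.

Lemma derivable_box_perimeter t : `|t| < 1 -> derivable (fine \o box_perimeter) t 1.
Proof.
move=> t1; have [d _] := near_eq_is_derive (nearPQ t1) (dQ t); exact: d.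
Qed.

(** The perimeter is half of a constant plus an integral quadratic in t: the
    factor 2 of its second derivative cancels the half. *)
Lemma second_derive_box_perimeter :
  is_derive (0 : R) (1 : R) (derive1 (fine \o box_perimeter))
    (bump_mass * (same_energy - opposite_energy)).
Proof.
have p0 : 0 <= p by rewrite /p; have := s0; lra.
have d2 := @is_derive_derive1_quadratic_integral _ _ _ nu g c p int_g mc c0 p0.
have : is_derive (0 : R) (1 : R) (fun t => 2^-1 * derive1 quad t) (bump_mass * (same_energy - opposite_energy)).
  have := @is_deriveZ _ _ _ _ (2^-1) (0 : R) (1 : R) _ d2.
  by rewrite integral_g /GRing.scale/= mulrA mulVf ?mul1r.
apply: near_eq_is_derive.
have : \forall t \near (0 : R), `|t| < 1 by apply: near_unit; rewrite normr0.
apply: filterS => t t1.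
by have [_ <-] := near_eq_is_derive (nearPQ t1) (dQ t); rewrite derive1E.
Qed.

End along.

(** * A cut-off field on the line with an explicit flow *)

Section cutoff.
Context {R : realType}.
Implicit Types (y c t : R).

(** The flow of a field c on (-2, 2) is the conjugate of the translations by a
    primitive of 1 / c. To have both explicit, the primitive comes first:
    [chart] is the identity on [-1, 1] and is unbounded near both ends of
    (-2, 2), and [cutoff] is the inverse of its derivative. The powers of
    [outer] and [inner] make [cutoff] a C^2 function of the whole line, equal to
    1 on [-1, 1] and to 0 outside (-2, 2). *)
Definition outer y : R := pospart (y ^+ 2 - 1).
Definition inner y : R := pospart (4 - y ^+ 2).
(** On (-2, 2) the derivative of [chart] is
    1 + outer y ^+ 3 * speed_poly (y ^+ 2) / inner y ^+ 3. *)
Definition speed_poly (Y : R) : R :=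
  (Y * (7 * Y ^+ 2 - 83 * Y + 276) - 32) / 8.

Definition cutoff y : R :=
  inner y ^+ 3 / (inner y ^+ 3 + outer y ^+ 3 * speed_poly (y ^+ 2)).

(** The factor 1 - y ^+ 2 / 8 makes [speed_poly] positive on the whole half-line
    y ^+ 2 >= 1, and with it the denominator of [cutoff] for y ^+ 2 >= 4. *)
Definition chart y : R :=
  y + y * outer y ^+ 4 * (1 - y ^+ 2 / 8) / inner y ^+ 2.

Lemma speed_poly_gt0 (Y : R) : 1 <= Y -> 0 < speed_poly Y.
Proof.
move=> Y1.
have q0 : 29 < 7 * Y ^+ 2 - 83 * Y + 276 by have := sqr_ge0 (Y - 83 / 14); lra.
have q1 : Y <= 2 -> 32 < 7 * Y ^+ 2 - 83 * Y + 276 by move=> Y2; nra.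
rewrite /speed_poly; move: (7 * _ ^+ 2 - _ + _) q0 q1 => Q q0 q1.
suff : 32 < Y * Q by lra.
by have [/q1|] := leP Y 2; nra.
Qed.

Lemma cutoff_den_gt0 y : 0 < inner y ^+ 3 + outer y ^+ 3 * speed_poly (y ^+ 2).
Proof.
have [y1|y1] := leP (y ^+ 2) 1.
  rewrite /outer pospart_0 ?subr_le0// expr0n/= mul0r addr0 exprn_gt0//.
  by rewrite /inner pospart_id; lra.
rewrite ltr_wpDl//; first by rewrite exprn_ge0 ?pospart_ge0.
apply: mulr_gt0; last exact: speed_poly_gt0 (ltW y1).
by apply: exprn_gt0; rewrite /outer pospart_id; lra.
Qed.

Lemma sqr_lt4 y : (`|y| < 2) = (y ^+ 2 < 4).
Proof.
rewrite -[y ^+ 2]real_normK ?num_real// (_ : 4 = 2 ^+ 2 :> R) ?ltr_sqr//; last by rewrite expr2; lra.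
by rewrite nnegrE.
Qed.

Lemma inner_gt0 y : `|y| < 2 -> 0 < inner y.
Proof. by rewrite sqr_lt4 => y2; rewrite /inner pospart_id; lra. Qed.

Lemma inner_eq0 y : 2 <= `|y| -> inner y = 0.
Proof. by rewrite leNgt sqr_lt4 -leNgt => y2; rewrite /inner pospart_0// subr_le0. Qed.

Lemma cutoff_eq0 y : 2 <= `|y| -> cutoff y = 0.
Proof. by move=> y2; rewrite /cutoff inner_eq0// expr0n/= mul0r. Qed.

Lemma cutoff_gt0 y : `|y| < 2 -> 0 < cutoff y.
Proof. by move=> y2; rewrite divr_gt0 ?cutoff_den_gt0// exprn_gt0// inner_gt0. Qed.

Lemma is_derive_chart y : `|y| < 2 -> is_derive y (1 : R) chart (cutoff y)^-1.
Proof.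
move=> y2; have d0 := inner_gt0 y2.
have dp : is_derive y (1 : R) (fun y : R => y ^+ 2 - 1) (2 * y).
  by apply: is_derive_eq; rewrite /GRing.scale/=; lra.
have dm : is_derive y (1 : R) (fun y : R => 4 - y ^+ 2) (- (2 * y)).
  apply: is_derive_eq; rewrite /GRing.scale/=; lra.
have dq := @is_derive1_comp _ (fun x => pospart x ^+ 4) _ _ _ _ (is_derive_pospartX 2 _) dp.
have di := @is_derive1_comp _ (fun x => pospart x ^+ 2) _ _ _ _ (is_derive_pospartX 0 _) dm.
have n0 : ((fun x => pospart x ^+ 2) \o (fun y : R => 4 - y ^+ 2)) y != 0.
  by rewrite /= expf_neq0// gt_eqF.
have dv := is_deriveV n0 di.
have d8 : is_derive y (1 : R) (fun y : R => 1 - y ^+ 2 / 8) (- (2 * y) / 8).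
  by apply: is_derive_eq; rewrite /GRing.scale/=; lra.
have h := is_deriveD (is_derive_id y 1) (is_deriveM (is_deriveM (is_deriveM (is_derive_id y 1) dq) d8) dv).
apply: (is_derive_eq h).
rewrite /GRing.scale !fctE /= /cutoff invf_div -[outer y]/(pospart (y ^+ 2 - 1)) /speed_poly.
rewrite (_ : inner y = 4 - y ^+ 2) in d0 *; last first.
  by rewrite /inner pospart_id// subr_ge0 ltW// -sqr_lt4.
rewrite (_ : pospart (4 - y ^+ 2) = 4 - y ^+ 2); last first.
  by rewrite pospart_id// ltW.
have [y1|y1] := leP (y ^+ 2) 1.
  rewrite pospart_0 ?subr_le0//. by field; rewrite gt_eqF.
by rewrite pospart_id ?subr_ge0 ?(ltW y1)//; field; rewrite gt_eqF.
Qed.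

Let in_itv2 y : (y \in `]-2, 2[) = (`|y| < 2).
Proof. by rewrite in_itv/= ltr_norml. Qed.

Let derivable_chart y : `|y| < 2 -> derivable chart y 1.
Proof. by move=> /is_derive_chart[]. Qed.

Lemma continuous_chart y : `|y| < 2 -> {for y, continuous chart}.
Proof.
by move=> y2; apply: differentiable_continuous; apply/derivable1_diffP; exact: derivable_chart.
Qed.

Lemma chart_lt y y' : `|y| < 2 -> `|y'| < 2 -> y < y' -> chart y < chart y'.
Proof.
rewrite -!in_itv2; apply: gtr0_derive1_lt_oo.
- by move=> x; rewrite in_itv2; exact: derivable_chart.
- move=> x; rewrite in_itv2 => x2; rewrite derive1E.
  by rewrite (@derive_val _ _ _ _ _ _ _ (is_derive_chart x2)) invr_gt0 cutoff_gt0.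
- by move=> x; rewrite inE/= in_itv2; exact: continuous_chart.
Qed.

Lemma chart_inj y y' : `|y| < 2 -> `|y'| < 2 -> chart y = chart y' -> y = y'.
Proof.
move=> y2 y'2 e; have [h|h|//] := ltgtP y y'.
  by have := chart_lt y2 y'2 h; rewrite e ltxx.
by have := chart_lt y'2 y2 h; rewrite e ltxx.
Qed.

Lemma chartN y : chart (- y) = - chart y.
Proof. by rewrite /chart /outer /inner sqrrN !mulNr opprD. Qed.

Lemma chart_id y : `|y| <= 1 -> chart y = y.
Proof.
move=> y1; rewrite /chart /outer pospart_0 ?expr0n/= ?mulr0 ?mul0r ?addr0//.
by rewrite subr_le0 -[y ^+ 2]real_normK ?num_real// expr_le1.
Qed.

(** Near the ends of (-2, 2) the chart is unbounded. The value c is reached before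
    the point where y ^+ 2 = 4 - e with e = 1 / (1 + |c|). *)
Lemma chart_surj c : exists2 y, `|y| < 2 & chart y = c.
Proof.
pose e : R := (1 + `|c|)^-1.
have c1 : 0 < 1 + `|c| by rewrite ltr_wpDr.
have e0 : 0 < e by rewrite invr_gt0.
have e1 : e <= 1 by rewrite invf_le1// lerDl.
pose y0 : R := Num.sqrt (4 - e).
have y0E : y0 ^+ 2 = 4 - e by rewrite sqr_sqrtr//; lra.
have y00 : 0 <= y0 by exact: sqrtr_ge0.
have y02 : `|y0| < 2 by rewrite sqr_lt4 y0E; lra.
have y01 : 1 <= y0 by rewrite -(@ler_pXn2r _ 2)// ?nnegrE// expr1n y0E; lra.
have ch : `|c| <= chart y0.
  rewrite /chart /outer /inner y0E !pospart_id; [|lra..].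
  have -> : 4 - (4 - e) = e by ring.
  apply: (@le_trans _ _ e^-1); first by rewrite invrK lerDr.
  rewrite -[leLHS]add0r lerD//.
  rewrite (_ : e^-1 = e / e ^+ 2); last by field; rewrite gt_eqF.
  rewrite ler_wpM2r ?invr_ge0 ?sqr_ge0//.
  have h8 : 2^-1 <= 1 - (4 - e) / 8 by lra.
  have q16 : 16 <= (4 - e - 1) ^+ 4.
    have -> : 16 = 2 ^+ 4 :> R by ring.
    by rewrite ler_pXn2r ?nnegrE//; lra.
  apply: (le_trans e1); apply: (@le_trans _ _ (1 * 16 * 2^-1)); first lra.
  by rewrite !ler_pM//; lra.
have cc : {within `[- y0, y0], continuous chart}.
  apply: continuous_in_subspaceT => y; rewrite inE/= in_itv/= => /andP[h1 h2].
  by apply: continuous_chart; move: y02; rewrite !ltr_norml => /andP[h3 h4]; apply/andP; split; lra.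
have bc : Num.min (chart (- y0)) (chart y0) <= c <= Num.max (chart (- y0)) (chart y0).
  rewrite chartN; have [k1 k2] := (ler_norm c, ler_norm (- c)); rewrite normrN in k2.
  by rewrite ge_min le_max; apply/andP; split; apply/orP; [left|right]; lra.
have y0y0 : - y0 <= y0 by lra.
have [y] := IVT y0y0 cc bc.
rewrite in_itv/= => /andP[h1 h2] <-; exists y => //.
by move: y02; rewrite !ltr_norml => /andP[h3 h4]; apply/andP; split; lra.
Qed.

Definition chart_inv c : R := projT1 (cid2 (chart_surj c)).

Lemma chart_inv_lt2 c : `|chart_inv c| < 2.
Proof. by rewrite /chart_inv; case: cid2. Qed.

Lemma chart_invK : cancel chart_inv chart.
Proof. by move=> c; rewrite /chart_inv; case: cid2. Qed.

Lemma chartK y : `|y| < 2 -> chart_inv (chart y) = y.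
Proof. by move=> y2; apply: chart_inj => //; [exact: chart_inv_lt2|exact: chart_invK]. Qed.

Lemma is_derive_chart_inv c : is_derive c (1 : R) chart_inv (cutoff (chart_inv c)).
Proof.
have c2 := chart_inv_lt2 c.
rewrite -[X in is_derive X](chart_invK c) -[cutoff _]invrK.
have nr : \forall y \near chart_inv c, `|y| < 2.
  have : chart_inv c \in `]-2, 2[ by rewrite in_itv2.
  by move=> /near_in_itvoo; apply: filterS => y; rewrite in_itv2.
apply: is_derive_inverse.
- by move: nr; apply: filterS => y; exact: chartK.
- by move: nr; apply: filterS => y; exact: continuous_chart.
- exact: is_derive_chart.
- by rewrite invr_neq0// gt_eqF// cutoff_gt0.
Qed.

(** The points outside (-2, 2), where the cut-off vanishes, do not move. *)
Definition line_flow t y : R := if `|y| < 2 then chart_inv (chart y + t) else y.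

Lemma line_flow0 y : line_flow 0 y = y.
Proof. by rewrite /line_flow addr0; case: ifP => // /chartK. Qed.

Lemma is_derive_line_flow t y :
  is_derive t (1 : R) (line_flow ^~ y) (cutoff (line_flow t y)).
Proof.
rewrite /line_flow; case: ltP => y2; last first.
  by rewrite /= cutoff_eq0//; exact: (is_derive_cst y t 1).
have d1 : is_derive t (1 : R) (fun t => chart y + t) 1.
  by apply: is_derive_eq; lra.
have := is_derive1_comp (is_derive_chart_inv (chart y + t)) d1.
by rewrite mulr1.
Qed.

Lemma line_flowN t y : line_flow (- t) (line_flow t y) = y.
Proof.
rewrite {2}/line_flow; case: ifPn => y2; last by rewrite /line_flow (negbTE y2).
by rewrite /line_flow chart_inv_lt2 chart_invK addrK chartK.
Qed.

Lemma chart_inv_lt c c' : c < c' -> chart_inv c < chart_inv c'.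
Proof.
move=> cc'; rewrite ltNge; apply/negP; rewrite le_eqVlt => /orP[/eqP e|h].
  by move: cc'; rewrite -[c]chart_invK -[c']chart_invK e ltxx.
have := chart_lt (chart_inv_lt2 _) (chart_inv_lt2 _) h.
by rewrite !chart_invK => /(lt_trans cc'); rewrite ltxx.
Qed.

Lemma line_flow_lt t y y' : y < y' -> line_flow t y < line_flow t y'.
Proof.
rewrite /line_flow => yy'; case: ifPn => [y2|y2]; case: ifPn => [y'2|y'2] //.
- by apply: chart_inv_lt; rewrite ltrD2r chart_lt.
- have := chart_inv_lt2 (chart y + t); move: y2 y'2; rewrite -leNgt !ltr_norml ler_normr.
  by move=> /andP[h1 h2] /orP h /andP[h3 h4]; case: h => h; lra.
- have := chart_inv_lt2 (chart y' + t); move: y2 y'2; rewrite -leNgt !ltr_norml ler_normr.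
  by move=> /orP h /andP[h1 h2] /andP[h3 h4]; case: h => h; lra.
Qed.

Lemma line_flow_origin t : `|t| <= 1 -> line_flow t 0 = t.
Proof.
move=> t1; rewrite /line_flow normr0 ltr0n chart_id ?normr0// add0r.
by rewrite -[in LHS](chart_id t1) chartK// (le_lt_trans t1)// ltr1n.
Qed.

End cutoff.

(** * Twice continuous differentiability of the deforming field *)

Section c2_line.
Context {R : realType}.
Implicit Types (f g : R -> R) (x : R).

(** With explicit derivatives, the rules of calculus compute those of sums,
    products, inverses and compositions. *)
Definition C2 f : Prop := exists f1 f2 : R -> R,
  [/\ forall x, is_derive x (1 : R) f (f1 x),
      forall x, is_derive x (1 : R) f1 (f2 x) & continuous f2].

Lemma is_derive_continuous f df x : is_derive x (1 : R) f df -> {for x, continuous f}.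
Proof. by case=> d _; apply: differentiable_continuous; apply/derivable1_diffP. Qed.

Lemma C2_cst (k : R) : C2 (cst k).
Proof.
exists (cst 0), (cst 0); split => [x|x|]; [exact: is_derive_cst..|exact: cst_continuous].
Qed.

Lemma C2_id : C2 id.
Proof.
exists (cst 1), (cst 0); split => [x|x|]; last exact: cst_continuous.
  exact: is_derive_id.
exact: is_derive_cst.
Qed.

Lemma C2D f g : C2 f -> C2 g -> C2 (fun x => f x + g x).
Proof.
move=> [f1 [f2 [hf1 hf2 cf]]] [g1 [g2 [hg1 hg2 cg]]].
exists (fun x => f1 x + g1 x), (fun x => f2 x + g2 x); split => x.
- exact: is_deriveD (hf1 x) (hg1 x).
- exact: is_deriveD (hf2 x) (hg2 x).
- by apply: cvgD; [exact: cf|exact: cg].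
Qed.

Lemma C2M f g : C2 f -> C2 g -> C2 (fun x => f x * g x).
Proof.
move=> [f1 [f2 [hf1 hf2 cf]]] [g1 [g2 [hg1 hg2 cg]]].
exists (fun x => f x * g1 x + g x * f1 x),
  (fun x => (f x * g2 x + g1 x * f1 x) + (g x * f2 x + f1 x * g1 x)); split => x.
- exact: is_deriveM (hf1 x) (hg1 x).
- exact: is_deriveD (is_deriveM (hf1 x) (hg2 x)) (is_deriveM (hg1 x) (hf2 x)).
- have c1 := is_derive_continuous (hf1 x).
  have c2 := is_derive_continuous (hf2 x).
  have c3 := is_derive_continuous (hg1 x).
  have c4 := is_derive_continuous (hg2 x).
  apply: cvgD; apply: cvgD; apply: cvgM => //; [exact: cg|exact: cf].
Qed.

Lemma C2B f g : C2 f -> C2 g -> C2 (fun x => f x - g x).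
Proof.
move=> cf cg; rewrite (_ : (fun x => _) = (fun x => f x + (-1) * g x)).
  by apply: C2D => //; apply: C2M => //; exact: C2_cst.
by apply/funext => x; rewrite mulN1r.
Qed.

Lemma C2X f n : C2 f -> C2 (fun x => f x ^+ n).
Proof.
move=> cf; elim: n => [|n IH].
  by rewrite (_ : (fun x => _) = cst 1); [exact: C2_cst|apply/funext => x; rewrite expr0].
rewrite (_ : (fun x => _) = (fun x => f x * f x ^+ n)); first exact: C2M.
by apply/funext => x; rewrite exprS.
Qed.

Lemma C2_comp f g : C2 f -> C2 g -> C2 (fun x => f (g x)).
Proof.
move=> [f1 [f2 [hf1 hf2 cf]]] [g1 [g2 [hg1 hg2 cg]]].
exists (fun x => f1 (g x) * g1 x),
  (fun x => f1 (g x) * g2 x + g1 x * (f2 (g x) * g1 x)); split => x.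
- exact: is_derive1_comp (hf1 _) (hg1 x).
- exact: is_deriveM (is_derive1_comp (hf2 _) (hg1 x)) (hg2 x).
- have c3 := is_derive_continuous (hg1 x).
  have c4 := is_derive_continuous (hg2 x).
  have c1 : {for x, continuous (fun x => f1 (g x))}.
    exact: is_derive_continuous (is_derive1_comp (hf2 _) (hg1 x)).
  have c2 : {for x, continuous (fun x => f2 (g x))}.
    by apply: (continuous_comp c3); exact: cf.
  by apply: cvgD; apply: cvgM => //; [exact: cg|apply: cvgM].
Qed.

Lemma C2V f : (forall x, f x != 0) -> C2 f -> C2 (fun x => (f x)^-1).
Proof.
move=> f0 [f1 [f2 [hf1 hf2 cf]]].
have hV x := is_deriveV (f0 x) (hf1 x).
have hV1 : forall x, is_derive x (1:R) (fun x => (f x)^-1) (- (f x)^-1 * ((f x)^-1 * f1 x)).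
  by move=> x; apply: is_derive_eq (hV x) _; rewrite /GRing.scale/= -exprVn expr2; ring.
have hVN x := is_deriveN (hV1 x).
exists (fun x => - (f x)^-1 * ((f x)^-1 * f1 x)).
eexists; split => [x|x|].
- exact: hV1.
- exact: is_deriveM (hVN x) (is_deriveM (hV1 x) (hf2 x)).
- move=> x; have c1 := is_derive_continuous (hf1 x).
  have c2 := is_derive_continuous (hf2 x).
  have c3 := is_derive_continuous (hV1 x).
  have c4 : {for x, continuous (fun x => - (f x)^-1)} by apply: cvgN.
  have c5 : {for x, continuous (fun x => (f x)^-1 * f1 x)} by apply: cvgM.
  have c6 : {for x, continuous (fun x => - (f x)^-1 * ((f x)^-1 * f1 x))} by apply: cvgM.
  have c7 : {for x, continuous (fun x => - (- (f x)^-1 * ((f x)^-1 * f1 x)))} by apply: cvgN.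
  have c8 := cf x.
  apply: cvgD; apply: cvgM => //.
  by apply: cvgD; apply: cvgM.
Qed.

Lemma C2_pospartX3 : C2 (fun x => pospart x ^+ 3).
Proof.
exists (fun x => 3 * pospart x ^+ 2), (fun x => 3 * (2 * pospart x)); split => [x|x|x].
- exact: is_derive_pospartX.
- have := is_deriveZ 3 (is_derive_pospartX 0 x); exact.
- by do 2 (apply: cvgMr); exact: continuous_pospart.
Qed.

Lemma C2_step : C2 step.
Proof.
by exists step', step''; split; [exact: is_derive_step|exact: is_derive_step'|exact: continuous_step''].
Qed.

Lemma C2_plateau A : C2 (plateau A).
Proof.
have h B : C2 (ramp B).
  rewrite /ramp; apply: (C2_comp C2_step); apply: C2B; last exact: C2_cst.
  by apply: C2M; [exact: C2_id|exact: C2_cst].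
exact: C2B.
Qed.

Lemma C2_cutoff : C2 cutoff.
Proof.
have sq : C2 (fun y : R => y ^+ 2) by apply: C2X; exact: C2_id.
have ci : C2 (fun y => inner y ^+ 3).
  by apply: (C2_comp C2_pospartX3); apply: C2B => //; exact: C2_cst.
have co : C2 (fun y => outer y ^+ 3).
  by apply: (C2_comp C2_pospartX3); apply: C2B => //; exact: C2_cst.
apply: C2M => //; apply: C2V; first by move=> y; rewrite gt_eqF// cutoff_den_gt0.
apply: C2D => //; apply: C2M => //; apply: C2_comp => //.
have Cc := C2_cst; have Ci := C2_id.
exact: (C2M (C2B (C2M Ci (C2D (C2B (C2M (Cc 7) (C2X 2 Ci)) (C2M (Cc 83) Ci)) (Cc 276)))
  (Cc 32)) (Cc 8^-1)).
Qed.

End c2_line.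

Section product_field.
Context {R : realType}.
Implicit Types (a b : R -> R) (q v w : R * R).

Definition vertical_field a b q : R * R := (0, a q.1 * b q.2).

Let is_diff_fst q : is_diff q (fst : R * R -> R) fst.
Proof.
have lin : linear (fst : R * R -> R) by [].
pose L : {linear (R * R)%type -> R} := HB.pack (fst : R * R -> R)
  (GRing.isLinear.Build _ _ _ _ (fst : R * R -> R) lin).
have cL : continuous (L : R * R -> R) by move=> x; exact: cvg_fst.
apply: DiffDef; first exact: (@linear_differentiable _ _ _ L q cL).
exact: (@diff_lin _ _ _ L q cL).
Qed.

Let is_diff_snd q : is_diff q (snd : R * R -> R) snd.
Proof.
have lin : linear (snd : R * R -> R) by [].
pose L : {linear (R * R)%type -> R} := HB.pack (snd : R * R -> R)
  (GRing.isLinear.Build _ _ _ _ (snd : R * R -> R) lin).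
have cL : continuous (L : R * R -> R) by move=> x; exact: cvg_snd.
apply: DiffDef; first exact: (@linear_differentiable _ _ _ L q cL).
exact: (@diff_lin _ _ _ L q cL).
Qed.

Lemma is_diff_line f (x df : R) : is_derive x (1 : R) f df -> is_diff x f (fun h => h * df).
Proof.
move=> [d e]; have df' : differentiable f x by apply/derivable1_diffP.
apply: DiffDef => //; apply/funext => h.
by rewrite -e deriveE// -[h in LHS]mulr1 -[h * 1]/(h *: 1) linearZ.
Qed.

Section first_derivative.
Variables a b a1 b1 : R -> R.
Hypothesis ha : forall x, is_derive x (1 : R) a (a1 x).
Hypothesis hb : forall x, is_derive x (1 : R) b (b1 x).

Let is_diff_vertical q : is_diff q (vertical_field a b)
  (fun v => (0, a q.1 * (v.2 * b1 q.2) + b q.2 * (v.1 * a1 q.1))).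
Proof.
have da := @is_diff_comp _ _ _ _ _ _ _ _ q (is_diff_fst q) (is_diff_line (ha q.1)).
have db := @is_diff_comp _ _ _ _ _ _ _ _ q (is_diff_snd q) (is_diff_line (hb q.2)).
exact: is_diff_pair (is_diff_cst 0 q) (is_diffM da db).
Qed.

Lemma differentiable_vertical q : differentiable (vertical_field a b) q.
Proof. by case: (is_diff_vertical q). Qed.

(** Directional derivatives of product fields are sums of product fields, so
    that no other fields occur in derivatives of higher order. *)
Lemma derive_vertical v : 'D_v (vertical_field a b) =
  vertical_field (fun x => v.1 * a1 x) b + vertical_field (fun x => v.2 * a x) b1.
Proof.
apply/funext => q; rewrite deriveE; last exact: differentiable_vertical.
rewrite (@diff_val _ _ _ _ _ _ _ (is_diff_vertical q)).
by rewrite /vertical_field fctE /=; congr (_, _); [rewrite /= addr0|rewrite /=; ring].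
Qed.

End first_derivative.

Lemma continuous_vertical a b : continuous a -> continuous b -> continuous (vertical_field a b).
Proof.
move=> ca cb q.
have c1 : {for q, continuous (fun q : R * R => a q.1)}.
  by apply: (@continuous_comp _ _ _ fst a); [exact: cvg_fst|exact: ca].
have c2 : {for q, continuous (fun q : R * R => b q.2)}.
  by apply: (@continuous_comp _ _ _ snd b); [exact: cvg_snd|exact: cb].
have c0 : {for q, continuous (fun=> 0 : R)} by exact: cvg_cst.
have c3 : {for q, continuous (fun q : R * R => a q.1 * b q.2)} by exact: cvgM.
exact: (cvg_pair c0 c3).
Qed.

Lemma is_C2_vertical a b : C2 a -> C2 b -> is_Ck 2 (vertical_field a b).
Proof.
move=> [a1 [a2 [ha1 ha2 ca2]]] [b1 [b2 [hb1 hb2 cb2]]].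
have ca x := is_derive_continuous (ha1 x).
have cb x := is_derive_continuous (hb1 x).
have ca1 x := is_derive_continuous (ha2 x).
have cb1 x := is_derive_continuous (hb2 x).
have Z (k : R) f f1 : (forall x, is_derive x (1 : R) f (f1 x)) ->
    forall x, is_derive x (1 : R) (fun x => k * f x) (k * f1 x).
  by move=> h x; exact: is_deriveZ (h x).
have cZ (k : R) (f : R -> R) : continuous f -> continuous (fun x => k * f x).
  move=> cf x; have c0 : {for x, continuous (fun=> k)} by exact: cvg_cst.
  have cfx := cf x.
  exact: (@cvgM _ _ _ _ (fun=> k) f _ _ c0 cfx).
split => [q|v]; first exact: differentiable_vertical ha1 hb1 q.
rewrite (derive_vertical ha1 hb1).
have d1 := differentiable_vertical (Z v.1 _ _ ha2) hb1.
have d2 := differentiable_vertical (Z v.2 _ _ ha1) hb2.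
split => [q|w]; first exact: differentiableD.
rewrite (_ : 'D_w _ = 'D_w (vertical_field (fun x => v.1 * a1 x) b) +
   'D_w (vertical_field (fun x => v.2 * a x) b1)); last first.
  by apply/funext => q; rewrite deriveD//; exact: diff_derivable.
rewrite (derive_vertical (Z v.1 _ _ ha2) hb1) (derive_vertical (Z v.2 _ _ ha1) hb2).
have k1 := continuous_vertical (cZ w.1 _ (cZ v.1 _ ca2)) cb.
have k2 := continuous_vertical (cZ w.2 _ (cZ v.1 _ ca1)) cb1.
have k3 := continuous_vertical (cZ w.1 _ (cZ v.2 _ ca1)) cb1.
have k4 := continuous_vertical (cZ w.2 _ (cZ v.2 _ ca)) cb2.
by move=> q; exact: cvgD (cvgD (k1 q) (k2 q)) (cvgD (k3 q) (k4 q)).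
Qed.

End product_field.

(** * Squares are bounded Lipschitz domains *)

Section square.
Context {R : realType}.
Implicit Types (c x p : R * R).

Definition square c (rho : R) : set (R * R) :=
  [set x | `|x.1 - c.1| < rho /\ `|x.2 - c.2| < rho].

Lemma squareE c rho : square c rho = ball c rho.
Proof.
apply/seteqP; split => x; rewrite /square/ball/=/prod_ball -!ball_normE/= /ball_/=;
  by rewrite distrC [X in _ /\ X < _]distrC.
Qed.

Definition closed_square c (rho : R) : set (R * R) :=
  [set x | `|x.1 - c.1| <= rho /\ `|x.2 - c.2| <= rho].

Lemma closed_squareE c rho :
  closed_square c rho = `[c.1 - rho, c.1 + rho] `*` `[c.2 - rho, c.2 + rho].
Proof.
by apply/seteqP; split => x; rewrite /closed_square /= !in_itv/= !ler_distl.
Qed.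

Lemma compact_closed_square c rho : compact (closed_square c rho).
Proof. by rewrite closed_squareE; apply: compact_setX; exact: segment_compact. Qed.

Lemma closed_closed_square c rho : closed (closed_square c rho).
Proof.
by apply: compact_closed; [exact: norm_hausdorff|exact: compact_closed_square].
Qed.

Lemma closure_square_sub c rho : closure (square c rho) `<=` closed_square c rho.
Proof.
rewrite closureE; apply: smallest_sub; first exact: closed_closed_square.
by move=> x [h1 h2]; split; exact: ltW.
Qed.

(** A square is the union of the segments from its centre to its points. *)
Lemma connected_square c rho : 0 < rho -> connected (square c rho).
Proof.
move=> rho0.
have -> : square c rho = \bigcup_(x in square c rho)
    ((fun t : R => (c.1 + t * (x.1 - c.1), c.2 + t * (x.2 - c.2))) @` `[0, 1]).
  apply/seteqP; split => [x sx|y [x [s1 s2] [t]]].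
    exists x => //; exists 1; first by rewrite /= in_itv/= ler01 lexx.
    by rewrite !mul1r !subrKC; case: x sx.
  rewrite /= in_itv/= => /andP[t0 t1] <-.
  by split => /=; rewrite addrC addKr normrM ger0_norm//; apply: le_lt_trans (ler_piMl _ t1) _.
apply: bigcup_connected.
  exists c => x _; exists 0; first by rewrite /= in_itv/= ler01 lexx.
  by rewrite !mul0r !addr0; case: c.
move=> x _; apply: connected_continuous_connected; first exact: segment_connected.
apply: continuous_subspaceT => t.
have comp (a k : R) : {for t, continuous (fun t : R => a + t * k)}.
  by apply: cvgD; [exact: cvg_cst|apply: cvgMl; exact: cvg_id].
exact: (cvg_pair (comp _ _) (comp _ _)).
Qed.

Lemma bounded_square c rho : bounded_set (square c rho).
Proof.
exists (Num.max `|c.1| `|c.2| + `|rho|); split; first exact: num_real.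
move=> M hM x [h1 h2] /=; apply: le_trans (ltW hM).
rewrite prod_normE ge_max; apply/andP; split.
  rewrite -(subrK c.1 x.1) (le_trans (ler_normD _ _))// addrC lerD// ?le_max ?lexx//.
  by rewrite (le_trans (ltW h1))// ler_norm.
rewrite -(subrK c.2 x.2) (le_trans (ler_normD _ _))// addrC lerD// ?le_max ?lexx ?orbT//.
by rewrite (le_trans (ltW h2))// ler_norm.
Qed.

Lemma enorm_ge1 x : `|x.1| <= enorm x.
Proof.
by rewrite -sqrtr_sqr; apply: ler_wsqrtr; rewrite lerDl sqr_ge0.
Qed.

Lemma enorm_ge2 x : `|x.2| <= enorm x.
Proof.
by rewrite -sqrtr_sqr; apply: ler_wsqrtr; rewrite lerDr sqr_ge0.
Qed.

Lemma lipschitz_cst (k : R) : lipschitz (fun _ : R => k).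
Proof.
exists 0; split => // M M0 [x y] _ /=.
by rewrite subrr normr0 mulr_ge0// ltW.
Qed.

Lemma lipschitz_shifted_norm (k l : R) : lipschitz (fun x : R => k + `|x - l|).
Proof.
exists 1; split => // M M1 [x y] _ /=.
apply: (@le_trans _ _ `|x - y|); last by rewrite ler_peMl// ltW.
rewrite opprD addrACA subrr add0r (le_trans (ler_dist_dist _ _))//.
by rewrite opprB addrA subrK.
Qed.

(** Near a point p, an interval is described by the inward direction s if p is
    an end point, and by no condition, encoded by s = 0, otherwise. *)
Let side (c rho p : R) : `|p - c| <= rho -> 0 < rho ->
  exists (s d : R), [/\ 0 < d, s ^+ 2 = 1 & forall x : R, `|x - p| < d ->
    (`|x - c| < rho <-> 0 < s * (x - p))] \/
  [/\ 0 < d, s = 0, `|p - c| < rho & forall x : R, `|x - p| < d -> `|x - c| < rho].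
Proof.
move=> hp rho0.
have [h|h|h] := ltgtP `|p - c| rho.
- exists 0, (rho - `|p - c|); right; split => //; first by rewrite subr_gt0.
  move=> x hx; have := ler_normD (x - p) (p - c); rewrite addrA subrK; lra.
- by move: hp; rewrite leNgt h.
have [pc|pc] := leP 0 (p - c); [exists (-1)|exists 1]; exists rho; left; split => //.
- by rewrite sqrrN expr1n.
- move=> x; move: h; rewrite ger0_norm// => h; rewrite ltr_norml => /andP[h1 h2].
  by split; [rewrite ltr_norml => /andP[h3 h4]; lra|move=> h3; rewrite ltr_norml; apply/andP; split; lra].
- by rewrite expr1n.
- move=> x; move: h; rewrite ltr0_norm// => h; rewrite ltr_norml => /andP[h1 h2].
  by split; [rewrite ltr_norml => /andP[h3 h4]; lra|move=> h3; rewrite ltr_norml; apply/andP; split; lra].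
Qed.

(** At a corner the frame points along the inward diagonal, and the domain lies
    above the graph of the absolute value. On an edge the frame is normal to the
    edge and the function is constant. *)
Lemma lipschitz_boundary_square c rho : 0 < rho -> lipschitz_boundary (square c rho).
Proof.
move=> rho0 p [/closure_square_sub[hp1 hp2]].
rewrite (interior_id _).1; last by rewrite squareE; exact: ball_open.
move=> np.
have [s1 [d1 H1]] := side hp1 rho0; have [s2 [d2 H2]] := side hp2 rho0.
have dist x d : enorm (x - p) < d -> `|x.1 - p.1| < d /\ `|x.2 - p.2| < d.
  move=> h; split; apply: le_lt_trans h; [exact: (enorm_ge1 (x - p))|exact: (enorm_ge2 (x - p))].
have d0 : 0 < Num.min d1 d2 by rewrite lt_min; case: H1 => -[-> *]; case: H2 => -[-> *].
have dist' x : enorm (x - p) < Num.min d1 d2 -> `|x.1 - p.1| < d1 /\ `|x.2 - p.2| < d2.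
  by move=> /dist; rewrite !lt_min => -[/andP[? _] /andP[_ ?]].
case: H1 => -[_ s1E h1]; case: H2 => -[_ s2E h2].
- pose w : R := Num.sqrt 2^-1.
  have w2 : w ^+ 2 = 2^-1 by rewrite sqr_sqrtr.
  have w0 : 0 < w by rewrite sqrtr_gt0 invr_gt0.
  exists (s2 * w, - s1 * w), (Num.min d1 d2),
    (fun t => (p.2 * (s2 * w) + p.1 * (s1 * w)) + `|t - (p.1 * (s2 * w) - p.2 * (s1 * w))|); split => //.
  + rewrite /enorm /= !exprMn sqrrN s1E s2E w2 !mul1r.
    have -> : 2^-1 + 2^-1 = 1 :> R by lra. by rewrite sqrtr1.
  + exact: lipschitz_shifted_norm.
  + move=> x /dist'[/h1 e1 /h2 e2]; rewrite /square /= e1 e2.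
    set a := s1 * (x.1 - p.1); set b := s2 * (x.2 - p.2).
    have aE : x.1 - p.1 = s1 * a by rewrite /a mulrA -expr2 s1E mul1r.
    have bE : x.2 - p.2 = s2 * b by rewrite /b mulrA -expr2 s2E mul1r.
    have n1 : `|x.1 * (s2 * w) + x.2 * (- s1 * w) - (p.1 * (s2 * w) - p.2 * (s1 * w))| = w * `|a - b|.
      have -> : x.1 * (s2 * w) + x.2 * (- s1 * w) - (p.1 * (s2 * w) - p.2 * (s1 * w)) =
         (s1 * s2) * (w * (a - b)).
        transitivity (w * (s2 * (x.1 - p.1) - s1 * (x.2 - p.2))); first by ring.
        by rewrite aE bE; ring.
      rewrite normrM [X in _ * X]normrM (gtr0_norm w0).
      have -> : `|s1 * s2| = 1; last by rewrite mul1r.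
      apply/eqP; rewrite -(@pexpr_eq1 _ _ 2)// ?normr_ge0//.
      by rewrite real_normK ?num_real// exprMn s1E s2E mulr1.
    rewrite n1.
    have -> : (p.2 * (s2 * w) + p.1 * (s1 * w) + w * `|a - b| < x.2 * (s2 * w) - x.1 * (- s1 * w)) =
       (`|a - b| < a + b).
      rewrite -[RHS](ltr_pM2l w0) -[LHS]subr_gt0 -[RHS]subr_gt0; congr (_ < _).
      by rewrite mulrDr /a /b; set ab := w * `|_|; ring.
    rewrite ltr_norml; split => [[a0 b0]|/andP[k1 k2]]; first by apply/andP; split; lra.
    by split; lra.
- case: h2 => h2 h2'.
  exists (0, - s1), (Num.min d1 d2), (fun _ => s1 * p.1); split => //.
  + by rewrite /enorm /= expr0n add0r sqrrN s1E sqrtr1.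
  + exact: lipschitz_cst.
  + move=> x /dist'[/h1 e1 /h2' e2]; rewrite /square /= e1.
    rewrite mulr0 sub0r mulrN opprK [x.1 * s1]mulrC -[X in _ <-> is_true X]subr_gt0 -mulrBr.
    by split => [[]|] //.
- case: h1 => h1 h1'.
  exists (s2, 0), (Num.min d1 d2), (fun _ => s2 * p.2); split => //.
  + by rewrite /enorm /= expr0n addr0 s2E sqrtr1.
  + exact: lipschitz_cst.
  + move=> x /dist'[/h1' e1 /h2 e2]; rewrite /square /= e2.
    rewrite mulr0 subr0 [x.2 * s2]mulrC -[X in _ <-> is_true X]subr_gt0 -mulrBr.
    by split => [[]|] //.
- by exfalso; apply: np; split; [case: h1|case: h2].
Qed.

Lemma bounded_lipschitz_domain_square c rho : 0 < rho ->
  bounded_lipschitz_domain (square c rho).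
Proof.
move=> rho0; split.
- by rewrite squareE; exact: ball_open.
- by exists c; rewrite squareE; exact: ballxx.
- exact: connected_square.
- exact: bounded_square.
- exact: lipschitz_boundary_square.
Qed.

Lemma compactly_contained_square c rho : rho < c.1 ->
  compactly_contained (square c rho) (~` [set (0 : R * R)]).
Proof.
move=> rc; split.
  apply: (subclosed_compact _ (compact_closed_square (c := c) (rho := rho))).
    exact: closed_closure.
  exact: closure_square_sub.
move=> x /closure_square_sub[h1 _] /= x0; move: h1; rewrite x0 /= sub0r normrN.
by rewrite leNgt (lt_le_trans rc)// ler_norm.
Qed.

End square.

(** * Instability of the cross *)

Section energies.
Context {R : realType}.

Lemma same_energy_le (A s : R) : 1 <= A -> 0 <= s <= 2^-1 ->
  same_energy A s <= 40 * @kappa_mass R.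
Proof.
move=> A1 s01; have h := energy_same_le s01 A1.
rewrite -lee_fin fineK// ge0_fin_numE; first exact: le_lt_trans h (ltry _).
by apply: integral_ge0 => q _; rewrite lee_fin; case: ifP => // _; exact: density_ge0.
Qed.

Lemma opposite_energy_ge (s : R) (n : nat) : 0 <= s -> s * n.+4%:R <= 1 ->
  n%:R / 18 <= opposite_energy (2 ^+ n.+2) s.
Proof.
move=> s0 sn; have h := energy_opposite_ge s0 sn.
rewrite -lee_fin fineK// ge0_fin_numE.
  by apply: energy_opposite_lty => //; rewrite exprn_ege1// ler1n.
by apply: integral_ge0 => q _; rewrite lee_fin; case: ifP => // _; exact: density_ge0.
Qed.

Lemma second_variation_lt0 (s : R) (n : nat) :
  40 * @kappa_mass R < n%:R / 18 -> 0 <= s <= 2^-1 -> s * n.+4%:R <= 1 ->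
  bump_mass * (same_energy (2 ^+ n.+2) s - opposite_energy (2 ^+ n.+2) s) < 0.
Proof.
move=> kn /andP[s0 s1] sn.
rewrite pmulr_rlt0 ?bump_mass_gt0// subr_lt0.
apply: (le_lt_trans _ (lt_le_trans kn (opposite_energy_ge s0 sn))).
by apply: same_energy_le; rewrite ?s0// exprn_ege1// ler1n.
Qed.

End energies.

Section variation.
Context {R : realType}.
Variable A : R.
Hypothesis A1 : 1 <= A.

(** This is ]1, 6 * A + 1[ x ]- 3 * A, 3 * A[, which contains the support of the
    field, is high enough for displacements of length 1, and avoids the origin. *)
Let Omega : set (R * R) := square (3 * A + 1, 0) (3 * A).
Let X : R * R -> R * R := vertical_field (plateau A) cutoff.

Lemma square_box : Omega = [set q | in_box 1 (6 * A + 1) (3 * A) q].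
Proof.
apply/seteqP; split => -[x y]; rewrite /Omega /square /in_box /= !ltr_norml.
  by move=> [/andP[h1 h2] /andP[h3 h4]]; apply/and4P; split; lra.
by move=> /and4P[h1 h2 h3 h4]; split; apply/andP; split; lra.
Qed.

Lemma compactly_supported_vertical : compactly_contained [set q | X q != 0] Omega.
Proof.
have A1' := A1.
pose K := closed_square ((3 * A + 1, 0) : R * R) (3 * A - 1).
have XK : closure [set q | X q != 0] `<=` K.
  rewrite closureE; apply: smallest_sub; first exact: closed_closed_square.
  move=> [x y] /= X0; rewrite /K /closed_square /= subr0.
  have p0 : plateau A x != 0.
    by apply: contra X0 => /eqP p0; rewrite /X /vertical_field /= p0 mul0r.
  have c0 : cutoff y != 0.
    by apply: contra X0 => /eqP c0; rewrite /X /vertical_field /= c0 mulr0.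
  have y2 : `|y| < 2 by rewrite ltNge; apply: contra c0 => /cutoff_eq0 ->.
  have x2 : 2 < x by rewrite ltNge; apply: contra p0 => /(plateau_eq0l A1) ->.
  have x5 : x < 5 * A by rewrite ltNge; apply: contra p0 => /(plateau_eq0r A1) ->.
  split; last lra.
  by rewrite ler_norml; apply/andP; split; lra.
split.
  by apply: (subclosed_compact _ (compact_closed_square (c := _) (rho := _)) XK); exact: closed_closure.
by move=> q /XK[h1 h2]; split; lra.
Qed.

Lemma is_C2c_vertical : is_Ckc 2 Omega X.
Proof.
split; last exact: compactly_supported_vertical.
by apply: is_C2_vertical; [exact: C2_plateau|exact: C2_cutoff].
Qed.

Definition vertical_flow (t : R) (q : R * R) : R * R :=
  (q.1, line_flow (t * plateau A q.1) q.2).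

Lemma is_flow_vertical : is_flow X vertical_flow.
Proof.
move=> [x y]; split => [|t]; first by rewrite /vertical_flow /= mul0r line_flow0.
have dt : is_derive t (1 : R) (fun t : R => t * plateau A x) (plateau A x).
  by apply: is_derive_eq; rewrite /GRing.scale/=; lra.
have dl := @is_derive1_comp _ _ (fun t : R => t * plateau A x) _ _ _ (is_derive_line_flow (t * plateau A x) y) dt.
have [dv ev] := is_diff_pair (is_diff_cst x t) (is_diff_line dl).
apply: DeriveDef; first exact: diff_derivable.
by rewrite deriveE// ev /X /vertical_field /vertical_flow /= mul1r mulrC.
Qed.

(** On the columns x < 0 the flow is trivial. On a column x > 0 it is an
    increasing bijection of the line, which sends the end point 0 of the
    half-line to t * plateau A x, because this number stays in [-1, 1]. *)
Lemma vertical_flow_cross (t : R) : `|t| <= 1 ->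
  vertical_flow t @` cross R = [set q | in_graph_cross (fun x => t * plateau A x) q].
Proof.
move=> t1.
have small x : `|t * plateau A x| <= 1.
  by rewrite normrM -[leRHS]mulr1 ler_pM// plateau_norm_le1.
have left x : x < 0 -> t * plateau A x = 0.
  by move=> x0; have A1' := A1; rewrite (plateau_eq0l A1) ?mulr0//; lra.
apply/seteqP; split => [q [[x y]] /=|[x y]].
  rewrite /cross /= => xy <-; rewrite /in_graph_cross /vertical_flow /=.
  have [x0|x0|x0] := ltgtP x 0; last by move: xy; rewrite x0 mul0r ltxx.
    by rewrite left// line_flow0/=; move: xy; rewrite nmulr_rgt0.
  move: xy; rewrite pmulr_rgt0// => y0.
  by rewrite orbF -{1}(line_flow_origin (small x)) line_flow_lt.
rewrite /= /in_graph_cross /= => /orP[/andP[x0 y0]|/andP[x0 y0]].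
  exists (x, line_flow (- (t * plateau A x)) y).
    rewrite /cross /= pmulr_rgt0// -(line_flowN (t * plateau A x) 0) line_flow_lt//.
    by rewrite line_flow_origin.
  by rewrite /vertical_flow /= -[X in line_flow X]opprK line_flowN.
exists (x, y); first by rewrite /cross /= nmulr_rgt0.
by rewrite /vertical_flow /= left// line_flow0.
Qed.

Lemma is_second_variation_vertical (s : R) : 0 < s -> s <= 4^-1 ->
  is_second_variation s (cross R) Omega vertical_flow
    (bump_mass * (same_energy A s - opposite_energy A s)).
Proof.
move=> s0 s1.
have PE t : `|t| <= 1 -> Per_along s (cross R) Omega vertical_flow t = box_perimeter A s t.
  by move=> t1; rewrite /Per_along vertical_flow_cross// square_box.
have near_unit (t : R) : `|t| < 1 -> \forall t' \near t, `|t'| < 1.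
  rewrite ltr_norml => t1; have : t \in `]-1, 1[ by rewrite in_itv.
  by move=> /near_in_itvoo; apply: filterS => t'; rewrite in_itv/= ltr_norml.
pose Q := fine \o box_perimeter A s.
pose P t := fine (Per_along s (cross R) Omega vertical_flow t).
have QP (t : R) : `|t| < 1 -> \forall t' \near t, Q t' = P t'.
  by move=> /near_unit; apply: filterS => t' /ltW h; rewrite /P PE.
have dP (t : R) : `|t| < 1 -> is_derive t (1 : R) P (derive1 Q t).
  move=> t1; apply: (near_eq_is_derive (QP t t1)).
  by rewrite derive1E; exact: (DeriveDef (derivable_box_perimeter A1 s0 s1 t1) erefl).
have n0 : `|0 : R| < 1 by rewrite normr0.
split.
  move: (near_unit 0 n0); apply: filterS => t t1; split.
    by rewrite PE ?(ltW t1)//; apply: box_perimeter_lty => //; exact: ltW.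
  by case: (dP t t1).
apply: (near_eq_is_derive _ (second_derive_box_perimeter A1 s0 s1)).
move: (near_unit 0 n0); apply: filterS => t t1.
by rewrite [RHS]derive1E; case: (dP t t1) => _ ->.
Qed.

End variation.

Theorem proposition5p1 (R : realType) :
  exists s0 : R, (0 < s0 /\ s0 < 2^-1) /\
    forall s : R, 0 < s -> s < s0 ->
      ~ stable s (cross R) (~` [set (0 : R * R)]).
Proof.
(* With A = 2 ^ (n + 2) the opposite side energy is at least n / 18, which must
   exceed the bound on the same side energy. *)
have [n kn] : exists n : nat, 40 * @kappa_mass R < n%:R / 18.
  exists (Num.bound `|40 * @kappa_mass R * 18|); rewrite ltr_pdivlMr//.
  exact: le_lt_trans (ler_norm _) (archi_boundP (normr_ge0 _)).
have n4 : (4 : R) <= n.+4%:R by rewrite ler_nat.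
have n0 : (0 : R) < n.+4%:R by rewrite ltr0n.
have n4' : n.+4%:R^-1 <= 4^-1 :> R by rewrite lef_pV2 ?posrE.
exists n.+4%:R^-1; split; first by rewrite invr_gt0; split => //; apply: (le_lt_trans n4'); lra.
move=> s s0 sn stab.
have s1 : s <= 4^-1 by rewrite (le_trans (ltW sn)).
have sn1 : s * n.+4%:R <= 1 by rewrite -ler_pdivlMr// div1r ltW.
pose A : R := 2 ^+ n.+2.
have A1 : 1 <= A by rewrite exprn_ege1// ler1n.
have r0 : 0 < 3 * A by lra.
have O0 : compactly_contained (square (3 * A + 1, 0) (3 * A)) (~` [set (0 : R * R)]).
  by apply: compactly_contained_square; rewrite /= ltrDl.
have sv : is_second_variation s (cross R) (square (3 * A + 1, 0) (3 * A)) (vertical_flow A)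
    (bump_mass * (same_energy A s - opposite_energy A s)).
  exact: is_second_variation_vertical.
have := stab _ (bounded_lipschitz_domain_square _ r0) O0 _ (is_C2c_vertical A1)
  _ (is_flow_vertical A) _ sv.
have s01 : 0 <= s <= 2^-1 by apply/andP; split; lra.
by rewrite leNgt second_variation_lt0.
Qed.
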